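(* Let $q$ be a prime power, let $\mathbb{F}_q$ be the field with $q$ elements, and let $\mathbb{F}_q\langle x,y\rangle$ be the free (unital) associative algebra on two generators. For $n\ge1$ let $p_n$ be the number of $\mathbb{F}_q$-automorphisms $\varphi=(f,g)$ of $\mathbb{F}_q\langle x,y\rangle$ with $\max\{\deg(f),\deg(g)\}=n$. Then: (i) \[ p_1=q^3(q-1)^2(q+1),\qquad p_n=(q(q-1)(q+1))^2\sum \left(\frac{q-1}{q}\right)^k q^{n_1+\cdots+n_k}\quad (n>1), \] where the summation is over all ordered factorizations $n=n_1\cdots n_k$ of $n$ with $n_1,\ldots,n_k>1$ (over all possible lengths $k\ge1$). (ii) \[ \sum_{n\geq 1}\frac{p_n}{n^s} =(q(q-1)(q+1))^2\left(\frac{1}{1-\frac{q-1}{q}\rho(s)}-\frac{1}{q+1}\right),\qquad \rho(s)=\sum_{n\geq 2}\frac{q^n}{n^s}. \] (iii) For $n\ge2$, \[ (q-1)^3(q+1)^2q^{n+1}\leq p_n\leq (q-1)^3(q+1)^2q^{n+1}+(\log_2 n)^{\log_2 n}q^{n/2+8}, \] and for fixed $q$ and any $\varepsilon>0$, $p_n=(q-1)^3(q+1)^2q^{n+1}+\mathcal{O}(q^{n(1/2+\varepsilon)})$ as $n\to\infty$.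
   Context: An automorphism $\varphi$ of $\mathbb{F}_q\langle x,y\rangle$ is written $\varphi=(f,g)$, meaning $f=\varphi(x)$, $g=\varphi(y)$; all automorphisms are $\mathbb{F}_q$-algebra automorphisms. Here $\deg$ is the total degree of a noncommutative polynomial. Dirichlet series are formal: $\sum_{n\ge1}a_n n^{-s}$ encodes the sequence $(a_n)_{n\ge1}$ of rational numbers, addition is coefficientwise, and multiplication is Dirichlet convolution (the coefficient at $n$ of a product is $\sum_{ij=n}a_ib_j$). A constant $c$ denotes the series with coefficient $c$ at $n=1$ and $0$ elsewhere. Since $\rho(s)$ has zero coefficient at $n=1$, the series $1-\frac{q-1}{q}\rho(s)$ is invertible in this ring. No convergence is claimed. *)

(* Defs.v *)
From HB Require Import structures.
From mathcomp Require Import all_boot all_order all_algebra.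
(* The notations of monalg clash with those of mathcomp-analysis. *)
From mathcomp Require Import -(notations) monalg.
From mathcomp Require Import finmap.
From mathcomp Require Import all_classical all_reals all_analysis.

Set Implicit Arguments.
Unset Strict Implicit.
Unset Printing Implicit Defensive.

Import GRing.Theory Num.Theory.
Import numFieldNormedType.Exports.

Local Open Scope classical_set_scope.
Local Open Scope ring_scope.

(* F<x,y>: the monoid algebra over F of the free monoid on two letters. *)
Notation freeAlg2 F := (malg (fmonom 'I_2) F).

Definition fx (F : nzRingType) : freeAlg2 F := mkmalgU (fmu (0 : 'I_2)) 1.
Definition fy (F : nzRingType) : freeAlg2 F := mkmalgU (fmu (1 : 'I_2)) 1.

(* [mmeasure] is 1 plus the largest length of a word in the support, and 0 for
   the zero polynomial; thus fdegree 0 = 0. *)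
Definition fdegree (F : nzRingType) (f : freeAlg2 F) : nat :=
  (mmeasure (@fdeg 'I_2) f).-1.

Definition is_alg_automorphism (F : nzRingType)
    (phi : freeAlg2 F -> freeAlg2 F) : Prop :=
  [/\ linear phi, monoid_morphism phi & bijective phi].

Definition automorphisms_of_degree (F : nzRingType) (n : nat) :
    set (freeAlg2 F -> freeAlg2 F) :=
  [set phi | is_alg_automorphism phi /\
             maxn (fdegree (phi (fx F))) (fdegree (phi (fy F))) = n].
Arguments automorphisms_of_degree F n : clear implicits.

(* An infinite set would be counted as 0. *)
Definition num_automorphisms (F : nzRingType) (n : nat) : nat :=
  #|` fset_set (automorphisms_of_degree F n) |.

Definition ordered_factorizations (n : nat) : set (seq nat) :=
  [set s | [/\ (0 < size s)%N, all (ltn 1) s & (\prod_(m <- s) m)%N = n]].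

(* Formal Dirichlet series over rat; the function k |-> a (k+1) stands for
   \sum_(n >= 1) a_n / n^s, so a series is exactly a sequence indexed by the
   positive integers. *)
Definition dirichlet : Type := nat -> rat.

Definition dseries (a : nat -> rat) : dirichlet := fun k => a k.+1.

Definition dconst (c : rat) : dirichlet := dseries (fun n => c *+ (n == 1)%N).

Definition dmul (a b : dirichlet) : dirichlet := fun k =>
  \sum_(i < k.+1) \sum_(j < k.+1 | (i.+1 * j.+1 == k.+1)%N) a i * b j.

HB.instance Definition _ := GRing.Zmodule.copy dirichlet (nat -> rat).

Lemma dseriesP (a b : dirichlet) : (forall k, a k = b k) -> a = b.
Proof. exact: funext. Qed.

Lemma daddE (a b : dirichlet) k : (a + b) k = a k + b k.
Proof. by []. Qed.

Lemma dmul_widen N (a b : dirichlet) k : (k < N)%N ->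
  dmul a b k =
    \sum_(i < N) \sum_(j < N) if (i.+1 * j.+1 == k.+1)%N then a i * b j else 0.
Proof.
move=> kN; rewrite /dmul.
pose G i j : rat := if (i.+1 * j.+1 == k.+1)%N then a i * b j else 0.
have G0 i j : (k.+1 <= i)%N || (k.+1 <= j)%N -> G i j = 0.
  rewrite /G; case: eqP => // e /orP[] h; exfalso; move: h;
    by rewrite -ltnS -e ltnNge ?leq_pmulr ?leq_pmull.
under eq_bigr do rewrite big_mkcond /=.
rewrite -(big_mkord xpredT (fun i => \sum_(j < k.+1) G i j)).
rewrite -(big_mkord xpredT (fun i => \sum_(j < N) G i j)).
rewrite (big_cat_nat (n := k.+1) (p := N)) //=.
rewrite [X in _ + X]big_nat_cond [X in _ + X]big1 ?addr0; last first.
  by move=> i /andP[/andP[ki _] _]; apply: big1 => j _; rewrite G0 // ki.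
apply: eq_bigr => i _.
rewrite -(big_mkord xpredT (G i)) -(big_mkord xpredT (G i)).
rewrite [RHS](big_cat_nat (n := k.+1)) //=.
rewrite [X in _ + X]big_nat_cond [X in _ + X]big1 ?addr0 //.
by move=> j /andP[/andP[kj _] _]; rewrite G0 // kj orbT.
Qed.

Lemma dmulC : commutative dmul.
Proof.
move=> a b; apply: dseriesP => k.
rewrite !(dmul_widen _ _ (ltnSn k)) exchange_big /=.
apply: eq_bigr => i _; apply: eq_bigr => j _.
by rewrite mulnC [a j * _]mulrC.
Qed.

Lemma dmul3 (a b c : dirichlet) k :
  dmul (dmul a b) c k =
  \sum_(i < k.+1) \sum_(j < k.+1) \sum_(l < k.+1)
    if (i.+1 * j.+1 * l.+1 == k.+1)%N then a i * b j * c l else 0.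
Proof.
rewrite (dmul_widen _ _ (ltnSn k)).
transitivity (\sum_(m < k.+1) \sum_(l < k.+1) \sum_(i < k.+1) \sum_(j < k.+1)
  if (i.+1 * j.+1 == m.+1)%N && (m.+1 * l.+1 == k.+1)%N
  then a i * b j * c l else 0).
  apply: eq_bigr => m _; apply: eq_bigr => l _.
  case: ifP => _; last first.
    by rewrite big1 // => i _; rewrite big1 // => j _; rewrite andbF.
  rewrite (dmul_widen _ _ (ltn_ord m)) mulr_suml; apply: eq_bigr => i _.
  rewrite mulr_suml; apply: eq_bigr => j _.
  by rewrite andbT; case: ifP => // _; rewrite mul0r.
under eq_bigr do rewrite exchange_big /=.
rewrite exchange_big /=; apply: eq_bigr => i _.
under eq_bigr do rewrite exchange_big /=.
rewrite exchange_big /=; apply: eq_bigr => j _.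
rewrite exchange_big /=; apply: eq_bigr => l _.
case: (eqVneq (i.+1 * j.+1 * l.+1)%N k.+1) => [e|ne]; last first.
  rewrite big1 // => m _; case: ifP => // /andP[/eqP e1 /eqP e2].
  by move: ne; rewrite e1 e2 eqxx.
have lt : ((i.+1 * j.+1).-1 < k.+1)%N.
  rewrite prednK ?muln_gt0 //.
  by have := leq_pmulr (i.+1 * j.+1) (ltn0Sn l); rewrite e.
have [m0 e0] : exists m0 : 'I_k.+1, m0.+1 = (i.+1 * j.+1)%N.
  by exists (Ordinal lt).
rewrite (bigD1 m0) //= e0 eqxx e eqxx /= big1 ?addr0 // => m /eqP ne.
case: ifP => // /andP[/eqP e1 _]; case: ne; apply: val_inj.
by apply: succn_inj; rewrite -e1 -e0.
Qed.

Lemma dmulA : associative dmul.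
Proof.
move=> a b c; apply: dseriesP => k.
rewrite [dmul a _]dmulC !dmul3.
under eq_bigr do rewrite exchange_big /=.
rewrite exchange_big /=; apply: eq_bigr => i _; apply: eq_bigr => j _.
apply: eq_bigr => l _.
by rewrite [(_ * i.+1)%N]mulnC mulnA [_ * a i]mulrC mulrA.
Qed.

Lemma dmul1 : left_id (dconst 1) dmul.
Proof.
move=> a; apply: dseriesP => k; rewrite /dmul.
rewrite (bigD1 ord0) //= (bigD1 ord_max) ?mul1n //= [X in _ + X + _]big1.
  rewrite big1 ?addr0 ?mul1r // => i i0; apply: big1 => j _.
  rewrite /dconst /dseries eqSS; case: eqP => [e|_]; last by rewrite mul0r.
  by case/eqP: i0; apply: val_inj.
move=> j /andP[]; rewrite mul1n eqSS => /eqP e /eqP ne; case: ne.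
exact: val_inj.
Qed.

Lemma dmulDl : left_distributive dmul +%R.
Proof.
move=> a b c; apply: dseriesP => k; rewrite daddE /dmul -big_split /=.
apply: eq_bigr => i _; rewrite -big_split /=.
by apply: eq_bigr => j _; rewrite daddE mulrDl.
Qed.

Lemma dconst1_neq0 : dconst 1 != 0.
Proof. by apply/eqP => /(congr1 (fun a : dirichlet => a 0%N)). Qed.

HB.instance Definition _ := GRing.Zmodule_isComNzRing.Build dirichlet
  dmulA dmulC dmul1 dmulDl dconst1_neq0.

(* Coefficients of the inverse of a series with a_1 <> 0, from
   \sum_(ij = n) a_i b_j = 0 for n > 1; the first argument is fuel. *)
Fixpoint dinv_rec (m : nat) (a : dirichlet) (k : nat) : rat :=
  if m is m'.+1 then
    (a 0%N)^-1 * ((k == 0%N)%:R -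
      \sum_(i < k.+1) \sum_(j < k | (i.+1 * j.+1 == k.+1)%N)
        a i * dinv_rec m' a j)
  else 0.

Definition dunit : pred dirichlet := fun a => a 0%N != 0.

Definition dinv (a : dirichlet) : dirichlet :=
  if a \in dunit then fun k => dinv_rec k.+1 a k else a.

Lemma dinv_rec_fuel a m m' k : (k < m)%N -> (k < m')%N ->
  dinv_rec m a k = dinv_rec m' a k.
Proof.
elim: m m' k => // m IH [//|m'] k; rewrite !ltnS => km km' /=.
congr (_ * (_ - _)); apply: eq_bigr => i _; apply: eq_bigr => j _.
by rewrite (IH m') // (leq_trans (ltn_ord j)).
Qed.

Lemma dmulVr : {in dunit, left_inverse (1 : dirichlet) dinv *%R}.
Proof.
move=> a ua; rewrite mulrC; apply: dseriesP => k.
have a0 : a 0%N != 0 by [].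
have dinvE j : dinv a j = dinv_rec j.+1 a j by rewrite /dinv ua.
rewrite [LHS]/(dmul a (dinv a) k) [RHS]/(_ *+ _) eqSS /dmul.
pose S := \sum_(i < k.+1) \sum_(j < k | (i.+1 * j.+1 == k.+1)%N)
  a i * dinv_rec k a j.
transitivity (S + a 0%N * dinv a k); last first.
  by rewrite dinvE /= mulrA mulfV // mul1r addrC subrK.
transitivity (\sum_(i < k.+1) ((\sum_(j < k | (i.+1 * j.+1 == k.+1)%N)
    a i * dinv_rec k a j) +
    if i == 0%N :> nat then a i * dinv a k else 0)).
  apply: eq_bigr => i _; rewrite big_mkcond big_ord_recr /= -big_mkcond /=.
  congr (_ + _).
    apply: eq_bigr => j _; rewrite dinvE; congr (_ * _).
    exact: (@dinv_rec_fuel a j.+1 k j).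
  by rewrite -[X in _ == X]mul1n eqn_pmul2r.
rewrite big_split /= -/S; congr (_ + _).
by rewrite big_ord_recl /= big1 ?addr0.
Qed.

Lemma dunitPl (a b : dirichlet) : b * a = 1 -> a \in dunit.
Proof.
move=> /(congr1 (fun c : dirichlet => c 0%N)).
rewrite [X in X = _]/(dmul b a 0%N) /dmul big_ord1 (bigD1 ord0) //= big1.
  rewrite addr0 => e; apply/eqP => a0; move: e; rewrite a0 mulr0 => /eqP.
  by rewrite eq_sym oner_eq0.
by move=> j /andP[_]; rewrite ord1.
Qed.

Lemma dinv_out : {in [predC dunit], dinv =1 id}.
Proof. by move=> a; rewrite inE /dinv => /negbTE ->. Qed.

HB.instance Definition _ := GRing.ComNzRing_hasMulInverse.Build dirichlet
  dmulVr dunitPl dinv_out.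

Lemma dirichlet_unitE (a : dirichlet) : (a \is a GRing.unit) = (a 0%N != 0).
Proof. by []. Qed.

(* rho(s) = \sum_(n >= 2) q^n / n^s *)
Definition rho (q : nat) : dirichlet :=
  dseries (fun n => if (2 <= n)%N then q%:R ^+ n else 0).

Lemma one_sub_rho_unit (q : nat) (c : rat) :
  (1 : dirichlet) - dconst c * rho q \is a GRing.unit.
Proof.
rewrite dirichlet_unitE.
have e : dmul (dconst c) (rho q) 0%N = 0.
  by rewrite /dmul big1 // => i _; rewrite big1 // => j _; rewrite (ord1 j) mulr0.
have -> : ((1 : dirichlet) - dconst c * rho q) 0%N =
    1 - dmul (dconst c) (rho q) 0%N by [].
by rewrite e subr0 oner_neq0.
Qed.

Definition log2 (R : realType) (x : R) : R := ln x / ln 2.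

(* Main.v *)
Require Import Defs.
From HB Require Import structures.
From mathcomp Require Import all_boot all_order all_algebra all_fingroup finfield.
From mathcomp Require Import finmap.
From mathcomp Require Import -(notations) monalg.
From mathcomp Require Import all_classical all_reals all_analysis.
From mathcomp Require Import zify ring lra.

(* Words are compared degree-lexicographically. Let (f, g) be the images of the
   generators under an automorphism. If the leading words of f and g do not
   commute, distinct words in f and g have distinct leading words, so the single
   letters can only be reached when f and g have degree 1. Otherwise the leading
   words are powers m^i and m^j of one primitive word m, and the main point is
   that i divides j or j divides i. If not, the commutator [f, g] is non-zero and
   its leading word w is not a power of m. Starting from H = g, one replaces H by
   a power of H minus elements whose leading words are powers of m, as with key
   polynomials, following the leading word of [f, H], until the leading word of H
   is no longer a power of m. Then the algebra is spanned by elements with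
   distinct leading words, at most one of which is a letter, a contradiction.
   Hence the larger of f and g is reduced in degree by subtracting c f^k.

   Consequently, for fixed deg f = d, allowing deg g < (k + 1) d instead of
   deg g < k d multiplies the number of pairs by q. This gives a recursion over
   divisors starting from the affine pairs, whose solution is the sum over ordered
   factorizations and whose Dirichlet series is the inverse of 1 - (q - 1)/q rho.
   For the upper bound, a factorization of length at least 2 has sum at most
   n/2 + 2, and there are at most n^2 <= (log2 n)^(log2 n) of them if n >= 16. *)

Import Order.TTheory GRing.Theory Num.Theory.
Import numFieldNormedType.Exports.

Local Open Scope classical_set_scope.

Set Implicit Arguments.
Unset Strict Implicit.
Unset Printing Implicit Defensive.

(** * Words and their roots *)

(** The obstacle is positive characteristic. The commutator [[f, g ^+ n]] is a sum of [n] terms, and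
    when all leading words are powers of [m] their top coefficients add up to a multiple of [n],
    which may vanish. This forces two stages. To see that the leading word of [[f, g]] is not a
    power of [m], a pair whose exponents have gcd [e] is replaced by a pair with smaller gcd. The
    exponents divided by [e] are coprime, so the characteristic [p] fails to divide one of them; and
    a product [f ^+ a * g ^+ b] with [p] dividing [b] but not [a] lets just one of two competing top
    terms survive. Once the leading word [w] of the commutator does not commute with [m], the terms
    of [[f, H ^+ n]] have distinct leading words and no integer coefficient appears. Which term wins
    depends on the order between [m w] and [w m]; one case is treated, and the other is its mirror
    image, which is why everything is stated for an abstract algebra with leading words. *)

Section Words.
Variable T : eqType.
Implicit Types (u v w m : seq T).

Definition wpow m n : seq T := iter n (cat m) [::].

Lemma wpowD m a b : wpow m (a + b) = wpow m a ++ wpow m b.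
Proof. by elim: a => // a IH; rewrite addSn /= IH catA. Qed.

Lemma wpow1 m : wpow m 1 = m.
Proof. exact: cats0. Qed.

Lemma size_wpow m n : size (wpow m n) = (n * size m)%N.
Proof. by elim: n => // n IH; rewrite /= size_cat IH mulSn. Qed.

Lemma wpowM m a b : wpow m (a * b) = wpow (wpow m b) a.
Proof. by elim: a => // a IH; rewrite mulSn wpowD /= IH. Qed.

Definition wcomm u v := u ++ v == v ++ u.

Lemma wcommC u v : wcomm u v = wcomm v u.
Proof. by rewrite /wcomm eq_sym. Qed.

Lemma wcomm_refl u : wcomm u u.
Proof. by rewrite /wcomm. Qed.

Lemma wcomm_nil u : wcomm u [::].
Proof. by rewrite /wcomm cats0. Qed.

Lemma wcomm_cat u a b : wcomm u a -> wcomm u b -> wcomm u (a ++ b).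
Proof.
rewrite /wcomm => /eqP e1 /eqP e2.
by rewrite catA e1 -catA e2 catA.
Qed.

Lemma wcomm_wpow u a n : wcomm u a -> wcomm u (wpow a n).
Proof. by move=> h; elim: n => [|n IH] /=; [exact: wcomm_nil|exact: wcomm_cat]. Qed.

Lemma wcomm_take u a : wcomm u a -> (size a <= size u)%N -> a = take (size a) u.
Proof.
move=> /eqP e le; have := congr1 (take (size a)) e.
by rewrite takel_cat // take_size_cat.
Qed.

(** A word commuting with [u] commutes with the powers of [u], so it is a prefix of a long enough
    one and its length determines it. *)
Lemma wcomm_det u a b : u != [::] -> wcomm u a -> wcomm u b ->
  size a = size b -> a = b.
Proof.
move=> nu ca cb sab.
have hu : (0 < size u)%N by case: (u) nu.
have key c : wcomm u c -> (size c <= size a)%N -> c = take (size c) (wpow u (size a)).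
  move=> cc le; apply: wcomm_take; last first.
    by rewrite size_wpow (leq_trans le) // leq_pmulr.
  by rewrite wcommC; apply: wcomm_wpow; rewrite wcommC.
by rewrite (key a ca) // [RHS](key b cb) sab.
Qed.

(** Both [a ++ b] and [b ++ a] commute with [u], and they have the same length. *)
Lemma wcomm_trans u a b : u != [::] -> wcomm u a -> wcomm u b -> wcomm a b.
Proof.
move=> nu ca cb; apply/eqP; apply: (wcomm_det nu); try exact: wcomm_cat.
by rewrite !size_cat addnC.
Qed.

Lemma wcomm_wpow_inv u v n : wcomm (wpow u n.+1) v -> wcomm u v.
Proof.
have [->|nu] := eqVneq u [::]; first by rewrite /wcomm cats0.
move=> h; apply: (@wcomm_trans (wpow u n.+1)) => //.
- by case: (u) nu.
- by rewrite wcommC; apply: wcomm_wpow; apply: wcomm_refl.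
Qed.

(** A primitive word, encoded by its centralizer rather than by the absence of proper roots. *)
Definition wroot m := m != [::] /\ forall v, wcomm m v -> exists j, v = wpow m j.

(** The root is the shortest non-empty prefix of [u] that commutes with [u]. By minimality every
    non-empty word commuting with it is at least as long, hence starts with it, and the root can be
    peeled off. *)
Lemma wroot_exists u : u != [::] -> exists m i, wroot m /\ u = wpow m i.
Proof.
move=> nu.
have hu : (0 < size u)%N by case: (u) nu.
pose p n := [&& 0 < n, n <= size u & wcomm u (take n u)]%N.
have exP : exists n, p n.
  by exists (size u); rewrite /p hu leqnn take_size wcomm_refl.
have [n /and3P[n0 nle cn] nmin] := ex_minnP exP.
pose m := take n u.
have sm : size m = n by rewrite size_takel.
have nm : m != [::] by rewrite -size_eq0 sm -lt0n.
have root v : wcomm m v -> exists j, v = wpow m j.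
  move: {-1}(size v) (leqnn (size v)) => k; elim: k v => [|k IH] v.
    by rewrite leqn0 size_eq0 => /eqP -> _; exists 0%N.
  move=> sv cv.
  have [->|nv] := eqVneq v [::]; first by exists 0%N.
  have sv0 : (0 < size v)%N by case: (v) nv.
  have cuv : wcomm u v by apply: (wcomm_trans nm) => //; rewrite wcommC.
  have le : (n <= size v)%N.
    rewrite leqNgt; apply/negP => lt.
    have le' : (size v <= size u)%N by apply: leq_trans (ltnW lt) nle.
    have ev := wcomm_take cuv le'.
    have /nmin : p (size v) by rewrite /p sv0 le' -ev cuv.
    by rewrite leqNgt lt.
  have em : m = take n v.
    by rewrite -sm; apply: wcomm_take; [rewrite wcommC|rewrite sm].
  have dv : v = m ++ drop n v by rewrite em cat_take_drop.
  have cd : wcomm m (drop n v).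
    move: cv; rewrite dv /wcomm -catA eqseq_cat // => /andP[_].
    by rewrite drop_size_cat ?sm.
  have [|j ej] := IH (drop n v) _ cd.
    by rewrite size_drop leq_subLR (leq_trans sv) // -add1n leq_add2r.
  by exists j.+1; rewrite /= -ej.
have [i ei] : exists i, u = wpow m i by apply: root; rewrite wcommC.
by exists m, i.
Qed.

Lemma wroot_size m : wroot m -> (0 < size m)%N.
Proof. by case; case: m. Qed.

Lemma wpow_inj m a b : wroot m -> wpow m a = wpow m b -> a = b.
Proof.
move=> /wroot_size hm /(congr1 size); rewrite !size_wpow => /eqP.
by rewrite eqn_pmul2r // => /eqP.
Qed.

(** A list of booleans records one way of writing the word as a product of copies of [u] and [v];
    freeness of the pair then becomes injectivity of the decoding. *)
Definition wgen u v w := exists l : seq bool, w = flatten [seq if b then u else v | b <- l].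

Lemma wgenC u v w : wgen u v w -> wgen v u w.
Proof.
case=> l ->; exists (map negb l); rewrite -map_comp; congr flatten.
by apply: eq_map => -[].
Qed.

Lemma wgen_nil u v : wgen u v [::].
Proof. by exists [::]. Qed.

Lemma wgen_l u v w : wgen u v w -> wgen u v (u ++ w).
Proof. by case=> l ->; exists (true :: l). Qed.

Lemma wgen_r u v w : wgen u v w -> wgen u v (v ++ w).
Proof. by move/wgenC/wgen_l/wgenC. Qed.

Lemma wgen_pow u v w n : wgen u v w -> wgen u v (wpow u n ++ w).
Proof. by move=> h; elim: n => //= n IH; rewrite -catA; apply: wgen_l. Qed.

Lemma wgen_sub u v w : wgen u (u ++ v) w -> wgen u v w.
Proof.
case=> l ->; elim: l => [|[] l IH] /=; first exact: wgen_nil.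
  exact: wgen_l.
by rewrite -catA; apply: wgen_l; apply: wgen_r.
Qed.

(* Two words with a non-trivial relation commute: the relation survives the
   Euclidean step (u, u ++ v) -> (u, v). *)
Lemma wgen_relation u v X Y : wgen u v X -> wgen u v Y -> u ++ X = v ++ Y -> wcomm u v.
Proof.
move: {-1}(size u + size v)%N (leqnn (size u + size v)) => k.
elim: k u v X Y => [|k IH] u v X Y.
  by rewrite leqn0 addn_eq0 !size_eq0 => /andP[/eqP -> /eqP ->].
wlog le : u v X Y / (size u <= size v)%N.
  move=> H sz gX gY e; have [le|/ltnW le] := leqP (size u) (size v).
    exact: (H u v X Y).
  by rewrite wcommC; apply: (H v u Y X) => //; rewrite 1?addnC //; apply: wgenC.
move=> sz gX gY e.
have [->|nu] := eqVneq u [::]; first by rewrite wcommC wcomm_nil.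
have su : (0 < size u)%N by case: (u) nu.
have eu : u = take (size u) v.
  by have := congr1 (take (size u)) e; rewrite take_size_cat // takel_cat.
pose v' := drop (size u) v.
have ev : v = u ++ v' by rewrite {1}eu cat_take_drop.
have e' : X = v' ++ Y.
  by move: e; rewrite {1}ev -catA => /eqP; rewrite eqseq_cat // => /andP[_ /eqP].
have gY' : wgen u v' Y by apply: wgen_sub; rewrite -ev.
have sub w : wgen u v w -> wgen u v' w by rewrite {1}ev; apply: wgen_sub.
suff c : wcomm u v' by rewrite ev; apply: wcomm_cat => //; apply: wcomm_refl.
have sz' : (size u + size v' <= k)%N.
  rewrite -ltnS (leq_trans _ sz) // ltn_add2l ev size_cat -[X in (X < _)%N]add0n.
  by rewrite ltn_add2r.
have [X0|[X2 gX2 eX]] : X = [::] \/ exists2 X2, wgen u v' X2 & X = u ++ X2.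
- case: gX => -[|b l] ->; [by left|right].
  pose t := flatten [seq if b then u else v | b <- l].
  have gt : wgen u v' t by apply: sub; exists l.
  case: b; first by exists t.
  by exists (v' ++ t); [apply: wgen_r|rewrite /= catA -ev].
- by move: e'; rewrite X0; case: (v') => // _; exact: wcomm_nil.
- by apply: (IH u v' X2 Y) => //; rewrite -eX.
Qed.

(** At the first place where two codes differ, cancellation leaves a relation [u ++ X = v ++ Y],
    excluded by [wgen_relation]. *)
Lemma wgen_inj u v : ~~ wcomm u v ->
  injective (fun l : seq bool => flatten [seq if b then u else v | b <- l]).
Proof.
move=> nc.
have nu : u != [::] by apply: contraNneq nc => ->; rewrite wcommC wcomm_nil.
have nv : v != [::] by apply: contraNneq nc => ->; rewrite wcomm_nil.
elim=> [|a l IH] [|b l'] //=.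
- by case: b; [case: (u) nu|case: (v) nv].
- by case: a; [case: (u) nu|case: (v) nv].
have g x : wgen u v (flatten [seq if b then u else v | b <- x]) by exists x.
case: a b => [] [] e.
- by move/eqP: e; rewrite eqseq_cat // eqxx => /eqP/IH ->.
- by case/negP: nc; apply: wgen_relation e.
- by case/negP: nc; apply: wgen_relation (esym e).
- by move/eqP: e; rewrite eqseq_cat // eqxx => /eqP/IH ->.
Qed.

(** The word m^t0 w m^t1 w m^t2 ..., the shape of the leading words in the final spanning set. *)
Definition wtower m w t0 ts : seq T :=
  wpow m t0 ++ flatten [seq w ++ wpow m t | t <- ts].

Lemma wgen_tower m w t0 ts : wgen m w (wtower m w t0 ts).
Proof.
rewrite /wtower; apply: wgen_pow.
elim: ts => [|t ts IH] /=; first exact: wgen_nil.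
by rewrite -catA; apply: wgen_r; apply: wgen_pow.
Qed.

Lemma wtower_cons m w t0 t ts :
  wtower m w t0 (t :: ts) = wpow m t0 ++ w ++ wtower m w t ts.
Proof. by rewrite /wtower /= -!catA. Qed.

Lemma wtower_inj m w t0 ts t0' ts' : ~~ wcomm m w ->
  wtower m w t0 ts = wtower m w t0' ts' -> t0 = t0' /\ ts = ts'.
Proof.
move=> nc.
have nm : m != [::] by apply: contraNneq nc => ->; rewrite wcommC wcomm_nil.
have nw : w != [::] by apply: contraNneq nc => ->; rewrite wcomm_nil.
(* If [a < b], cancelling m^a leaves a word that is empty or starts with [w] on one side and starts
   with [m] on the other, which is a non-trivial relation between [m] and [w]. *)
have head a b us us' : wtower m w a us = wtower m w b us' -> (b <= a)%N.
  move=> e; rewrite leqNgt; apply/negP => lt; move: e.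
  rewrite -(subnKC lt) addSnnS /wtower wpowD -catA => /eqP.
  rewrite eqseq_cat // eqxx /= => /eqP.
  case: us => [|u us] /=; first by case: (m) nm.
  rewrite -!catA => e; case/negP: nc.
  apply: (wgen_relation _ _ (esym e)); last exact: (wgen_tower m w u us).
  exact: (wgen_tower m w _ us').
elim: ts t0 t0' ts' => [|t ts IH] t0 t0' ts' e.
  have et : t0 = t0' by apply/eqP; rewrite eqn_leq (head _ _ _ _ e) (head _ _ _ _ (esym e)).
  split=> //; move/eqP: e; rewrite et /wtower eqseq_cat // eqxx /=.
  by case: ts' => //= t' ts'; case: (w) nw.
have et : t0 = t0' by apply/eqP; rewrite eqn_leq (head _ _ _ _ e) (head _ _ _ _ (esym e)).
split=> //; case: ts' e => [|t' ts'].
  by rewrite et /wtower => /eqP; rewrite eqseq_cat // eqxx /=; case: (w) nw.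
rewrite !wtower_cons et => /eqP; rewrite eqseq_cat // eqxx eqseq_cat // eqxx /=.
by move=> /eqP/IH [-> ->].
Qed.
End Words.

Local Open Scope ring_scope.

(** * Leading words *)

(* An F-algebra A with a basis of monomials indexed by the words on T, and an
   enumeration ord of a degree-compatible monomial order. Keeping A abstract
   lets the left-right mirror image of the free algebra be an instance too. *)
Record wordval (T : eqType) (F : fieldType) (A : nzRingType) := WordVal {
  sc : F -> A;
  mon : seq T -> A;
  co : A -> seq T -> F;
  ord : seq T -> nat;
  sc_comm : forall c x, sc c * x = x * sc c;
  co_sc : forall c x w, co (sc c * x) w = c * co x w;
  co_add : forall x y w, co (x + y) w = co x w + co y w;
  mon_nil : mon [::] = 1;
  mon_cat : forall u v, mon (u ++ v) = mon u * mon v;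
  co_mon : forall u w, co (mon u) w = (u == w)%:R;
  co_mul : forall x y w, co (x * y) w != 0 ->
    exists u v, [/\ w = u ++ v, co x u != 0 & co y v != 0];
  co_ext : forall x, (forall w, co x w = 0) -> x = 0;
  co_bounded : forall x, exists N, forall w, co x w != 0 -> (ord w <= N)%N;
  ord_inj : injective ord;
  ord_size : forall u v, (size u < size v)%N -> (ord u < ord v)%N;
  ord_catl : forall c u v, (ord u < ord v)%N -> (ord (c ++ u) < ord (c ++ v))%N;
  ord_catr : forall c u v, (ord u < ord v)%N -> (ord (u ++ c) < ord (v ++ c))%N
}.

Section WordVal.
Variables (T : eqType) (F : fieldType) (A : nzRingType) (V : wordval T F A).
Local Notation sc := (sc V).
Local Notation mon := (mon V).
Local Notation co := (co V).
Local Notation ord := (ord V).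
Implicit Types (x y z : A) (u v w : seq T) (c d : F).

Lemma co0 w : co 0 w = 0.
Proof. by apply: (addrI (co 0 w)); rewrite -co_add !addr0. Qed.

Lemma coN x w : co (- x) w = - co x w.
Proof. by apply: (addrI (co x w)); rewrite -co_add !subrr co0. Qed.

Lemma coB x y w : co (x - y) w = co x w - co y w.
Proof. by rewrite co_add coN. Qed.

Lemma co_sum I (r : seq I) (P : pred I) (E : I -> A) w :
  co (\sum_(i <- r | P i) E i) w = \sum_(i <- r | P i) co (E i) w.
Proof. by apply: (big_morph (co^~ w)) => [x y|]; rewrite ?co_add ?co0. Qed.

Lemma co_inj x y : (forall w, co x w = co y w) -> x = y.
Proof.
move=> h; apply/eqP; rewrite -subr_eq0; apply/eqP/(@co_ext _ _ _ V) => w.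
by rewrite coB h subrr.
Qed.

Lemma sc1 : sc 1 = 1.
Proof. by rewrite -[LHS]mulr1; apply: co_inj => w; rewrite co_sc mul1r. Qed.

Lemma sc0 : sc 0 = 0.
Proof. by rewrite -[LHS]mulr1; apply: co_inj => w; rewrite co_sc mul0r co0. Qed.

Lemma sc_mulr x c y : x * (sc c * y) = sc c * (x * y).
Proof. by rewrite mulrA -sc_comm mulrA. Qed.

Lemma sc_mul c d x : sc c * (sc d * x) = sc (c * d) * x.
Proof. by apply: co_inj => w; rewrite !co_sc mulrA. Qed.

Lemma sc_add c d x : sc (c + d) * x = sc c * x + sc d * x.
Proof. by apply: co_inj => w; rewrite co_add !co_sc mulrDl. Qed.

Lemma sc_opp c x : sc (- c) * x = - (sc c * x).
Proof. by apply: co_inj => w; rewrite coN !co_sc mulNr. Qed.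

(** Bounds also hold for zero, so sums and cancellations need no case distinction; only [lead]
    asserts that the top coefficient is non-zero. *)
Definition bnd x w := forall v, co x v != 0 -> (ord v <= ord w)%N.
Definition sbnd x w := forall v, co x v != 0 -> (ord v < ord w)%N.
Definition slt n x := forall v, co x v != 0 -> (size v < n)%N.
Definition lead x w := co x w != 0 /\ bnd x w.

Lemma sbnd_bnd x w : sbnd x w -> bnd x w.
Proof. by move=> h v /h/ltnW. Qed.

Lemma sbnd_co x w : sbnd x w -> co x w = 0.
Proof. by move=> h; apply/eqP; apply/negPn/negP => /h; rewrite ltnn. Qed.

Lemma bnd_sbnd x w : bnd x w -> co x w = 0 -> sbnd x w.
Proof.
move=> h e v nv; rewrite ltn_neqAle h // andbT; apply: contraNneq nv => /ord_inj ->.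
by rewrite e.
Qed.

Lemma bnd_trans x u w : bnd x u -> (ord u <= ord w)%N -> bnd x w.
Proof. by move=> h le v /h/leq_trans; apply. Qed.

Lemma bnd_strans x u w : bnd x u -> (ord u < ord w)%N -> sbnd x w.
Proof. by move=> h le v /h/leq_ltn_trans; apply. Qed.

Lemma ne0D c d : c + d != 0 -> (c != 0) || (d != 0).
Proof. by rewrite -negb_and; apply: contraNN => /andP[/eqP-> /eqP->]; rewrite addr0. Qed.

Lemma ne0Z c d : c * d != 0 -> d != 0.
Proof. by apply: contraNneq => ->; rewrite mulr0. Qed.

Lemma bnd0 w : bnd 0 w. Proof. by move=> v; rewrite co0 eqxx. Qed.
Lemma sbnd0 w : sbnd 0 w. Proof. by move=> v; rewrite co0 eqxx. Qed.
Lemma slt0 n : slt n 0. Proof. by move=> v; rewrite co0 eqxx. Qed.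

Lemma bndD x y w : bnd x w -> bnd y w -> bnd (x + y) w.
Proof. by move=> hx hy v; rewrite co_add => /ne0D/orP[/hx|/hy]. Qed.
Lemma sbndD x y w : sbnd x w -> sbnd y w -> sbnd (x + y) w.
Proof. by move=> hx hy v; rewrite co_add => /ne0D/orP[/hx|/hy]. Qed.
Lemma sltD n x y : slt n x -> slt n y -> slt n (x + y).
Proof. by move=> hx hy v; rewrite co_add => /ne0D/orP[/hx|/hy]. Qed.

Lemma bndZ c x w : bnd x w -> bnd (sc c * x) w.
Proof. by move=> h v; rewrite co_sc => /ne0Z/h. Qed.
Lemma sbndZ c x w : sbnd x w -> sbnd (sc c * x) w.
Proof. by move=> h v; rewrite co_sc => /ne0Z/h. Qed.
Lemma bndN x w : bnd x w -> bnd (- x) w.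
Proof. by move=> h v; rewrite coN oppr_eq0 => /h. Qed.
Lemma sbndN x w : sbnd x w -> sbnd (- x) w.
Proof. by move=> h v; rewrite coN oppr_eq0 => /h. Qed.
Lemma bnd_sum I (r : seq I) (P : pred I) (E : I -> A) w :
  (forall i, P i -> bnd (E i) w) -> bnd (\sum_(i <- r | P i) E i) w.
Proof.
move=> h; elim/big_rec: _ => [|i x Pi hx]; [exact: bnd0|].
by apply: bndD => //; apply: h.
Qed.
Lemma sbnd_sum I (r : seq I) (P : pred I) (E : I -> A) w :
  (forall i, P i -> sbnd (E i) w) -> sbnd (\sum_(i <- r | P i) E i) w.
Proof.
move=> h; elim/big_rec: _ => [|i x Pi hx]; [exact: sbnd0|].
by apply: sbndD => //; apply: h.
Qed.
Lemma ord_leq_catl (c u v : seq T) : (ord u <= ord v)%N -> (ord (c ++ u) <= ord (c ++ v))%N.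
Proof.
by rewrite leq_eqVlt => /orP[/eqP/ord_inj->//|h]; apply/ltnW/ord_catl.
Qed.
Lemma ord_leq_catr (c u v : seq T) : (ord u <= ord v)%N -> (ord (u ++ c) <= ord (v ++ c))%N.
Proof.
by rewrite leq_eqVlt => /orP[/eqP/ord_inj->//|h]; apply/ltnW/ord_catr.
Qed.
Lemma ord_ltn_catr (c u v : seq T) : (ord (u ++ c) < ord (v ++ c))%N = (ord u < ord v)%N.
Proof.
apply/idP/idP; last exact: ord_catr.
by rewrite !ltnNge; apply: contraNN; apply: ord_leq_catr.
Qed.

Lemma bndM x y u v : bnd x u -> bnd y v -> bnd (x * y) (u ++ v).
Proof.
move=> hx hy w /co_mul[a [b [-> /hx ha /hy hb]]].
exact: leq_trans (ord_leq_catr b ha) (ord_leq_catl u hb).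
Qed.

Lemma sbndMl x y u v : sbnd x u -> bnd y v -> sbnd (x * y) (u ++ v).
Proof.
move=> hx hy w /co_mul[a [b [-> /hx ha /hy hb]]].
exact: leq_trans (@ord_catr _ _ _ V b _ _ ha) (ord_leq_catl u hb).
Qed.

Lemma sbndMr x y u v : bnd x u -> sbnd y v -> sbnd (x * y) (u ++ v).
Proof.
move=> hx hy w /co_mul[a [b [-> /hx ha /hy hb]]].
exact: leq_ltn_trans (ord_leq_catr b ha) (@ord_catl _ _ _ V u _ _ hb).
Qed.

Lemma slt_sbnd n x w : slt n x -> (n <= size w)%N -> sbnd x w.
Proof. by move=> h le v /h lt; apply: ord_size; apply: leq_trans le. Qed.

Lemma bnd_slt x w : bnd x w -> slt (size w).+1 x.
Proof.
move=> h v /h; rewrite ltnS; apply: contraTT; rewrite -!ltnNge; exact: ord_size.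
Qed.

Lemma bnd_mon u : bnd (mon u) u.
Proof. by move=> v; rewrite co_mon; case: (u =P v) => [-> //|_]; rewrite eqxx. Qed.

(** Without their top terms both factors lie strictly below their bounds, and the order is strictly
    compatible with concatenation, so only the product of the top terms reaches [u ++ v]. Bounds are
    assumed instead of leading words because the lemma is also applied to top coefficients that
    vanish. *)
Lemma coM_top x y u v : bnd x u -> bnd y v -> co (x * y) (u ++ v) = co x u * co y v.
Proof.
move=> hx hy.
pose x' := x - sc (co x u) * mon u; pose y' := y - sc (co y v) * mon v.
have bx' : sbnd x' u.
  apply: bnd_sbnd; first by apply: bndD => //; apply/bndN/bndZ/bnd_mon.
  by rewrite coB co_sc co_mon eqxx mulr1 subrr.
have by' : sbnd y' v.
  apply: bnd_sbnd; first by apply: bndD => //; apply/bndN/bndZ/bnd_mon.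
  by rewrite coB co_sc co_mon eqxx mulr1 subrr.
have -> : x * y = x' * y + (sc (co x u) * mon u) * y'
                  + sc (co x u * co y v) * mon (u ++ v).
  rewrite mon_cat -sc_mul -[sc (co y v) * (_ * _)]sc_mulr mulrA -addrA -mulrDr.
  by rewrite subrK -mulrDl subrK.
rewrite !co_add (sbnd_co (sbndMl bx' hy)) (sbnd_co (sbndMr _ by')).
  by rewrite !add0r co_sc co_mon eqxx mulr1.
by apply/bndZ/bnd_mon.
Qed.

Lemma leadM x y u v : lead x u -> lead y v -> lead (x * y) (u ++ v).
Proof.
move=> [nx bx] [ny byv]; split; last exact: bndM.
by rewrite coM_top // mulf_neq0.
Qed.

Lemma lead_uniq x u v : lead x u -> lead x v -> u = v.
Proof.
by move=> [nx bx] [ny b]; apply: (@ord_inj _ _ _ V); apply/eqP; rewrite eqn_leq b // bx.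
Qed.

Lemma lead_neq0 x u : lead x u -> x != 0.
Proof. by case=> n _; apply: contraNneq n => ->; rewrite co0. Qed.

Lemma lead_exists x : x != 0 -> exists w, lead x w.
Proof.
move=> nx; have [N hN] := co_bounded V x.
suff: (exists w, lead x w) \/ x = 0 by case=> // x0; rewrite x0 eqxx in nx.
have {hN} : forall w, co x w != 0 -> (ord w < N.+1)%N by move=> w /hN.
elim: N.+1 => {N} [|N IH] hN.
  by right; apply: (@co_ext _ _ _ V) => w; apply/eqP/negPn/negP => /hN.
have [[w [ow nw]]|h] := EM (exists w, ord w = N /\ co x w != 0).
  by left; exists w; split=> // v /hN; rewrite ow ltnS.
apply: IH => w nw; rewrite ltn_neqAle -ltnS hN // andbT.
by apply/eqP => ow; apply: h; exists w.
Qed.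

Lemma lead_bnd x u w : lead x u -> bnd x w -> (ord u <= ord w)%N.
Proof. by case=> nx _; apply. Qed.

Lemma lead_sbnd x u w : lead x u -> sbnd x w -> (ord u < ord w)%N.
Proof. by case=> nx _; apply. Qed.

Lemma lead_slt x u n : lead x u -> slt n x -> (size u < n)%N.
Proof. by case=> nx _; apply. Qed.

Lemma lead_sbndD x y w : lead x w -> sbnd y w -> lead (x + y) w.
Proof.
move=> [nx bx] sy; split; last by apply: bndD => //; apply: sbnd_bnd.
by rewrite co_add (sbnd_co sy) addr0.
Qed.

Lemma leadN x w : lead x w -> lead (- x) w.
Proof. by case=> nx bx; split; [rewrite coN oppr_eq0|apply: bndN]. Qed.

Lemma leadZ c x w : c != 0 -> lead x w -> lead (sc c * x) w.
Proof. by move=> nc [nx bx]; split; [rewrite co_sc mulf_neq0|apply: bndZ]. Qed.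

Lemma lead1 : lead 1 [::].
Proof.
rewrite -(mon_nil V); split; last exact: bnd_mon.
by rewrite co_mon eqxx oner_eq0.
Qed.

Lemma lead_mon u : lead (mon u) u.
Proof. by split; [rewrite co_mon eqxx oner_eq0|exact: bnd_mon]. Qed.

Lemma bnd1 : bnd 1 [::]. Proof. by case: lead1. Qed.

Lemma bndX x w n : bnd x w -> bnd (x ^+ n) (wpow w n).
Proof. by move=> h; elim: n => [|n IH]; [exact: bnd1|rewrite exprS; apply: bndM]. Qed.

Lemma leadX x w n : lead x w -> lead (x ^+ n) (wpow w n).
Proof. by move=> h; elim: n => [|n IH]; [exact: lead1|rewrite exprS; apply: leadM]. Qed.

Lemma coX x w n : bnd x w -> co (x ^+ n) (wpow w n) = co x w ^+ n.
Proof.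
move=> h; elim: n => [|n IH]; first by rewrite expr0 -(mon_nil V) co_mon eqxx.
by rewrite !exprS /= coM_top ?IH //; apply: bndX.
Qed.

Lemma reduce x p w : lead p w -> bnd x w -> sbnd (x - sc (co x w / co p w) * p) w.
Proof.
move=> [np bp] bx; apply: bnd_sbnd; first by apply: bndD => //; apply/bndN/bndZ.
by rewrite coB co_sc divfK // subrr.
Qed.

Lemma lead_ind (P : A -> Prop) :
  (forall x, (forall y, (forall w w', lead y w -> lead x w' -> (ord w < ord w')%N) -> y != 0 -> P y)
     -> x != 0 -> P x) -> forall x, x != 0 -> P x.
Proof.
move=> IH x nx; have [w lw] := lead_exists nx.
have main : forall N y v, lead y v -> (ord v < N)%N -> P y.
  elim=> [//|N IHN] y v ly; rewrite ltnS => le.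
  apply: IH; last exact: lead_neq0 ly.
  move=> z hz nz; have [v' lz] := lead_exists nz.
  exact: IHN lz (leq_trans (hz _ _ lz ly) le).
exact: main lw (ltnSn _).
Qed.

Definition com x y := x * y - y * x.

Lemma comC x y : com y x = - com x y. Proof. by rewrite /com opprB. Qed.
Lemma comD x y z : com x (y + z) = com x y + com x z.
Proof. by rewrite /com mulrDr mulrDl opprD addrACA. Qed.
Lemma comN x y : com x (- y) = - com x y.
Proof. by rewrite /com mulrN mulNr opprK opprB addrC. Qed.
Lemma comB x y z : com x (y - z) = com x y - com x z.
Proof. by rewrite comD comN. Qed.
Lemma comZ x c y : com x (sc c * y) = sc c * com x y.
Proof. by rewrite /com sc_mulr -mulrA -mulrBr. Qed.
Lemma com0 x : com x 0 = 0.
Proof. by rewrite /com mulr0 mul0r subrr. Qed.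
Lemma comM x y z : com x (y * z) = com x y * z + y * com x z.
Proof. by rewrite /com mulrBl mulrBr !mulrA addrA subrK. Qed.
Lemma com1 x : com x 1 = 0.
Proof. by rewrite /com mulr1 mul1r subrr. Qed.
Lemma comXx x n : com x (x ^+ n) = 0.
Proof. by rewrite /com -exprS -exprSr subrr. Qed.
Lemma comX x y n :
  com x (y ^+ n) = \sum_(l < n) y ^+ l * com x y * y ^+ (n - l.+1).
Proof.
elim: n => [|n IH]; first by rewrite big_ord0 com1.
rewrite exprS comM IH big_ord_recl /= expr0 mul1r subn1 /= mulr_sumr.
congr (_ + _); apply: eq_bigr => i _.
by rewrite exprS !mulrA.
Qed.

Lemma bnd_com x y u v : bnd x u -> bnd y v -> wcomm u v -> bnd (com x y) (u ++ v).
Proof.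
by move=> hx hy /eqP e; apply: bndD; [|apply: bndN; rewrite e]; apply: bndM.
Qed.

(** The scalars commute, so [x * y] and [y * x] have the same top coefficient. *)
Lemma sbnd_com x y u v : bnd x u -> bnd y v -> wcomm u v -> sbnd (com x y) (u ++ v).
Proof.
move=> hx hy c; apply: bnd_sbnd; first exact: bnd_com.
by move/eqP: c => e; rewrite coB {2}e !coM_top // mulrC subrr.
Qed.

Lemma lead_com x y u v : lead x u -> lead y v -> (ord (v ++ u) < ord (u ++ v))%N ->
  lead (com x y) (u ++ v).
Proof.
move=> lx ly lt; apply: lead_sbndD; first exact: leadM.
by apply: sbndN; apply: bnd_strans lt; case: (leadM ly lx).
Qed.

Lemma lead_com_nc x y u v : lead x u -> lead y v -> ~~ wcomm u v ->
  exists2 w, lead (com x y) w & (w = u ++ v \/ w = v ++ u).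
Proof.
move=> lx ly nc; case: (ltngtP (ord (v ++ u)) (ord (u ++ v))) => [lt|lt|e].
- by exists (u ++ v); [exact: lead_com|left].
- by exists (v ++ u); [rewrite comC; apply/leadN/lead_com|right].
- by case/negP: nc; rewrite /wcomm (@ord_inj _ _ _ V _ _ e).
Qed.

Inductive span (G : A -> Prop) : A -> Prop :=
| span0 : span G 0
| span_cons c g z : G g -> span G z -> span G (sc c * g + z).

Definition subspace (W : A -> Prop) :=
  [/\ W 0, forall x y, W x -> W y -> W (x + y) & forall c x, W x -> W (sc c * x)].

Lemma span_gen G g : G g -> span G g.
Proof.
move=> Gg; have -> : g = sc 1 * g + 0 by rewrite sc1 mul1r addr0.
by apply: span_cons => //; apply: span0.
Qed.

Lemma spanD G x y : span G x -> span G y -> span G (x + y).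
Proof.
move=> sx sy; elim: sx => [|c g z Gg sz IH]; first by rewrite add0r.
by rewrite -addrA; apply: span_cons.
Qed.

Lemma spanZ G c x : span G x -> span G (sc c * x).
Proof.
elim=> [|d g z Gg sz IH]; first by rewrite mulr0; apply: span0.
by rewrite mulrDr sc_mul; apply: span_cons.
Qed.

Lemma span_subspace G : subspace (span G).
Proof. by split; [exact: span0|move=> x y; exact: spanD|move=> c x; exact: spanZ]. Qed.

Lemma span_min G (W : A -> Prop) : subspace W -> (forall g, G g -> W g) ->
  forall x, span G x -> W x.
Proof.
move=> [W0 WD WZ] h x; elim=> [//|c g z Gg _ Wz].
by apply: WD => //; apply: WZ; apply: h.
Qed.

Lemma span_sum G I (r : seq I) (P : pred I) (E : I -> A) :
  (forall i, P i -> span G (E i)) -> span G (\sum_(i <- r | P i) E i).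
Proof.
move=> h; elim/big_rec: _ => [|i x Pi hx]; first exact: span0.
by apply: spanD => //; apply: h.
Qed.

Lemma span_img G G' (f : A -> A) :
  f 0 = 0 -> (forall x y, f (x + y) = f x + f y) -> (forall c x, f (sc c * x) = sc c * f x) ->
  (forall g, G g -> span G' (f g)) -> forall x, span G x -> span G' (f x).
Proof.
move=> f0 fD fZ h x; elim=> [|c g z Gg _ IH]; first by rewrite f0; apply: span0.
by rewrite fD fZ; apply: spanD => //; apply: spanZ; apply: h.
Qed.

(* A combination of elements with pairwise distinct leading words cannot
   cancel, so its leading word is one of theirs. *)
Lemma span_lead (G : A -> Prop) :
  (forall g, G g -> exists w, lead g w) ->
  (forall g g' w, G g -> G g' -> lead g w -> lead g' w -> g = g') ->
  forall z, span G z -> z != 0 -> exists2 g, G g & exists2 w, lead g w & lead z w.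
Proof.
move=> exl inj z sz nz.
pose GN N g := G g /\ forall w, lead g w -> (ord w < N)%N.
suff main : forall N z, span (GN N) z ->
    z = 0 \/ exists2 g, GN N g & exists2 w, lead g w & lead z w.
  have [N sN] : exists N, span (GN N) z.
    elim: sz => [|c g y Gg sy [N IH]]; first by exists 0%N; apply: span0.
    have [w lw] := exl g Gg.
    exists (maxn N (ord w).+1); apply: span_cons.
      by split=> // w' lw'; rewrite (lead_uniq lw' lw) leq_max leqnn orbT.
    apply: (span_min (span_subspace _)) IH => h [Gh hh]; apply: span_gen.
    by split=> // w' /hh lt; rewrite leq_max lt.
  by case: (main N z sN) nz => [->|[g [Gg _] h] _]; rewrite ?eqxx //; exists g.
elim=> [|N IH] {sz nz}z sz.
  left; elim: sz => // c g y [Gg hg] _ _; have [w /hg] := exl g Gg.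
  by rewrite ltn0.
have mono x : span (GN N) x -> x = 0 \/
    exists2 g, GN N.+1 g & exists2 w, lead g w & lead x w.
  move=> /IH [->|[g [Gg hg] h]]; [by left|right].
  by exists g => //; split=> // w /hg/ltnW.
have : span (GN N) z \/ exists c g w, [/\ GN N.+1 g, lead g w, ord w = N, c != 0 &
    span (GN N) (z - sc c * g)].
  elim: sz => [|c g y [Gg hg] sy]; first by left; apply: span0.
  have [w lw] := exl g Gg.
  have [->|nc] := eqVneq c 0; first by rewrite sc0 mul0r add0r.
  have [ltN|geN] := ltnP (ord w) N.
    have sg : span (GN N) (sc c * g).
      by apply/spanZ/span_gen; split=> // w' lw'; rewrite (lead_uniq lw' lw).
    case=> [h|[d [g' [w' [G' lw' ow' nd s']]]]]; [left|right]; first exact: spanD.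
    by exists d, g', w'; split=> //; rewrite -addrA; apply: spanD.
  have owN : ord w = N by apply/eqP; rewrite eqn_leq geN -ltnS hg.
  case=> [h|[d [g' [w' [[Gg' hg'] lw' ow' nd s']]]]].
    by right; exists c, g, w; split=> //; rewrite addrAC subrr add0r.
  have ew : w' = w by apply: (@ord_inj _ _ _ V); rewrite ow'.
  have eg : g' = g by apply: (@inj _ _ w) => //; rewrite -ew.
  subst g'; have [z0|ncd] := eqVneq (c + d) 0.
    left; have -> // : sc c * g + y = y - sc d * g.
    by rewrite (_ : c = - d) ?sc_opp 1?addrC //; apply/eqP; rewrite -addr_eq0 z0.
  right; exists (c + d), g, w; split=> //.
  by rewrite sc_add opprD addrACA subrr add0r.
case=> [/mono//|[c [g [w [Gg lw ow nc s]]]]]; right; exists g => //; exists w => //.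
rewrite -[z](subrK (sc c * g)) addrC; apply: lead_sbndD; first exact: leadZ.
case: (IH _ s) => [->|[g' [_ hg'] [w' lg' [_ b]]]]; first exact: sbnd0.
by apply: bnd_strans b _; rewrite ow; apply: hg'.
Qed.

End WordVal.

(** * Leading words of commutators *)

(** The Frobenius bound for two coprime numbers. Take [b] below [n] with [b * k] congruent to [r]
    modulo [n]; if [b * k] exceeded [r], the difference would be at least [n], which the bound
    [b * k <= n.-1 * k] forbids. *)
Lemma coprime_semigroup n k r : (0 < n)%N -> coprime n k -> (n.-1 * k < r + n)%N ->
  exists a b, (b < n)%N /\ r = (a * n + b * k)%N.
Proof.
move=> n0 cnk lt.
have [b bn eb] : exists2 b, (b < n)%N & (b * k = r %[mod n])%N.
  have [k0|k0] := posnP k.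
    move: cnk; rewrite k0 /coprime gcdn0 => /eqP ->.
    by exists 0%N; rewrite // !modn1.
  have [km kn ekm _] := egcdnP n k0.
  move: ekm; rewrite gcdnC (eqP cnk) => ekm.
  exists ((r * km) %% n)%N; first by rewrite ltn_mod.
  by rewrite modnMml -mulnA ekm mulnDr muln1 mulnA modnMDl.
have le : (b * k <= r)%N.
  rewrite leqNgt; apply/negP => lt2.
  have /dvdnP[q eq] : (n %| b * k - r)%N by rewrite -eqn_mod_dvd ?(ltnW lt2) // eb.
  have q0 : (0 < q)%N by rewrite lt0n; apply/eqP => q0; move: eq; rewrite q0 mul0n; lia.
  have : (n <= b * k - r)%N by rewrite eq leq_pmull.
  have : (b * k <= n.-1 * k)%N by rewrite leq_mul2r -ltnS prednK // bn orbT.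
  lia.
have /dvdnP[a ea] : (n %| r - b * k)%N by rewrite -eqn_mod_dvd // eb.
by exists a, b; split=> //; rewrite -ea subnK.
Qed.

Section PowerCommutators.
Variables (T : eqType) (F : fieldType) (A : nzRingType) (V : wordval T F A).
Local Notation sc := (sc V).
Local Notation co := (co V).
Local Notation ord := (ord V).
Local Notation bnd := (bnd V).
Local Notation sbnd := (sbnd V).
Local Notation lead := (lead V).
Local Notation span := (span V).
Implicit Types (x y z : A) (u v w : seq T).

(** While the remainder shares its leading word with an element of [G], a multiple of that element
    is subtracted and the leading word decreases; the hypothesis keeps the remainder from
    vanishing. *)
Lemma reduce_span (G : A -> Prop) x : (forall z, span G z -> x - z != 0) ->
  exists2 z, span G z & forall g w, G g -> lead g w -> ~ lead (x - z) w.
Proof.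
have : x != 0 -> (forall z, span G z -> x - z != 0) ->
  exists2 z, span G z & forall g w, G g -> lead g w -> ~ lead (x - z) w.
  move: x; apply: (@lead_ind _ _ _ V) => x IH nx hx.
  have [[g [w [Gg lg lx]]]|no] := EM (exists g w, [/\ G g, lead g w & lead x w]).
    have [nx' bx] := lx; have sy := reduce lg bx.
    set c := (_ / _) in sy; set y := x - _ in sy.
    have sg : span G (sc c * g) by apply/spanZ/span_gen.
    have ey z : y - z = x - (sc c * g + z) by rewrite opprD addrA.
    have hy z : span G z -> y - z != 0 by move=> sz; rewrite ey; apply/hx/spanD.
    have ny : y != 0 by rewrite -[y]subr0; apply/hy/span0.
    have [||//|z sz hz] := IH y.
      by move=> v v' ly lv'; rewrite (lead_uniq lv' lx); apply: lead_sbnd sy.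
      by [].
    by exists (sc c * g + z); [exact: spanD|move=> g' v; rewrite -ey; apply: hz].
  exists 0; first exact: span0.
  by rewrite subr0 => g w Gg lg lx; apply: no; exists g, w.
by move=> h hx; apply: h => //; rewrite -[x]subr0; apply/hx/span0.
Qed.

Variable m : seq T.
Hypothesis rm : wroot m.

Lemma ord_wpow a b : (a < b)%N -> (ord (wpow m a) < ord (wpow m b))%N.
Proof. by move=> lt; apply: ord_size; rewrite !size_wpow ltn_pmul2r ?wroot_size. Qed.

Lemma ord_wpow_lt a b : (ord (wpow m a) < ord (wpow m b))%N = (a < b)%N.
Proof.
apply/idP/idP; last exact: ord_wpow.
by rewrite !ltnNge; apply: contraNN; rewrite leq_eqVlt => /orP[/eqP->//|/ord_wpow/ltnW].
Qed.

Lemma ord_wpow_le a b : (ord (wpow m a) <= ord (wpow m b))%N = (a <= b)%N.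
Proof. by rewrite leqNgt ord_wpow_lt -leqNgt. Qed.

Lemma wcomm_pow a b : wcomm (wpow m a) (wpow m b).
Proof. by rewrite /wcomm -!wpowD addnC. Qed.

(** If [v] did not commute with [m], the leading word of the commutator would be one of the two
    products of leading words; being a power of [m], it would force [v] to commute with [m] after
    all. The strict bound is the cancellation of the top terms. *)
Lemma lead_com_pow x y i v t : lead x (wpow m i.+1) -> lead y v ->
  lead (com x y) (wpow m t) -> exists2 j, v = wpow m j & (t < i.+1 + j)%N.
Proof.
move=> lx ly lc.
have cv : wcomm m v.
  apply: contraT => nc.
  have nc' : ~~ wcomm (wpow m i.+1) v by apply: contraNN nc => /wcomm_wpow_inv.
  have [w lw ew] := lead_com_nc lx ly nc'.
  have ew' := lead_uniq lw lc.
  have hw : m ++ w = w ++ m by apply/eqP; rewrite ew'; apply/wcomm_wpow/wcomm_refl.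
  have cm : wcomm m (wpow m i.+1) by apply/wcomm_wpow/wcomm_refl.
  case/negP: nc; move: (wpow m i.+1) cm ew => M cm ew; case: ew hw => ->; rewrite ?catA.
    by rewrite (eqP cm) -!catA => /eqP; rewrite eqseq_cat // => /andP[].
  rewrite -[RHS]catA -(eqP cm) catA => /eqP.
  by rewrite eqseq_cat ?size_cat 1?addnC // => /andP[].
have [j ej] := rm.2 v cv; exists j => //.
rewrite -ord_wpow_lt wpowD -ej; apply: lead_sbnd lc _.
by case: lx ly => _ bx [_ b]; apply: sbnd_com => //; rewrite ej wcomm_pow.
Qed.

(** Powers of [m] commute, so all [n.+1] terms of the Leibniz sum have the same top word; here the
    integer factor arises. *)
Lemma comX_top x y i t n : bnd x (wpow m i) -> bnd (com y x) (wpow m t) ->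
  bnd (com y (x ^+ n.+1)) (wpow m (t + n * i)) /\
  co (com y (x ^+ n.+1)) (wpow m (t + n * i)) =
    n.+1%:R * (co x (wpow m i) ^+ n * co (com y x) (wpow m t)).
Proof.
move=> bx bc; rewrite comX.
have E (l : 'I_n.+1) : wpow m (t + n * i) =
    (wpow (wpow m i) l ++ wpow m t) ++ wpow (wpow m i) (n.+1 - l.+1).
  rewrite -!wpowM -!wpowD; congr (wpow m _).
  have := ltn_ord l; rewrite ltnS => le.
  by rewrite -{1}(subnKC le) mulnDl subSS; lia.
split.
  apply: bnd_sum => l _; rewrite (E l); apply: bndM; last exact: bndX.
  by apply: bndM bc; apply: bndX bx.
rewrite co_sum (eq_bigr (fun _ => co x (wpow m i) ^+ n * co (com y x) (wpow m t))).
  by rewrite sumr_const card_ord mulr_natl.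
move=> l _; rewrite (E l).
have b1 : bnd (x ^+ l) (wpow (wpow m i) l) by exact: bndX bx.
rewrite coM_top; [|exact: bndM b1 bc|exact: bndX bx].
rewrite coM_top // !coX // mulrAC -exprD; congr (_ ^+ _ * _).
by rewrite subSS subnKC // -ltnS.
Qed.

End PowerCommutators.

Section PowerCommutators.
Variables (T : eqType) (F : fieldType) (A : nzRingType) (V : wordval T F A).
Local Notation sc := (sc V).
Local Notation co := (co V).
Local Notation ord := (ord V).
Local Notation bnd := (bnd V).
Local Notation sbnd := (sbnd V).
Local Notation lead := (lead V).
Local Notation span := (span V).
Implicit Types (x y z : A) (u v w : seq T).
Variable m : seq T.
Hypothesis rm : wroot m.

Lemma com_span0 (G : A -> Prop) x z : (forall g, G g -> com x g = 0) -> span G z -> com x z = 0.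
Proof.
move=> h; elim=> [|c g y Gg _ IH]; first exact: com0.
by rewrite comD comZ h // IH mulr0 addr0.
Qed.

(** Subtracting powers of [f] from [g] does not change the commutator with [f], and these powers
    realize every exponent divisible by [i]. *)
Lemma com_pow_dvd f g i j t : (0 < i)%N -> lead f (wpow m i) -> lead g (wpow m j) ->
  lead (com f g) (wpow m t) ->
  exists g' j', [/\ lead g' (wpow m j'), com f g' = com f g & ~~ (i %| j')%N].
Proof.
move=> i0 lf lg lc.
pose G x := exists a, x = f ^+ a.
have cG z : span G z -> com f (g - z) = com f g.
  move=> sz; rewrite comB (@com_span0 G f z) ?subr0 // => _ [a ->].
  exact: comXx.
have [|z sz hz] := reduce_span (V := V) (G := G) (x := g).
  move=> z sz; apply/eqP => e0; have := lead_neq0 lc.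
  by rewrite -(cG z sz) e0 com0 eqxx.
have gz0 : g - z != 0.
  apply/eqP => e0; have := lead_neq0 lc.
  by rewrite -(cG z sz) e0 com0 eqxx.
have [v lv] := lead_exists V gz0.
have lc' : lead (com f (g - z)) (wpow m t) by rewrite cG.
move: lf lc'; rewrite -(prednK i0) => lf lc'.
have [j' ej _] := lead_com_pow rm lf lv lc'; subst v.
exists (g - z), j'; split=> //; first exact: cG.
apply/negP => /dvdnP[a ea]; apply: (hz (f ^+ a) (wpow m j')) => //; first by exists a.
by rewrite ea wpowM; apply: leadX.
Qed.

Lemma shift_exponents (w k a b n e : nat) : (0 < a)%N -> (0 < b)%N -> (k + n = w + e)%N ->
  (w + a.-1 * n + b * e = a * n + (k + b.-1 * e))%N.
Proof. by case: a b => [|a] [|b] //= _ _; rewrite !mulSn; lia. Qed.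

(** The new pair is [H] and [f ^+ a * g ^+ b], where [H] is [g ^+ n] reduced by monomials in [f] and
    [g]. The exponent of [H] is not a multiple of [e], and the exponent of the second element is
    congruent to [e] modulo that of [H]; hence the gcd falls below [e]. *)
Lemma com_pow_step p f g e n k t : p \in [pchar F] -> coprime n k -> (1 < n)%N ->
  (0 < k)%N -> (0 < e)%N -> ~~ (p %| n)%N -> lead f (wpow m (n * e)) ->
  lead g (wpow m (k * e)) -> lead (com f g) (wpow m t) ->
  exists f' g' i' j' t', [/\ lead f' (wpow m i'), lead g' (wpow m j'),
    lead (com f' g') (wpow m t') & (gcdn i' j' < e)%N].
Proof.
move=> pF cnk n1 k0 e0 pn lf lg lc.
have n0 : (0 < n)%N by apply: ltnW.
have nat0 a : (a%:R == 0 :> F) = (p %| a)%N by rewrite (dvdn_pcharf pF).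
have [nf bf] := lf; have [ng bg] := lg; have [nc bc] := lc.
have bc' : bnd (com g f) (wpow m t) by rewrite comC; apply: bndN.
pose G x := exists a b, [/\ (b < n)%N, (a * (n * e) + b * (k * e) <= n * (k * e))%N &
  x = f ^+ a * g ^+ b].
have leadG a b : lead (f ^+ a * g ^+ b) (wpow m (a * (n * e) + b * (k * e))).
  by rewrite wpowD !wpowM; apply: leadM; apply: leadX; rewrite -?wpowM.
pose W := (t + n.-1 * (k * e))%N.
have [bX cX] : bnd (com f (g ^+ n)) (wpow m W) /\
    co (com f (g ^+ n)) (wpow m W) =
    n%:R * (co g (wpow m (k * e)) ^+ n.-1 * co (com f g) (wpow m t)).
  by have := comX_top n.-1 bg bc; rewrite prednK.
have lX : lead (com f (g ^+ n)) (wpow m W).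
  by split=> //; rewrite cX !mulf_neq0 ?expf_neq0 // nat0.
(* The monomials leave the top of [[f, g ^+ n]] untouched: equality [a * n + b.+1 * k = n * k] would
   make [n] divide [b.+1], which is smaller than [n]. *)
have sG z : span G z -> sbnd (com f z) (wpow m W).
  elim=> [|c x y Gx _ IH]; first by rewrite com0; apply: sbnd0.
  rewrite comD comZ; apply: sbndD => //; apply: sbndZ.
  case: Gx => a [[|b] [bn le ->]].
    by rewrite expr0 mulr1 comXx; apply: sbnd0.
  rewrite comM comXx mul0r add0r.
  have [bb _] := comX_top b bg bc.
  apply: (@bnd_strans _ _ _ V _ (wpow m (a * (n * e) + (t + b * (k * e))))).
    by rewrite wpowD; apply: bndM => //; rewrite wpowM; apply: bndX.
  apply: ord_wpow => //; rewrite /W.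
  suff : (a * n + b.+1 * k < n * k)%N.
    move=> lt; have : ((a * n + b.+1 * k) * e < n * k * e)%N by rewrite ltn_pmul2r.
    by move: (k * e)%N (mulnA n k e) (mulnA a n e) => ke e1 e2; nia.
  rewrite ltn_neqAle; apply/andP; split; last by rewrite -(leq_pmul2r e0); nia.
  apply/eqP => eq.
  have : (n %| b.+1 * k)%N.
    by rewrite -(dvdn_addr _ (dvdn_mull a (dvdnn n))) eq dvdn_mulr.
  by rewrite Gauss_dvdl // => /(dvdn_leq (ltn0Sn b)); rewrite leqNgt bn.
have cG z : span G z -> lead (com f (g ^+ n - z)) (wpow m W).
  move=> sz; rewrite comB; apply: lead_sbndD => //; apply/sbndN; exact: sG.
have [|z sz hz] := reduce_span (V := V) (G := G) (x := g ^+ n).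
  move=> z sz; apply/eqP => z0; have := lead_neq0 (cG z sz).
  by rewrite z0 com0 eqxx.
set H := g ^+ n - z in hz.
have lcH : lead (com f H) (wpow m W) by apply: cG.
have nH : H != 0 by apply/eqP => z0; have := lead_neq0 lcH; rewrite z0 com0 eqxx.
have [v lv] := lead_exists V nH.
have ne0 : (0 < n * e)%N by rewrite muln_gt0 n0.
have [t2 ev lt2] : exists2 j, v = wpow m j & (W < n * e + j)%N.
  have L := lf; rewrite -(prednK ne0) in L.
  by have := lead_com_pow rm L lv lcH; rewrite prednK.
subst v.
have bGz : bnd z (wpow m (n * (k * e))).
  elim: sz => [|c x y [a [b [bn le ->]]] _ IH]; first exact: bnd0.
  apply: bndD => //; apply: bndZ; have [_ bb] := leadG a b.
  by apply: bnd_trans bb _; rewrite ord_wpow_le.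
have t2le : (t2 <= n * (k * e))%N.
  rewrite -(ord_wpow_le V rm); apply: lead_bnd lv _.
  by apply: bndD; [rewrite wpowM; apply: bndX|apply: bndN].
(* If [e] divided [t2], the lower bound [lt2] would place the quotient in the range of the Frobenius
   bound, so [t2] would be the exponent of a monomial in [G], although [H] is reduced. *)
have ndvd : ~~ (e %| t2)%N.
  apply/negP => /dvdnP[r er].
  have lt3 : (n.-1 * k < r + n)%N.
    rewrite -(ltn_pmul2r e0) mulnDl -er -mulnA addnC.
    by apply: leq_ltn_trans lt2; rewrite leq_addl.
  have [a [b [bn eab]]] := coprime_semigroup n0 cnk lt3.
  have et : t2 = (a * (n * e) + b * (k * e))%N by rewrite er eab mulnDl !mulnA.
  apply: (hz (f ^+ a * g ^+ b) (wpow m t2)) => //.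
    by exists a, b; rewrite -et.
  by rewrite et.
have t20 : (0 < t2)%N by rewrite lt0n; apply: contraNneq ndvd => ->; rewrite dvdn0.
(* [K] bounds the exponents in [[g, H]]. By [EK] the two parts of [[H, f ^+ a * g ^+ b]] have the
   same top word, so their coefficients must decide. *)
pose K := (t + n * (k * e) - n * e)%N.
have EK : (K + n * e = W + k * e)%N.
  rewrite /K /W subnK.
    by rewrite -addnA -mulSnr prednK.
  by rewrite (leq_trans _ (leq_addl _ _)) // leq_mul2l leq_pmull ?orbT.
have bgH : bnd (com g H) (wpow m K).
  rewrite comB comXx sub0r; apply: bndN.
  elim: sz {hz H lcH nH lv} => [|c x y [[|a] [b [bn le ->]]] _ IH].
  - by rewrite com0; apply: bnd0.
  - by rewrite comD comZ expr0 mul1r comXx mulr0 add0r.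
  rewrite comD comZ; apply: bndD => //; apply: bndZ.
  rewrite comM comXx mulr0 addr0.
  have [bb _] := comX_top a bf bc'.
  apply: (@bnd_trans _ _ _ V _ (wpow m ((t + a * (n * e)) + b * (k * e)))).
    by rewrite wpowD; apply: bndM => //; rewrite wpowM; apply: bndX.
  rewrite ord_wpow_le // /K; nia.
have pk0 : (0 < p * k)%N by rewrite muln_gt0 k0 andbT prime_gt0 // (pcharf_prime pF).
have cpn : coprime (p * k) n.
  by rewrite coprimeMl (prime_coprime _ (pcharf_prime pF)) pn coprime_sym.
(* Bezout for [p * k] and [n] gives [a * n = q * (p * k) + 1], so [p] does not divide [a]. As [p]
   divides the [b] chosen below, the part with [[H, g ^+ b]] loses its top coefficient and the part
   with [[H, f ^+ a]] keeps it. *)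
have [a q ea _] := egcdnP (p * k) n0.
rewrite gcdnC (eqP cpn) in ea.
have pa : ~~ (p %| a)%N.
  apply/negP => /dvdnP[a' ea']; move: ea; rewrite ea' => ea.
  have : (p %| 1)%N.
    rewrite -(dvdn_addr 1 (dvdn_mull q (dvdn_mulr k (dvdnn p)))) -ea.
    by rewrite mulnAC dvdn_mull.
  by rewrite dvdn1 => /eqP p1; have := pcharf_prime pF; rewrite p1.
have a0 : (0 < a)%N by rewrite lt0n; apply: contraNneq pa => ->; rewrite dvdn0.
(* The factor [t2.-1] completes [q * (p * k)] to a multiple of [t2], so that [a * n + b * k] is 1
   modulo [t2]. *)
pose b := (p * q * t2.-1)%N.
have eN : (a * n + b * k = q * (p * k) * t2 + 1)%N.
  rewrite ea /b -[in RHS](prednK t20) mulnS addnAC; congr (_ + _ + _)%N; nia.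
have lcH' : lead (com H f) (wpow m W) by rewrite comC; apply: leadN.
have bgH' : bnd (com H g) (wpow m K) by rewrite comC; apply: bndN.
pose U := (W + a.-1 * (n * e) + b * (k * e))%N.
have [nfH bfH] := lcH'.
have [bfa cfa] := comX_top a.-1 bf bfH; rewrite prednK // in bfa cfa.
have lfa : lead (com H (f ^+ a) * g ^+ b) (wpow m U).
  rewrite /U wpowD; apply: leadM; last by rewrite wpowM; apply: leadX.
  by split=> //; rewrite cfa !mulf_neq0 ?expf_neq0 // nat0.
have sgb : sbnd (f ^+ a * com H (g ^+ b)) (wpow m U).
  have [b0|b0] := posnP b; first by rewrite b0 expr0 com1 mulr0; apply: sbnd0.
  have [bgb cgb] := comX_top b.-1 bg bgH'; rewrite prednK // in bgb cgb.
  have -> : wpow m U = wpow (wpow m (n * e)) a ++ wpow m (K + b.-1 * (k * e)).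
    rewrite -wpowM -wpowD /U; congr (wpow m _).
    exact: shift_exponents.
  apply: sbndMr; first exact: bndX.
  apply: bnd_sbnd => //; rewrite cgb.
  have -> : b%:R = 0 :> F by apply/eqP; rewrite nat0 /b -mulnA dvdn_mulr.
  by rewrite mul0r.
exists H, (f ^+ a * g ^+ b), t2, (a * (n * e) + b * (k * e))%N, U; split=> //.
  by rewrite comM; apply: lead_sbndD.
have -> : (a * (n * e) + b * (k * e) = e * (q * (p * k) * t2 + 1))%N by rewrite -eN; nia.
rewrite mulnDr muln1 mulnA addnC gcdnC -gcdn_modl -modnDmr modnMl addn0 gcdn_modl.
rewrite ltn_neqAle; apply/andP; split; last exact/dvdn_leq/dvdn_gcdl.
by apply: contraNneq ndvd => eg; rewrite -[X in (X %| _)%N]eg dvdn_gcdr.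
Qed.

(** Induction on the gcd of the exponents. If one exponent divides the other, [com_pow_dvd] lowers
    the gcd; otherwise [com_pow_step] does, with [f] and [g] exchanged when [p] divides the reduced
    exponent of [f]. *)
Lemma com_not_pow p f g i j t : p \in [pchar F] -> lead f (wpow m i) ->
  lead g (wpow m j) -> ~ lead (com f g) (wpow m t).
Proof.
move=> pF; move: {-1}(gcdn i j) (leqnn (gcdn i j)) => N.
elim: N f g i j t => [|N IH] f g i j t.
  rewrite leqn0 eqn0Ngt gcdn_gt0 negb_or -!eqn0Ngt => /andP[/eqP -> /eqP ->] [_ bf] [_ bg] lc.
  have := lead_sbnd lc (sbnd_com bf bg (wcomm_refl _)).
  by rewrite -wpowD ord_wpow_lt.
have dvd f' g' i' j' t' : (0 < i')%N -> (i' %| j')%N -> (gcdn i' j' <= N.+1)%N ->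
    lead f' (wpow m i') -> lead g' (wpow m j') -> ~ lead (com f' g') (wpow m t').
  move=> i0 dij le lf lg lc.
  have [g2 [j2 [l2 e2 nd]]] := com_pow_dvd i0 lf lg lc.
  apply: (IH f' g2 i' j2 t') => //; last by rewrite e2.
  rewrite -ltnS (leq_trans _ le) // (gcdn_idPl dij).
  rewrite ltn_neqAle dvdn_leq ?dvdn_gcdl // andbT.
  by apply: contraNneq nd => eg; rewrite -[X in (X %| _)%N]eg dvdn_gcdr.
move=> le lf lg lc.
have lc' : lead (com g f) (wpow m t) by rewrite comC; apply: leadN.
have [i0|i0] := posnP i.
  have [j0|j0] := posnP j.
    case: lf lg => _ bf [_ bg]; move: bf bg; rewrite i0 j0 => bf bg.
    have := lead_sbnd lc (sbnd_com bf bg (wcomm_refl _)).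
    by rewrite -wpowD ord_wpow_lt.
  by apply: (dvd g f j i t) => //; rewrite ?i0 ?dvdn0 // gcdnC -i0.
have [dij|ndij] := boolP (i %| j)%N; first exact: (dvd f g i j t).
have j0 : (0 < j)%N by rewrite lt0n; apply: contraNneq ndij => ->; rewrite dvdn0.
pose e := gcdn i j.
have e0 : (0 < e)%N by rewrite gcdn_gt0 i0.
have ei : i = (i %/ e * e)%N by rewrite divnK // dvdn_gcdl.
have ej : j = (j %/ e * e)%N by rewrite divnK // dvdn_gcdr.
have cij : coprime (i %/ e)%N (j %/ e)%N.
  by rewrite /coprime -(eqn_pmul2r e0) muln_gcdl -ei -ej mul1n.
have ki0 : (0 < i %/ e)%N by rewrite divn_gt0 // dvdn_leq // dvdn_gcdl.
have kj0 : (0 < j %/ e)%N by rewrite divn_gt0 // dvdn_leq // dvdn_gcdr.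
have [dji|ndji] := boolP (j %| i)%N; first by apply: (dvd g f j i t) => //; rewrite gcdnC.
have ki1 : (1 < i %/ e)%N.
  rewrite ltn_neqAle ki0 andbT; apply: contraNneq ndij => e1.
  by rewrite ei -e1 mul1n dvdn_gcdr.
have kj1 : (1 < j %/ e)%N.
  rewrite ltn_neqAle kj0 andbT; apply: contraNneq ndji => e1.
  by rewrite ej -e1 mul1n dvdn_gcdl.
have fin : exists f' g' i' j' t', [/\ lead f' (wpow m i'), lead g' (wpow m j'),
    lead (com f' g') (wpow m t') & (gcdn i' j' < e)%N].
  have [pi|pi] := boolP (p %| i %/ e)%N.
    apply: (@com_pow_step p g f e (j %/ e)%N (i %/ e)%N t) => //.
    - by rewrite coprime_sym.
    - apply/negP => pj; have : (p %| gcdn (i %/ e)%N (j %/ e)%N)%N by rewrite dvdn_gcd pi.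
      by rewrite (eqP cij) dvdn1 => /eqP p1; have := pcharf_prime pF; rewrite p1.
    - by rewrite -ej.
    - by rewrite -ei.
  by apply: (@com_pow_step p f g e (i %/ e)%N (j %/ e)%N t) => //; rewrite -?ei -?ej.
have [f' [g' [i' [j' [t' [lf' lg' lc2 lt]]]]]] := fin.
by apply: (IH f' g' i' j' t') => //; rewrite -ltnS (leq_trans lt).
Qed.

End PowerCommutators.

(** * Key elements *)

Lemma word_bound1 (a b c d w v : nat) :
  (a + b < w + c -> v <= d -> a + v + b < w + (c + d))%N.
Proof. lia. Qed.

Lemma word_bound2 (a b c d w v : nat) :
  (a <= c -> v <= w + d -> a + v + b <= w + (c + d + b))%N.
Proof. lia. Qed.

Section Chain.
Variables (T : eqType) (F : fieldType) (A : nzRingType) (V : wordval T F A).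
Local Notation sc := (sc V).
Local Notation co := (co V).
Local Notation ord := (ord V).
Local Notation bnd := (bnd V).
Local Notation sbnd := (sbnd V).
Local Notation slt := (slt V).
Local Notation lead := (lead V).
Local Notation span := (span V).
Implicit Types (x y z : A) (u v : seq T).
Variables (m w : seq T) (f g : A) (i0 : nat).
Hypothesis rm : wroot m.
Hypothesis ncw : ~~ wcomm m w.
Hypothesis ormw : (ord (m ++ w) < ord (w ++ m))%N.
Hypothesis i0_gt0 : (0 < i0)%N.
Hypothesis lf : lead f (wpow m i0).
Let s := com f g.
Hypothesis ls : lead s w.

Lemma ord_pow_cat a : (0 < a)%N -> (ord (wpow m a ++ w) < ord (w ++ wpow m a))%N.
Proof.
elim: a => // -[|a] IH _; first by rewrite wpow1.
have -> : wpow m a.+2 = m ++ wpow m a.+1 by [].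
rewrite -catA; apply: ltn_trans (_ : (ord ((m ++ w) ++ wpow m a.+1) < _)%N).
  by rewrite -catA; apply/ord_catl/IH.
by rewrite [w ++ _]catA; apply: ord_catr.
Qed.

Lemma w_neq0 : (0 < size w)%N.
Proof. by rewrite lt0n size_eq0; apply: contraNneq ncw => ->; exact: wcomm_nil. Qed.

Definition powf x := exists a, x = f ^+ a.
Definition sandwich (G : A -> Prop) x := exists p p', [/\ G p, G p' & x = p * s * p'].

(* G plays the role of the monomials in the key elements found so far; H is
   the next key element, and psi records the leading word w m^psi of [f, H]. *)
Record chain (D : nat) (G : A -> Prop) (H : A) (psi : nat) : Prop := Chain {
  chain_D0 : (0 < D)%N;
  chain_Di : (D %| i0)%N;
  chain_1 : G 1;
  chain_f : forall p, G p -> G (f * p);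
  chain_lead : forall p, G p -> exists t, [/\ lead p (wpow m t), (D %| t)%N & (t + i0)%N <> psi];
  chain_uniq : forall p p' u, G p -> G p' -> lead p u -> lead p' u -> p = p';
  chain_psi : (D %| psi)%N;
  chain_com : lead (com f H) (w ++ wpow m psi);
  chain_g : forall p, G p -> exists x a z,
    [/\ g * p = x + a * H + z, span G x, span powf a & span (sandwich G) z]
}.

(** Beyond [psi] the shifted exponents of [G] exhaust the multiples of [D]; a key element whose
    leading word is missing from [G] must therefore bring in an exponent outside these multiples. *)
Definition chain_full D (G : A -> Prop) psi := forall r, (D %| r)%N -> (psi < r)%N ->
  exists p t, [/\ r = (t + i0)%N, G p & lead p (wpow m t)].

(** With m^t' the leading word of [H], passing from [p] to [[f, p]] gains less length than passing
    from [H] to [[f, H]]. This allows monomials to be subtracted from a power of [H] without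
    disturbing the top of its commutator. *)
Definition chain_small (G : A -> Prop) psi t' := forall p t, G p -> lead p (wpow m t) ->
  forall v, co (com f p) v != 0 ->
  (size v + t' * size m < size w + (psi + t) * size m)%N.

Lemma chain_powf D G H psi : chain D G H psi -> forall p, powf p -> G p.
Proof.
move=> C p [a ->]; elim: a => [|a IH]; first exact: chain_1 C.
by rewrite exprS; apply: chain_f C _ IH.
Qed.

Definition adjoin (G : A -> Prop) H n x := exists p c, [/\ G p, (c < n)%N & x = p * H ^+ c].

(** The Leibniz term with [w] furthest to the left dominates, since m^a w is smaller than w m^a. It
    occurs once, so no integer coefficient appears. *)
Lemma com_powH psi t' H n : (0 < t')%N -> lead H (wpow m t') ->
  lead (com f H) (w ++ wpow m psi) ->
  lead (com f (H ^+ n.+1)) (w ++ wpow m (psi + n * t')).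
Proof.
move=> t0 lH lc; rewrite comX big_ord_recl /= expr0 mul1r subSS subn0.
have -> : w ++ wpow m (psi + n * t') = (w ++ wpow m psi) ++ wpow (wpow m t') n.
  by rewrite wpowD wpowM catA.
apply: lead_sbndD; first by apply: leadM => //; apply: leadX.
apply: sbnd_sum => l _; have [_ bH] := lH; have [_ bc] := lc.
have b1 : bnd (H ^+ (bump 0 l)) (wpow m (l.+1 * t')) by rewrite wpowM; exact: bndX bH.
have b2 : bnd (H ^+ (n.+1 - (bump 0 l).+1)) (wpow m ((n - l.+1) * t')).
  by rewrite wpowM; exact: bndX bH.
apply: bnd_strans (bndM (bndM b1 bc) b2) _.
have -> : (w ++ wpow m psi) ++ wpow (wpow m t') n =
    (w ++ wpow m (l.+1 * t')) ++ wpow m (psi + (n - l.+1) * t').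
  rewrite -wpowM -!catA -!wpowD; congr (_ ++ wpow m _).
  by rewrite -{1}(subnKC (ltn_ord l)) mulnDl addnCA.
rewrite wpowD !catA -2!catA -[X in (_ < ord X)%N]catA.
rewrite [X in (ord X < _)%N]catA.
by apply: ord_catr; apply: ord_pow_cat; rewrite muln_gt0 t0.
Qed.

(** * One step of the key-element construction *)

Section Step.
Variables (D : nat) (G : A -> Prop) (H : A) (psi t' : nat).
Hypothesis C : chain D G H psi.
Hypothesis full : chain_full D G psi.
Hypothesis small : chain_small G psi t'.
Hypothesis lH : lead H (wpow m t').
Hypothesis gap : forall p, G p -> ~ lead p (wpow m t').

Let D' := gcdn D t'.
Let n := (D %/ D')%N.
Let k := (t' %/ D')%N.
Let psi' := (psi + n.-1 * t')%N.

(** The leading words of [f] and [H] commute, so [[f, H]] stays strictly below their product; the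
    bound follows by comparing lengths. *)
Lemma step_psi_lt : (psi < t' + i0)%N.
Proof.
have [_ bf] := lf; have [_ bH] := lH.
have := lead_sbnd (chain_com C) (sbnd_com bf bH (wcomm_pow m i0 t')).
rewrite -wpowD => lt; rewrite ltnNge; apply/negP => le; move: lt.
apply/negP; rewrite -leqNgt ltnW //; apply: ord_size.
rewrite size_cat !size_wpow; have := w_neq0.
have : ((i0 + t') * size m <= psi * size m)%N by rewrite leq_mul2r addnC le orbT.
lia.
Qed.

Lemma step_t'_gt0 : (0 < t')%N.
Proof.
rewrite lt0n; apply/eqP => t0; apply: (gap (chain_1 C)); rewrite t0; exact: lead1.
Qed.

(** Otherwise fullness would supply an element of [G] with the leading word of [H]. *)
Lemma step_ndvd : ~~ (D %| t')%N.
Proof.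
apply/negP => dt; have [||p [t [e Gp lp]]] := full (r := (t' + i0)%N).
- by rewrite dvdn_add // (chain_Di C).
- exact: step_psi_lt.
by apply: (gap Gp); move/addIn: e => ->.
Qed.

Lemma step_D'_gt0 : (0 < D')%N.
Proof. by rewrite gcdn_gt0 (chain_D0 C). Qed.

Lemma step_D'_lt : (D' < D)%N.
Proof.
rewrite ltn_neqAle (dvdn_leq (chain_D0 C) (dvdn_gcdl _ _)) andbT.
by apply: contraNneq step_ndvd => eg; rewrite -[X in (X %| _)%N]eg dvdn_gcdr.
Qed.

Lemma step_D : D = (n * D')%N.
Proof. by rewrite /n divnK // dvdn_gcdl. Qed.

Lemma step_t' : t' = (k * D')%N.
Proof. by rewrite /k divnK // dvdn_gcdr. Qed.

Lemma step_n_gt1 : (1 < n)%N.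
Proof. by rewrite -(ltn_pmul2r step_D'_gt0) mul1n -step_D step_D'_lt. Qed.

Lemma step_n_gt0 : (0 < n)%N. Proof. exact: ltnW step_n_gt1. Qed.

Lemma step_coprime : coprime n k.
Proof. by rewrite /coprime -(eqn_pmul2r step_D'_gt0) muln_gcdl -step_D -step_t' mul1n. Qed.

Lemma step_dvd c : (D %| c * t')%N = (n %| c)%N.
Proof.
by rewrite step_D [X in (_ %| c * X)%N]step_t' mulnA dvdn_pmul2r ?step_D'_gt0 //
  Gauss_dvdl // step_coprime.
Qed.

Lemma step_lead q : adjoin G H n q -> exists t c, [/\ lead q (wpow m (t + c * t')),
  (D %| t)%N, (t + i0)%N <> psi, (c < n)%N & exists p, [/\ G p, lead p (wpow m t) & q = p * H ^+ c]].
Proof.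
case=> p [c [Gp cn ->]]; have [t [lp dt nt]] := chain_lead C Gp.
exists t, c; split=> //; last by exists p.
by rewrite wpowD wpowM; apply: leadM => //; apply: leadX.
Qed.

Lemma step_index t c t2 c2 : (D %| t)%N -> (D %| t2)%N -> (c < n)%N -> (c2 < n)%N ->
  (t + c * t' = t2 + c2 * t')%N -> c = c2.
Proof.
wlog le : t c t2 c2 / (c <= c2)%N => [Hw|] dt dt2 cn c2n e.
  have [le|/ltnW le] := leqP c c2; first exact: (Hw t c t2 c2).
  exact/esym/(Hw t2 c2 t c).
have e1 : (t = t2 + (c2 - c) * t')%N.
  by apply: (@addIn (c * t')); rewrite -addnA -mulnDl subnK.
have : (D %| (c2 - c) * t')%N by rewrite -(dvdn_addr _ dt2) -e1.
rewrite step_dvd => dv; apply/eqP; rewrite eqn_leq le /= -subn_eq0.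
by case: (c2 - c)%N (leq_ltn_trans (leq_subr c c2) c2n) dv => // d lt /(dvdn_leq (ltn0Sn d)); rewrite leqNgt lt.
Qed.

(** In [p * H ^+ c] the derivation [[f, _]] hits either [p], where [small] is strict, or a factor
    [H], where equality is possible. The second case needs [c > 0], and then [D] cannot divide
    [u]. *)
Lemma step_small q (u : nat) : adjoin G H n q -> lead q (wpow m u) -> forall v, co (com f q) v != 0 ->
  (size v + t' * size m <= size w + (psi + u) * size m)%N /\
  ((D %| u)%N -> (size v + t' * size m < size w + (psi + u) * size m)%N).
Proof.
move=> Aq lq v nv; have [t [c [lq' dt nt cn [p [Gp lp eq]]]]] := step_lead Aq.
have eu : u = (t + c * t')%N by apply: (wpow_inj rm); apply: lead_uniq lq lq'.
have [_ bH] := lH; have bHc := bnd_slt (@bndX _ _ _ V _ _ c bH).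
move: nv; rewrite eq comM co_add => /ne0D/orP[].
  move=> /co_mul[v1 [v2 [-> n1 n2]]]; have := small Gp lp n1.
  have := bHc _ n2; rewrite ltnS !size_wpow size_cat eu.
  have -> : ((psi + (t + c * t')) * size m = (psi + t) * size m + c * (t' * size m))%N.
    by rewrite addnA mulnDl mulnA.
  move=> h2 h1; have h3 := word_bound1 h1 h2.
  by split=> [|_]; [exact: ltnW|].
case: c cn eu lq' eq bHc => [|c] cn eu _ eq _; first by rewrite expr0 com1 mulr0 co0 eqxx.
move=> /co_mul[v1 [v2 [-> n1 n2]]].
have h1 : (size v1 <= t * size m)%N.
  by case: lp => _ /bnd_slt /(_ _ n1); rewrite size_wpow.
have h2 : (size v2 <= size w + (psi + c * t') * size m)%N.
  have [_ /bnd_slt /(_ _ n2)] := com_powH c step_t'_gt0 lH (chain_com C).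
  by rewrite size_cat size_wpow.
split.
  rewrite size_cat eu mulSn.
  have -> : ((psi + (t + (t' + c * t'))) * size m =
    t * size m + (psi + c * t') * size m + t' * size m)%N by nia.
  exact: word_bound2 h1 h2.
move=> du; have := step_dvd c.+1; rewrite (_ : (D %| c.+1 * t')%N) => [/esym /(dvdn_leq (ltn0Sn c))|].
  by rewrite leqNgt cn.
by rewrite -(dvdn_addr _ dt) -eu.
Qed.

Lemma adjoin0 p : G p -> adjoin G H n p.
Proof. by move=> Gp; exists p, 0%N; rewrite expr0 mulr1 step_n_gt0. Qed.

Lemma step_powf a q : powf a -> adjoin G H n q -> adjoin G H n (a * q).
Proof.
case=> e -> [p [c [Gp cn ->]]]; exists (f ^+ e * p), c; split; rewrite ?mulrA //.
by elim: e => [|e IH]; rewrite ?expr0 ?mul1r // exprS -mulrA; apply: chain_f C _ IH.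
Qed.

Lemma span_powf_adjoin a x : span powf a -> span (adjoin G H n) x -> span (adjoin G H n) (a * x).
Proof.
move=> sa sx; elim: sa => [|c y z py _ IH]; first by rewrite mul0r; exact: span0.
rewrite mulrDl -mulrA; apply: spanD => //; apply: spanZ.
elim: sx => [|d q z' Aq _ IH']; first by rewrite mulr0; exact: span0.
rewrite mulrDr sc_mulr; apply: span_cons => //; exact: step_powf.
Qed.

(** The next key element is [H ^+ n] reduced by monomials [p * H ^+ c] with [c < n], where [n] is
    the least positive integer such that [D] divides [n * t']. *)
Lemma step_chain : exists H', [/\ chain D' (adjoin G H n) H' psi',
  chain_full D' (adjoin G H n) psi' &
  (exists t'', [/\ lead H' (wpow m t''), chain_small (adjoin G H n) psi' t'' &
     forall q, adjoin G H n q -> ~ lead q (wpow m t'')])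
  \/ (exists2 v, lead H' v & ~~ wcomm m v)].
Proof.
pose G1 q := adjoin G H n q /\ exists2 j, lead q (wpow m j) & (j <= n * t')%N.
have n0 := step_n_gt0; have t0 := step_t'_gt0.
have lX : lead (com f (H ^+ n)) (w ++ wpow m psi').
  by have := com_powH n.-1 t0 lH (chain_com C); rewrite prednK.
have G1com z : span G1 z -> sbnd (com f z) (w ++ wpow m psi').
  elim=> [|c q y [Aq [u lq le]] _ IH]; first by rewrite com0; exact: sbnd0.
  rewrite comD comZ; apply: sbndD => //; apply: sbndZ => v nv; apply: ord_size.
  have [h1 h2] := step_small Aq lq nv.
  rewrite size_cat size_wpow /psi'.
  have e1 : (n * t' = n.-1 * t' + t')%N by rewrite -{1}(prednK n0) mulSn addnC.
  have [eu|nu] := eqVneq u (n * t')%N.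
    have /h2 : (D %| u)%N by rewrite eu step_dvd.
    rewrite eu e1 !mulnDl.
    by move: (n.-1 * t' * size m)%N (t' * size m)%N (psi * size m)%N => x1 x3 x4; lia.
  have {}nu : (u < n * t')%N by rewrite ltn_neqAle nu.
  have : (u * size m < n * t' * size m)%N by rewrite ltn_pmul2r ?wroot_size.
  rewrite e1; move: h1; rewrite !mulnDl.
  by move: (n.-1 * t' * size m)%N (u * size m)%N (t' * size m)%N (psi * size m)%N => x1 x2 x3 x4; lia.
have cG1 z : span G1 z -> lead (com f (H ^+ n - z)) (w ++ wpow m psi').
  by move=> sz; rewrite comB; apply: lead_sbndD => //; apply/sbndN/G1com.
have [z sz|z sz hz] := reduce_span (V := V) (G := G1) (x := H ^+ n).
  by apply/eqP => z0; have := lead_neq0 (cG1 z sz); rewrite z0 com0 eqxx.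
set H' := H ^+ n - z in hz.
have sz' : span (adjoin G H n) z.
  by apply: (span_min (span_subspace _ _)) sz => q [Aq _]; apply: span_gen.
have lcH' : lead (com f H') (w ++ wpow m psi') by apply: cG1.
have nH' : H' != 0 by apply/eqP => z0; have := lead_neq0 lcH'; rewrite z0 com0 eqxx.
(* By the Frobenius bound a multiple of [D'] beyond [psi'] is [a * D + b * t'] with [b < n]; then
   [a * D] lies beyond [psi], where [G] is full. *)
have full' : chain_full D' (adjoin G H n) psi'.
  move=> r /dvdnP[r' er] lt.
  have [|a [b [bn eab]]] := @coprime_semigroup n k r' n0 step_coprime.
    rewrite -(ltn_pmul2r step_D'_gt0) mulnDl -er -step_D -mulnA -step_t'.
    apply: leq_trans (leq_trans (_ : (n.-1 * t' < r)%N) (leq_addr _ _)) => //.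
    by apply: leq_ltn_trans lt; rewrite leq_addl.
  have er2 : (r = a * D + b * t')%N by rewrite er eab mulnDl -!mulnA -step_D -step_t'.
  have [||p [t [et Gp lp]]] := full (r := (a * D)%N); first exact: dvdn_mull.
    have : (b * t' <= n.-1 * t')%N by rewrite leq_mul2r -ltnS prednK // bn orbT.
    by move: lt; rewrite er2 /psi'; lia.
  exists (p * H ^+ b), (t + b * t')%N; split.
  - by rewrite er2 et addnAC.
  - by exists p, b.
  - by rewrite wpowD wpowM; apply: leadM => //; apply: leadX.
exists H'; split=> //.
- split.
  + exact: step_D'_gt0.
  + exact: dvdn_trans (dvdn_gcdl _ _) (chain_Di C).
  + exact/adjoin0/(chain_1 C).
  + by move=> q Aq; apply: step_powf => //; exists 1%N; rewrite expr1.
  + move=> q Aq; have [t [c [lq dt nt cn _]]] := step_lead Aq.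
    exists (t + c * t')%N; split=> //.
      by rewrite dvdn_add ?dvdn_mull ?dvdn_gcdr // (dvdn_trans (dvdn_gcdl _ _)).
    move=> e; apply: nt.
    (* The index [c] is determined by the exponent modulo [D], and [psi'] has index [n.-1]; thus the
       exponent missing from the new set reduces to the one missing from [G]. *)
    have ec : c = n.-1.
      apply: (@step_index (t + i0)%N c psi n.-1) => //.
      * by rewrite dvdn_add // (chain_Di C).
      * exact: chain_psi C.
      * by rewrite prednK.
      * by rewrite addnAC e.
    by move: e; rewrite /psi' ec addnAC => /addIn.
  + move=> q q' u Aq Aq' lq lq'.
    have [t [c [lq1 dt _ cn [p [Gp lp eq]]]]] := step_lead Aq.
    have [t2 [c2 [lq2 dt2 _ cn2 [p2 [Gp2 lp2 eq2]]]]] := step_lead Aq'.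
    have et : (t + c * t' = t2 + c2 * t')%N.
      by apply: (wpow_inj rm); rewrite -(lead_uniq lq lq1) (lead_uniq lq' lq2).
    have ec := step_index dt dt2 cn cn2 et; subst c2.
    move/addIn: et => et; subst t2.
    by rewrite eq eq2 (chain_uniq C Gp Gp2 lp lp2).
  + rewrite dvdn_add ?dvdn_mull ?dvdn_gcdr // (dvdn_trans (dvdn_gcdl _ _)) //.
    exact: chain_psi C.
  + exact: lcH'.
  + move=> q [p [c [Gp cn ->]]]; have [x [a [y [e sx sa sy]]]] := chain_g C Gp.
    have sxH : span (adjoin G H n) (x * H ^+ c).
      apply: (span_img (f := fun x => x * H ^+ c)) sx => [|x1 x2|d x1|q' Gq'].
      * by rewrite mul0r.
      * by rewrite mulrDl.
      * by rewrite mulrA.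
      * by apply: span_gen; exists q', c.
    have syH : span (sandwich (adjoin G H n)) (y * H ^+ c).
      apply: (span_img (f := fun x => x * H ^+ c)) sy => [|x1 x2|d x1|_ [p1 [p2 [G1p G2p ->]]]].
      * by rewrite mul0r.
      * by rewrite mulrDl.
      * by rewrite mulrA.
      * apply: span_gen; exists p1, (p2 * H ^+ c); split; first exact: adjoin0.
          by exists p2, c.
        by rewrite !mulrA.
    have e' : g * (p * H ^+ c) = x * H ^+ c + a * H ^+ c.+1 + y * H ^+ c.
      by rewrite mulrA e !mulrDl exprS !mulrA.
    (* For [c = n.-1] the product reaches [H ^+ n], which is [H' + z]; for smaller [c] it is again a
       combination of monomials. *)
    move: cn; rewrite leq_eqVlt => /orP[/eqP cn|cn].
      exists (x * H ^+ c + a * z), a, (y * H ^+ c); split=> //.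
        by rewrite e' cn -[H ^+ n](subrK z) mulrDr [a * _ + a * z]addrC addrA.
      by apply: spanD => //; apply: span_powf_adjoin.
    exists (x * H ^+ c + a * H ^+ c.+1), 0, (y * H ^+ c); split=> //.
    * by rewrite mul0r addr0.
    * apply: spanD => //.
      apply: (span_img (f := fun x => x * H ^+ c.+1)) sa => [|x1 x2|d x1|g0 pq].
      - by rewrite mul0r.
      - by rewrite mulrDl.
      - by rewrite mulrA.
      - by apply: span_gen; exists g0, c.+1; split=> //; apply: chain_powf C _ pq.
    * exact: span0.
- have [v lv] := lead_exists V nH'.
  have [cv|] := boolP (wcomm m v); last by right; exists v.
  have [t'' et] := rm.2 v cv; subst v; left.
  have bH' : bnd H' (wpow m (n * t')).
    apply: bndD; first by rewrite wpowM; apply: bndX; case: lH.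
    apply: bndN; elim: (sz) => [|c q y [Aq [u [_ bq] le]] _ IH]; first exact: bnd0.
    apply: bndD => //; apply/bndZ/(bnd_trans bq); by rewrite ord_wpow_le.
  have le2 : (t'' <= n * t')%N by rewrite -(ord_wpow_le V rm); apply: lead_bnd lv bH'.
  have gap' q : adjoin G H n q -> ~ lead q (wpow m t'').
    by move=> Aq lq; apply: (hz q (wpow m t'')) => //; split=> //; exists t''.
  (* By fullness [G] already contains an element with leading word m^(n t'), so reduction has
     removed that word from [H']. This strictness turns the weak bound of [step_small] into
     [chain_small]. *)
  have lt2 : (t'' < n * t')%N.
    rewrite ltn_neqAle le2 andbT; apply/eqP => e2.
    have [||p [t [et Gp lp]]] := full (r := (n * t' + i0)%N).
    - by rewrite dvdn_add ?(chain_Di C) // step_dvd.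
    - apply: leq_trans step_psi_lt _; rewrite leq_add2r.
      by rewrite -{1}[t']mul1n leq_mul2r n0 orbT.
    apply: (gap' p (adjoin0 Gp)).
    by move/addIn: et; rewrite -e2 => ->.
  exists t''; split=> // q u Aq lq v nv.
  have [h1 _] := step_small Aq lq nv.
  have : (t'' * size m < n * t' * size m)%N by rewrite ltn_pmul2r ?wroot_size.
  have e1 : (n * t' = n.-1 * t' + t')%N by rewrite -{1}(prednK n0) mulSn addnC.
  move: h1; rewrite e1 /psi' !mulnDl.
  by move: (n.-1 * t' * size m)%N (u * size m)%N (t' * size m)%N (psi * size m)%N (t'' * size m)%N
    => x1 x2 x3 x4 x5; lia.
Qed.

End Step.

End Chain.

(** * Towers over the last key element *)

Section Terminal.
Variables (T : eqType) (F : fieldType) (A : nzRingType) (V : wordval T F A).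
Local Notation sc := (sc V).
Local Notation co := (co V).
Local Notation mon := (mon V).
Local Notation ord := (ord V).
Local Notation lead := (lead V).
Local Notation span := (span V).
Implicit Types (x y z : A) (u v : seq T).

(** Closure under left multiplication already reaches every product of [f] and [g], and it matches
    the way towers absorb a factor on the left. *)
Definition generate (f g : A) := forall W : A -> Prop, subspace V W -> W 1 ->
  (forall x, W x -> W (f * x)) -> (forall x, W x -> W (g * x)) -> forall x, W x.

Section Oriented.
Variables (m w : seq T) (f g : A) (i0 : nat).
Hypothesis rm : wroot m.
Hypothesis ncw : ~~ wcomm m w.
Hypothesis ormw : (ord (m ++ w) < ord (w ++ m))%N.
Hypothesis i0_gt0 : (0 < i0)%N.
Hypothesis lf : lead f (wpow m i0).
Hypothesis ls : lead (com f g) w.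
Let s := com f g.
Notation chain := (chain V m w f g i0).

(** [D] strictly decreases, so the leading word of the key element eventually leaves the powers of
    [m]. The invariant [i0 < psi] makes [t'] at least 2, so adjoining powers of [H] never creates
    the leading word [m]. *)
Lemma chain_terminal D G H psi t' : chain D G H psi -> chain_full V m i0 D G psi ->
  chain_small V m w f G psi t' -> lead H (wpow m t') ->
  (forall p, G p -> ~ lead p (wpow m t')) ->
  (i0 < psi)%N -> (forall p, G p -> ~ lead p m) ->
  exists D G H psi v, [/\ chain D G H psi, (i0 < psi)%N, forall p, G p -> ~ lead p m,
    lead H v & ~~ wcomm m v].
Proof.
have [N leD] : exists N, (D <= N)%N by exists D.
elim: N D G H psi t' leD => [|N IH] D G H psi t' leD C.
  by have := leq_trans (chain_D0 C) leD.
move=> full small lH gap lt no1.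
have [H' [C' full' alt]] := step_chain rm ncw ormw i0_gt0 lf C full small lH gap.
have lt' := step_psi_lt ncw ormw i0_gt0 lf C lH.
have [n0 t0] : (0 < (D %/ gcdn D t'))%N /\ (1 < t')%N.
  by split; [rewrite divn_gt0 ?gcdn_gt0 ?(chain_D0 C) // dvdn_leq ?(chain_D0 C) // dvdn_gcdl|lia].
have no1' p : adjoin G H (D %/ gcdn D t') p -> ~ lead p m.
  move=> /(step_lead C lH)[t [c [lp _ _ _ [q [Gq lq _]]]]] lp1.
  have : wpow m (t + c * t') = wpow m 1 by rewrite wpow1; apply: lead_uniq lp lp1.
  move/(wpow_inj rm); case: c {lp} => [|c]; last by rewrite mulSn; lia.
  by rewrite addn0 => t1; apply: no1 Gq _; rewrite -[m]wpow1 -t1.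
case: alt => [[t'' [lH' small' gap']]|[v lv nc]].
  apply: (IH _ _ _ _ _ _ C' full' small' lH' gap') => //.
    by rewrite -ltnS (leq_trans _ leD) // (step_D'_lt ncw ormw i0_gt0 lf C full lH gap).
  by apply: leq_trans lt _; rewrite leq_addr.
do 5 eexists; split; [exact: C'| |exact: no1'|exact: lv|exact: nc].
by apply: leq_trans lt _; rewrite leq_addr.
Qed.

Section Final.
Variables (D : nat) (G : A -> Prop) (H : A) (psi : nat) (v : seq T).
Hypothesis C : chain D G H psi.
Hypothesis lt : (i0 < psi)%N.
Hypothesis no1 : forall p, G p -> ~ lead p m.
Hypothesis lH : lead H v.
Hypothesis ncv : ~~ wcomm m v.

Let phi := (psi - i0)%N.

(** The leading word of [[f, H]] is the larger of v m^i0 and m^i0 v. The second would yield w m^i0 <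
    m^i0 w, against the orientation of [m] and [w]. *)
Lemma final_word : v = w ++ wpow m phi.
Proof.
have epsi : psi = (phi + i0)%N by rewrite subnK // ltnW.
suff e : v ++ wpow m i0 = w ++ wpow m psi.
  move/eqP: (e); rewrite epsi wpowD catA eqseq_cat; first by case/andP=> /eqP.
  by move/(congr1 size)/eqP: e; rewrite epsi wpowD catA !size_cat eqn_add2r => /eqP.
have ncv' : ~~ wcomm (wpow m i0) v.
  by move: i0_gt0; case: (i0) => // i _; apply: contraNN ncv => /wcomm_wpow_inv.
have lc := chain_com C.
have [lt1|le1] := ltnP (ord (wpow m i0 ++ v)) (ord (v ++ wpow m i0)).
  have := leadN (lead_com lH lf lt1); rewrite -comC => l2.
  exact: lead_uniq l2 lc.
have lt2 : (ord (v ++ wpow m i0) < ord (wpow m i0 ++ v))%N.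
  rewrite ltn_neqAle le1 andbT; apply: contraNneq ncv' => /ord_inj e.
  by rewrite /wcomm e.
have e := lead_uniq (lead_com lf lH lt2) lc.
have := ord_catl (wpow m i0) lt2.
rewrite e catA e -catA -wpowD addnC wpowD !catA ord_ltn_catr => lt3.
by have := ltn_trans lt3 (ord_pow_cat ormw i0_gt0); rewrite ltnn.
Qed.

(** A block has leading word w m^t: it is [H] for [t = phi] and [s * p] otherwise. No element of [G]
    has exponent [phi], so the two kinds of blocks never share a leading word. *)
Inductive tail : A -> seq nat -> Prop :=
| tail0 : tail 1 [::]
| tailH r ts : tail r ts -> tail (H * r) (phi :: ts)
| tailS p t r ts : G p -> lead p (wpow m t) -> tail r ts -> tail (s * (p * r)) (t :: ts).

Definition tower x := exists p t r ts, [/\ G p, lead p (wpow m t), tail r ts & x = p * r].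

Lemma tail_lead r ts : tail r ts -> lead r (flatten [seq w ++ wpow m t | t <- ts]).
Proof.
elim=> [|r' ts' _ IH|p t r' ts' Gp lp _ IH] /=; first exact: lead1.
  by apply: leadM => //; rewrite -final_word.
by rewrite -catA; do 2!apply: leadM => //.
Qed.

Lemma gap_phi p : G p -> ~ lead p (wpow m phi).
Proof.
move=> Gp lp; have [t [lp' _ nt]] := chain_lead C Gp; apply: nt.
have -> : t = phi by apply: (wpow_inj rm); apply: lead_uniq lp' lp.
by rewrite subnK // ltnW.
Qed.

Lemma tail_inv r ts : tail r ts -> match ts with
  | [::] => r = 1
  | t :: ts' => (t = phi /\ exists2 r', tail r' ts' & r = H * r') \/
      exists p r', [/\ G p, lead p (wpow m t), tail r' ts' & r = s * (p * r')]
  end.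
Proof.
case=> [//|r' ts' tr|p t r' ts' Gp lp tr]; [left|right]; last by exists p, r'.
by split=> //; exists r'.
Qed.

Lemma tail_uniq r r' ts : tail r ts -> tail r' ts -> r = r'.
Proof.
elim: ts r r' => [|t ts IH] r r' /tail_inv tr /tail_inv; first by rewrite tr.
case: tr => [[et [r1 tr1 ->]]|[p [r1 [Gp lp tr1 ->]]]].
  case=> [[_ [r2 tr2 ->]]|[p [r2 [Gp lp _ _]]]]; first by rewrite (IH r1 r2).
  by rewrite et in lp; case: (gap_phi Gp lp).
case=> [[et _]|[p' [r2 [Gp' lp' tr2 ->]]]].
  by rewrite et in lp; case: (gap_phi Gp lp).
by rewrite (IH r1 r2) // (chain_uniq C Gp Gp' lp lp').
Qed.

Lemma tower_lead x : tower x -> exists u, lead x u.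
Proof.
by case=> p [t [r [ts [Gp lp tr ->]]]]; eexists; apply: leadM lp (tail_lead tr).
Qed.

Lemma tower_uniq x y u : tower x -> tower y -> lead x u -> lead y u -> x = y.
Proof.
case=> p [t [r [ts [Gp lp tr ->]]]] [p' [t' [r' [ts' [Gp' lp' tr' ->]]]]] lx ly.
have e := lead_uniq (leadM lp (tail_lead tr)) lx.
have e' := lead_uniq (leadM lp' (tail_lead tr')) ly.
have [et ets] := wtower_inj ncw (etrans e (esym e')); subst t' ts'.
by rewrite (chain_uniq C Gp Gp' lp lp') (tail_uniq tr tr').
Qed.

(** Multiplication by [f] stays inside [G]. Multiplication by [g] is rewritten by [chain_g], whose
    three parts keep the blocks, prepend a block [H], or prepend a block [s * p]. *)
Lemma tower_full : generate f g -> forall x, span tower x.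
Proof.
move=> gen; apply: gen; first exact: span_subspace.
- apply: span_gen; exists 1, 0%N, 1, [::]; split; rewrite ?mulr1 //.
  + exact: chain_1 C.
  + exact: lead1.
  + exact: tail0.
- apply: span_img => [|x y|c x|_ [p [t [r [ts [Gp lp tr ->]]]]]].
  + by rewrite mulr0.
  + by rewrite mulrDr.
  + by rewrite sc_mulr.
  apply: span_gen; exists (f * p), (i0 + t)%N, r, ts; split; rewrite ?mulrA //.
    exact: chain_f C _ Gp.
  by rewrite wpowD; apply: leadM.
apply: span_img => [|x y|c x|_ [p [t [r [ts [Gp lp tr ->]]]]]].
- by rewrite mulr0.
- by rewrite mulrDr.
- by rewrite sc_mulr.
have tG q r' ts' : G q -> tail r' ts' -> span tower (q * r').
  move=> Gq tr'; have [t' [lq _ _]] := chain_lead C Gq.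
  by apply: span_gen; exists q, t', r', ts'.
have [x [a [z [e sx sa sz]]]] := chain_g C Gp.
rewrite mulrA e !mulrDl; apply: spanD; [apply: spanD|].
- apply: (span_img (f := fun x => x * r)) sx => [|x1 x2|d x1|q Gq].
  + by rewrite mul0r.
  + by rewrite mulrDl.
  + by rewrite mulrA.
  exact: tG tr.
- rewrite -mulrA; apply: (span_img (f := fun x => x * (H * r))) sa => [|x1 x2|d x1|q Fq].
  + by rewrite mul0r.
  + by rewrite mulrDl.
  + by rewrite -mulrA.
  by apply: tG (tailH tr); apply: chain_powf C _ Fq.
- apply: (span_img (f := fun x => x * r)) sz => [|x1 x2|d x1|_ [q [q' [Gq Gq' ->]]]].
  + by rewrite mul0r.
  + by rewrite mulrDl.
  + by rewrite mulrA.
  have [t' [lq' _ _]] := chain_lead C Gq'.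
  by rewrite -!mulrA; apply: tG (tailS Gq' lq' tr).
Qed.

(** A tower with leading word of length one is either an element of [G] with leading word [m], which
    is excluded, or has [w] itself as leading word. *)
Lemma final_letter a : generate f g -> w = [:: a].
Proof.
move=> gen; have la := lead_mon V [:: a].
have [x Tx [u lx lu]] := span_lead tower_lead tower_uniq (tower_full gen (mon [:: a])) (lead_neq0 la).
have eu := lead_uniq la lu; subst u.
case: Tx lx => p [t [r [ts [Gp lp tr ->]]]] lx.
have := lead_uniq (leadM lp (tail_lead tr)) lx.
have hm := wroot_size rm; have hw := w_neq0 ncw.
case: ts tr => [|t1 ts] tr /=.
  rewrite cats0 => e; have := congr1 size e; rewrite size_wpow /= => /eqP.
  rewrite muln_eq1 => /andP[/eqP t1 _].
  by case: (no1 Gp); rewrite -[m]wpow1 -t1.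
move=> e; have := congr1 size e; rewrite !size_cat !size_wpow /= => es.
have [t0 [t10 es']] : t = 0%N /\ t1 = 0%N /\ size (flatten [seq w ++ wpow m t | t <- ts]) = 0%N.
  by nia.
move: e; rewrite t0 t10 /= cats0; move/size0nil: es' => ->.
by rewrite cats0.
Qed.

End Final.

Variable j0 : nat.
Hypothesis lg : lead g (wpow m j0).
Hypothesis ndij : ~~ (i0 %| j0)%N.
Hypothesis ndji : ~~ (j0 %| i0)%N.

(** The construction starts with the powers of [f], the key element [g] and [psi = 0]. The first
    step is carried out separately because only afterwards does [psi] exceed [i0]. *)
Lemma oriented_single_letter a : generate f g -> w = [:: a].
Proof.
move=> gen.
have j00 : (0 < j0)%N by rewrite lt0n; apply: contraNneq ndij => ->; rewrite dvdn0.
have leadp b : lead (f ^+ b) (wpow m (b * i0)) by rewrite wpowM; apply: leadX.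
pose G := powf f.
have C : chain i0 G g 0.
  split=> //.
  - by exists 0%N; rewrite expr0.
  - by move=> _ [b ->]; exists b.+1; rewrite exprS.
  - by move=> _ [b ->]; exists (b * i0)%N; split=> //; [rewrite dvdn_mull|lia].
  - move=> _ _ u [b ->] [b' ->] l1 l2.
    have e1 := lead_uniq (leadp b) l1; have e2 := lead_uniq (leadp b') l2.
    have /eqP := wpow_inj rm (etrans e1 (esym e2)).
    by rewrite eqn_pmul2r // => /eqP ->.
  - by rewrite /= cats0.
  - move=> _ [b ->]; exists 0, (f ^+ b), (com g (f ^+ b)); split.
    + by rewrite add0r /com addrC subrK.
    + exact: span0.
    + by apply: span_gen; exists b.
    rewrite comX; apply: span_sum => l _.
    have -> : f ^+ l * com g f * f ^+ (b - l.+1) = sc (- 1) * (f ^+ l * com f g * f ^+ (b - l.+1)).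
      by rewrite sc_opp sc1 mul1r [com g f]comC mulrN mulNr.
    apply: spanZ; apply: span_gen; exists (f ^+ l), (f ^+ (b - l.+1)).
    by split=> //; [exists l|exists (b - l.+1)%N].
have full : chain_full V m i0 i0 G 0.
  move=> r /dvdnP[[|b] ->] // _; exists (f ^+ b), (b * i0)%N; split=> //.
    by rewrite mulSn addnC.
  by exists b.
have small : chain_small V m w f G 0 j0.
  by move=> _ t [b ->] _ v; rewrite comXx co0 eqxx.
have gap p : G p -> ~ lead p (wpow m j0).
  case=> b -> l2; have := wpow_inj rm (lead_uniq (leadp b) l2) => e.
  by case/negP: ndij; rewrite -e dvdn_mull.
have [H' [C' full' alt]] := step_chain rm ncw ormw i0_gt0 lf C full small lg gap.
set n := (i0 %/ gcdn i0 j0)%N in C' full' alt.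
have d0 : (0 < gcdn i0 j0)%N by rewrite gcdn_gt0 i0_gt0.
(* As neither exponent divides the other, [n] and [k] are coprime and at least 2, whence
   [n < n.-1 * k]; the borderline case [n = k = 2] is not coprime. *)
have lt : (i0 < 0 + n.-1 * j0)%N.
  have ei : i0 = (n * gcdn i0 j0)%N by rewrite /n divnK // dvdn_gcdl.
  pose k := (j0 %/ gcdn i0 j0)%N.
  have ej : j0 = (k * gcdn i0 j0)%N by rewrite /k divnK // dvdn_gcdr.
  have cnk : coprime n k by rewrite /coprime -(eqn_pmul2r d0) muln_gcdl -ei -ej mul1n.
  have n1 : n <> 1%N.
    by move=> n1; case/negP: ndij; rewrite ei n1 mul1n dvdn_gcdr.
  have k1 : k <> 1%N.
    by move=> k1; case/negP: ndji; rewrite ej k1 mul1n dvdn_gcdl.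
  have n0 : (0 < n)%N by move: i0_gt0; rewrite ei muln_gt0 => /andP[].
  have k0 : (0 < k)%N by move: j00; rewrite ej muln_gt0 => /andP[].
  rewrite add0n [X in (X < _)%N]ei [X in (_ < _ * X)%N]ej mulnA ltn_pmul2r //.
  have [n2|n2] := eqVneq n 2%N; last first.
    have n3 : (2 < n)%N by lia.
    by apply: (@leq_trans (n.-1 * 2)); [lia|rewrite leq_mul2l; lia].
  rewrite n2 mul1n ltn_neqAle; apply/andP; split; last by lia.
  by apply/eqP => k2; move: cnk; rewrite n2 -k2.
have no1 p : adjoin G g n p -> ~ lead p m.
  move=> /(step_lead C lg)[t [c [lp dt _ _ _]]] lp1.
  have : wpow m (t + c * j0) = wpow m 1 by rewrite wpow1; apply: lead_uniq lp lp1.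
  move/(wpow_inj rm); case: c {lp} => [|c].
    rewrite addn0 => t1; move: dt; rewrite t1 dvdn1 => /eqP i1.
    by case/negP: ndij; rewrite i1 dvd1n.
  rewrite mulSn => e; case/negP: ndji; have -> : j0 = 1%N by lia.
  exact: dvd1n.
have term : exists D G H psi v, [/\ chain D G H psi, (i0 < psi)%N,
    forall p, G p -> ~ lead p m, lead H v & ~~ wcomm m v].
  case: alt => [[t'' [lH' small' gap']]|[v lv nc]].
    exact: chain_terminal C' full' small' lH' gap' lt no1.
  do 5 eexists; split; [exact: C'|exact: lt|exact: no1|exact: lv|exact: nc].
have [D [G' [H [psi [v [C2 lt2 no2 lH nc]]]]]] := term.
exact: final_letter C2 lt2 no2 lH nc a gen.
Qed.

End Oriented.
End Terminal.

(** * Divisibility of the exponents *)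

Lemma rev_wpow (T : eqType) (m : seq T) n : rev (wpow m n) = wpow (rev m) n.
Proof.
elim: n => // n IH; have -> : n.+1 = (n + 1)%N by rewrite addn1.
by rewrite wpowD wpow1 rev_cat IH addn1.
Qed.

Lemma rev_eq_cat (T : eqType) (u v w : seq T) : (rev w = u ++ v) -> w = rev v ++ rev u.
Proof. by move=> e; rewrite -rev_cat -e revK. Qed.

Lemma wcomm_rev (T : eqType) (u v : seq T) : wcomm (rev u) (rev v) = wcomm u v.
Proof. by rewrite /wcomm -!rev_cat eq_sym (inj_eq (can_inj revK)). Qed.

Lemma wroot_rev (T : eqType) (m : seq T) : wroot m -> wroot (rev m).
Proof.
case=> nm h; split; first by rewrite -size_eq0 size_rev size_eq0.
move=> v; rewrite -{1}[v]revK wcomm_rev => /h[j e]; exists j.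
by rewrite -rev_wpow -e revK.
Qed.

Section Reverse.
Variables (T : eqType) (F : fieldType) (A : nzRingType) (V : wordval T F A).

(** In the converse ring words are read backwards, which exchanges the two possible orders of [m w]
    and [w m]. *)
Definition rev_wordval : wordval T F A^c.
Proof.
refine (@WordVal T F A^c (sc V) (fun w => mon V (rev w)) (fun x w => co V x (rev w))
  (fun w => ord V (rev w)) _ _ _ _ _ _ _ _ _ _ _ _ _).
- move=> c x; exact (esym (sc_comm V c x)).
- move=> c x w; have -> : (sc V c : A^c) * x = (x : A^c) * sc V c by exact (esym (sc_comm V c x)).
  exact: (co_sc V c x).
- by move=> x y w; apply: (co_add V).
- exact: (mon_nil V).
- by move=> u v; rewrite rev_cat; apply: (mon_cat V).
- by move=> u w; rewrite co_mon (inj_eq (can_inj revK)).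
- move=> x y w nz; have [u [v [e nu nv]]] := @co_mul T F A V y x (rev w) nz.
  by exists (rev v), (rev u); rewrite !revK; split=> //; apply: rev_eq_cat.
- by move=> x h; apply: (@co_ext _ _ _ V) => w; rewrite -[w]revK.
- by move=> x; have [N hN] := co_bounded V x; exists N => w; apply: hN.
- by move=> u v /(@ord_inj _ _ _ V)/(can_inj revK).
- by move=> u v lt; apply: (@ord_size _ _ _ V); rewrite !size_rev.
- by move=> c u v lt; rewrite !rev_cat; apply: (@ord_catr _ _ _ V).
- by move=> c u v lt; rewrite !rev_cat; apply: (@ord_catl _ _ _ V).
Defined.

Lemma rev_lead (x : A) w : lead V x w -> lead rev_wordval (x : A^c) (rev w).
Proof.
case=> n b; split; first by rewrite /= revK.
by move=> v /= /b; rewrite revK.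
Qed.

End Reverse.

Local Notation rev_lead_of V := (lead (rev_wordval V)).
Local Notation rev_ord_of V := (ord (rev_wordval V)).

(** * Leading words of a generating pair *)

Section Generators.
Variables (T : eqType) (F : fieldType) (A : nzRingType) (V : wordval T F A).
Local Notation mon := (mon V).
Local Notation ord := (ord V).
Local Notation lead := (lead V).
Local Notation span := (span V).
Variables (f g : A).
Hypothesis genl : generate V f g.
Hypothesis genr : forall W : A -> Prop, subspace V W -> W 1 ->
  (forall x, W x -> W (x * f)) -> (forall x, W x -> W (x * g)) -> forall x, W x.
Variables (a b : T).
Hypothesis nab : a != b.

(** If [f] and [g] commuted, every element would commute with both of them, and then with every
    other element; two distinct letters do not commute. *)
Lemma gen_com_neq0 : com f g != 0.
Proof.
apply/eqP => c0; have cfg : f * g = g * f by apply/eqP; rewrite -subr_eq0; apply/eqP.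
have sub x : subspace V (fun y => y * x = x * y).
  split; first by rewrite mul0r mulr0.
    by move=> y z e1 e2; rewrite mulrDl mulrDr e1 e2.
  by move=> c y e; rewrite -mulrA e sc_mulr.
have cl (x y : A) : y * x = x * y -> forall z : A, z * x = x * z -> (y * z) * x = x * (y * z).
  by move=> e z e2; rewrite -mulrA e2 !mulrA e.
have W1 (x : A) : 1 * x = x * 1 by rewrite mul1r mulr1.
have cf := genl (sub f) (W1 f) (cl f f erefl) (cl f g (esym cfg)).
have cg := genl (sub g) (W1 g) (cl g f cfg) (cl g g erefl).
have cc y := genl (sub y) (W1 y) (cl y f (esym (cf y))) (cl y g (esym (cg y))).
have := cc (mon [:: a]) (mon [:: b]); rewrite -!mon_cat /=.
move/(congr1 (fun x => co V x [:: b; a])); rewrite !co_mon eqxx /=.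
rewrite eqseq_cons (negbTE nab) /= => /eqP; by rewrite oner_eq0.
Qed.

(** The oriented result, applied to the pair or to its mirror image, identifies one fixed word with
    every letter, but [a] and [b] are different. *)
Lemma no_bad_pair p m i j : p \in [pchar F] -> wroot m -> lead f (wpow m i) -> lead g (wpow m j) ->
  ~~ (i %| j)%N -> ~~ (j %| i)%N -> False.
Proof.
move=> pF rm lf lg nij nji.
have i0 : (0 < i)%N by rewrite lt0n; apply: contraNneq nji => ->; rewrite dvdn0.
have [w lw] := lead_exists V gen_com_neq0.
have ncw : ~~ wcomm m w.
  apply/negP => /rm.2[t e]; subst w; exact (com_not_pow rm pF lf lg lw).
have nab' : [:: a] != [:: b] by rewrite eqseq_cons eqxx andbT.
case: (ltngtP (ord (m ++ w)) (ord (w ++ m))) => [lt|lt|/(@ord_inj _ _ _ V)e].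
- have e := @oriented_single_letter _ _ _ V m w f g i rm ncw lt i0 lf lw j lg nij nji.
  by case/eqP: nab'; rewrite -(e a genl) -(e b genl).
- have lf' := rev_lead lf; have lg' := rev_lead lg; rewrite rev_wpow in lf'; rewrite rev_wpow in lg'.
  have lw' : rev_lead_of V (com (f : A^c) (g : A^c)) (rev w).
    have -> : com (f : A^c) (g : A^c) = - com f g by rewrite /com opprB.
    exact: leadN (rev_lead lw).
  have ncw' : ~~ wcomm (rev m) (rev w) by rewrite wcomm_rev.
  have lt' : (rev_ord_of V (rev m ++ rev w) < rev_ord_of V (rev w ++ rev m))%N.
    by rewrite /= !rev_cat !revK.
  have gen' : generate (rev_wordval V) (f : A^c) (g : A^c).
    move=> W [W0 WD WZ] W1 Wf Wg; apply: genr => //; split=> // c x Wx.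
    by rewrite sc_comm; apply: WZ.
  have e := @oriented_single_letter _ _ _ (rev_wordval V) (rev m) (rev w) _ _ i (wroot_rev rm)
    ncw' lt' i0 lf' lw' j lg' nij nji.
  by case/eqP: nab'; rewrite -(e a gen') -(e b gen').
- by case/negP: ncw; rewrite /wcomm e.
Qed.

Lemma lead_free u v : lead f u -> lead g v -> ~~ wcomm u v -> size u = 1%N /\ size v = 1%N.
Proof.
move=> lf lg nc.
have nu : (0 < size u)%N by rewrite lt0n size_eq0; apply: contraNneq nc => ->; rewrite wcommC wcomm_nil.
have nv : (0 < size v)%N by rewrite lt0n size_eq0; apply: contraNneq nc => ->; rewrite wcomm_nil.
pose pr (l : seq bool) := \prod_(c <- l) (if c then f else g).
pose G x := exists l, x = pr l.
have lpr l : lead (pr l) (flatten [seq if c then u else v | c <- l]).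
  rewrite /pr; elim: l => [|c l IH] /=; first by rewrite big_nil; apply: lead1.
  by rewrite big_cons; apply: leadM => //; case: c.
have full x : span G x.
  move: x; apply: genl; first exact: span_subspace.
  - by apply: span_gen; exists [::]; rewrite /pr big_nil.
  - apply: span_img => [|x y|c x|_ [l ->]]; rewrite ?mulr0 ?mulrDr ?sc_mulr //.
    by apply: span_gen; exists (true :: l); rewrite /pr big_cons.
  - apply: span_img => [|x y|c x|_ [l ->]]; rewrite ?mulr0 ?mulrDr ?sc_mulr //.
    by apply: span_gen; exists (false :: l); rewrite /pr big_cons.
have letter c : u = [:: c] \/ v = [:: c].
  have lc := lead_mon V [:: c].
  have [||_ [l ->] [w lw lcw]] := span_lead _ _ (full (mon [:: c])) (lead_neq0 lc).
  - by move=> _ [l ->]; eexists; apply: lpr.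
  - move=> _ _ w [l ->] [l' ->] l1 l2; congr pr; apply: (wgen_inj nc) => /=.
    by rewrite (lead_uniq (lpr l) l1) (lead_uniq (lpr l') l2).
  have := lead_uniq (lpr l) lw; rewrite -(lead_uniq lc lcw) {lw}.
  case: l => [|d [|d' l]] //=; first by rewrite cats0; case: d; [left|right].
  move=> /(congr1 size); rewrite !size_cat /=.
  have : (0 < size (if d then u else v))%N by case: d.
  have : (0 < size (if d' then u else v))%N by case: d'.
  lia.
case: (letter a) (letter b) => [-> [[/eqP]|->]|-> [->|[/eqP]]] //; by rewrite (negbTE nab).
Qed.

Lemma lead_powers p u v : p \in [pchar F] -> lead f u -> lead g v ->
  [\/ exists k, v = wpow u k, exists k, u = wpow v k | size u = 1%N /\ size v = 1%N].
Proof.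
move=> pF lf lg; have [c|nc] := boolP (wcomm u v); last by apply: Or33; apply: lead_free.
have [->|nu] := eqVneq u [::]; first by apply: Or32; exists 0%N.
have [m [i [rm eu]]] := wroot_exists nu.
have [j ev] : exists j, v = wpow m j.
  apply: rm.2; apply: (wcomm_trans nu) => //.
  by rewrite wcommC eu; apply/wcomm_wpow/wcomm_refl.
subst u v.
have [/dvdnP[k ->]|nij] := boolP (i %| j)%N; first by apply: Or31; exists k; rewrite wpowM.
have [/dvdnP[k ->]|nji] := boolP (j %| i)%N; first by apply: Or32; exists k; rewrite wpowM.
by case: (no_bad_pair pF rm lf lg nij nji).
Qed.

End Generators.

(** * The free algebra on two generators *)

(* The deglex order on words in two letters is the order of the binary
   numbers 1w. *)
Definition wval (w : seq 'I_2) : nat := foldl (fun n (i : 'I_2) => (n.*2 + i)%N) 0%N w.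
Definition wcode (w : seq 'I_2) : nat := (2 ^ size w + wval w)%N.

Lemma wval_rcons w i : wval (rcons w i) = ((wval w).*2 + i)%N.
Proof. by rewrite /wval foldl_rcons. Qed.

Lemma wcode_rcons w i : wcode (rcons w i) = ((wcode w).*2 + i)%N.
Proof. by rewrite /wcode wval_rcons size_rcons expnS mul2n doubleD addnA. Qed.

Lemma wval_cat u v : wval (u ++ v) = (wval u * 2 ^ size v + wval v)%N.
Proof.
elim/last_ind: v => [|v i IH]; first by rewrite cats0 muln1 addn0.
by rewrite -rcons_cat !wval_rcons IH size_rcons expnS doubleD -!mul2n; nia.
Qed.

Lemma wval_lt w : (wval w < 2 ^ size w)%N.
Proof.
elim/last_ind: w => [//|w i IH]; rewrite wval_rcons size_rcons expnS -mul2n.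
by have := ltn_ord i; lia.
Qed.

Lemma wcode_cat u v : wcode (u ++ v) = (wcode u * 2 ^ size v + wval v)%N.
Proof. by rewrite /wcode wval_cat size_cat expnD mulnDl addnA. Qed.

Lemma wcode_size u v : (size u < size v)%N -> (wcode u < wcode v)%N.
Proof.
move=> lt; rewrite /wcode; apply: leq_trans (leq_addr _ _).
apply: leq_trans (_ : (2 ^ (size u).+1 <= _)%N); last by rewrite leq_exp2l.
by rewrite expnS mul2n -addnn ltn_add2l wval_lt.
Qed.

Lemma wcode_inj : injective wcode.
Proof.
elim/last_ind => [|u i IH] v; elim/last_ind: v => [|v j _] //.
- by rewrite wcode_rcons /wcode /wval /=; have := expn_gt0 2 (size v); lia.
- by rewrite wcode_rcons /wcode /wval /=; have := expn_gt0 2 (size u); lia.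
rewrite !wcode_rcons => e; have [e1 e2] : wcode u = wcode v /\ i = j :> nat.
  by have := ltn_ord i; have := ltn_ord j; move: (wcode u) (wcode v) e; lia.
by rewrite (IH _ e1) (val_inj e2).
Qed.

Lemma wcode_catl c u v : (wcode u < wcode v)%N -> (wcode (c ++ u) < wcode (c ++ v))%N.
Proof.
move=> lt; case: (ltngtP (size u) (size v)) => [l|l|e].
- by apply: wcode_size; rewrite !size_cat ltn_add2l.
- by have := ltn_trans lt (wcode_size l); rewrite ltnn.
by rewrite !wcode_cat e ltn_add2l; move: lt; rewrite /wcode e ltn_add2l.
Qed.

Lemma wcode_catr c u v : (wcode u < wcode v)%N -> (wcode (u ++ c) < wcode (v ++ c))%N.
Proof. by move=> lt; rewrite !wcode_cat ltn_add2r ltn_pmul2r // expn_gt0. Qed.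

Section FreeAlgebra.
Variable F : fieldType.
Notation A := (freeAlg2 F).

Definition word_mon (w : seq 'I_2) : A := mkmalgU (FMonom w) 1.

Lemma scalarC (c : F) (z : A) : malgC c * z = z * malgC c.
Proof.
apply/malgP => k; rewrite mul_malgC mcoeffZ.
rewrite (mcoeffMlw _ (fsubset_refl _) msuppU_le).
rewrite (eq_bigr (fun k1 => (mcoeff k1 z * c) *+ (k1 == k))).
  have [kz|kz] := boolP (k \in msupp z).
    rewrite (big_fsetD1 k) //= eqxx big1_fset ?addr0 1?mulrC // => k1.
    by rewrite in_fsetD1 => /andP[/negbTE ->].
  rewrite (mcoeff_outdom kz) mulr0 big1_fset // => k1 k1z _.
  by case: eqP k1z kz => // -> ->.
by move=> k1 _; rewrite big_seq_fset1 mcoeffUU mulm1.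
Qed.

Definition free_wordval : wordval 'I_2 F A.
Proof.
refine (@WordVal _ F A (fun c => malgC c) word_mon (fun x w => mcoeff (FMonom w) x)
  wcode _ _ _ _ _ _ _ _ _ wcode_inj wcode_size wcode_catl wcode_catr).
- exact: scalarC.
- by move=> c x w; rewrite mcoeffCM.
- by move=> x y w; rewrite mcoeffD.
- by rewrite /word_mon -mpolyC1E; congr mkmalgU; apply/eqP; rewrite /mone /= /fmone fmE.
- move=> u v; rewrite /word_mon [RHS]malgM_def fgmulUU mulr1; congr mkmalgU.
  by rewrite /mmul /= /fmmul fmE.
- by move=> u w; rewrite mcoeffU1; congr (nat_of_bool _)%:R.
- move=> x y w; rewrite mcoeff_neq0 => /msuppM_le[k1 [k2 [h1 h2 e]]].
  exists (fmonom_val k1), (fmonom_val k2); rewrite !mcoeff_neq0.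
  have eta (k : fmonom 'I_2) : FMonom (fmonom_val k) = k by case: k.
  by rewrite !eta; split=> //; move: e; rewrite /mmul /= /fmmul fmE => -[].
- by move=> x h; apply/malgP => -[w]; rewrite h mcoeff0.
- move=> x; exists (\max_(k <- msupp x) wcode (fmonom_val k))%N => w.
  rewrite mcoeff_neq0 => h.
  by apply: (@leq_bigmax_seq _ (enum_fset (msupp x)) predT (fun k : fmonom 'I_2 => wcode (fmonom_val k)) (FMonom w)).
Defined.

End FreeAlgebra.

Section Degree.
Variable F : fieldType.
Notation A := (freeAlg2 F).
Notation V := (free_wordval F).
Notation lead := (lead V).
Notation slt := (slt V).
Implicit Types (x y z f g : A) (c : F).

Lemma fdegree_lead z w : lead z w -> fdegree z = size w.
Proof.
move=> [nz b]; apply/eqP; rewrite eqn_leq /fdegree; apply/andP; split.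
  rewrite -ltnS; apply: (@leq_ltn_trans (size w)); last by [].
  suff : (mmeasure (@fdeg 'I_2) z <= (size w).+1)%N by case: mmeasure.
  rewrite mmeasureE; apply/bigmax_leqP_seq => -[v] hv _.
  rewrite ltnS leqNgt; apply/negP => /wcode_size.
  by rewrite ltnNge (b v) //= mcoeff_neq0.
have : (size w < mmeasure (@fdeg 'I_2) z)%N.
  by apply: (@mmeasure_mnm_lt _ _ _ z (FMonom w)); rewrite -mcoeff_neq0.
by case: mmeasure.
Qed.

Lemma fdegree0 : fdegree (0 : A) = 0%N.
Proof. by rewrite /fdegree mmeasure0. Qed.

(** Positivity of [n] accounts for the convention that zero has degree 0. *)
Lemma fdegree_slt n z : (0 < n)%N -> (fdegree z < n)%N <-> slt n z.
Proof.
move=> n0; have [->|nz] := eqVneq z 0; first by rewrite fdegree0; split=> // _; exact: slt0.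
have [w lw] := lead_exists V nz; rewrite (fdegree_lead lw); split; last exact: lead_slt.
by move=> lt v nv; apply: leq_trans lt; case: lw => _ /bnd_slt; apply.
Qed.

Arguments fdegree_slt {n z} _.

Lemma fdegreeX x k : x != 0 -> x ^+ k != 0 /\ fdegree (x ^+ k) = (k * fdegree x)%N.
Proof.
move=> /(lead_exists V)[u lu]; have l := leadX k lu.
split; first exact: lead_neq0 l.
by rewrite (fdegree_lead l) (fdegree_lead lu) size_wpow.
Qed.

Lemma fdegreeZ c x : c != 0 -> fdegree (c *: x) = fdegree x.
Proof.
move=> nc; have [->|nx] := eqVneq x 0; first by rewrite scaler0.
have [u lu] := lead_exists V nx.
by rewrite -mul_malgC (fdegree_lead (leadZ nc lu)) (fdegree_lead lu).
Qed.

Lemma fdegreeD_lt n x y : (fdegree x < n)%N -> (fdegree y < n)%N -> (fdegree (x + y)%R < n)%N.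
Proof.
move=> hx; have n0 : (0 < n)%N := leq_ltn_trans (leq0n _) hx.
by move: hx => /(fdegree_slt n0) hx /(fdegree_slt n0) hy; apply/(fdegree_slt n0); apply: sltD.
Qed.

Lemma fdegreeN x : fdegree (- x) = fdegree x.
Proof. by rewrite /fdegree mmeasureN. Qed.

Lemma fdegreeDl x y : (fdegree y < fdegree x)%N -> fdegree (x + y) = fdegree x.
Proof.
move=> lt; have nx : x != 0 by apply: contraTneq lt => ->; rewrite fdegree0.
have [u lu] := lead_exists V nx; rewrite (fdegree_lead lu) in lt *.
apply: fdegree_lead; apply: lead_sbndD => //.
have u0 := leq_ltn_trans (leq0n _) lt.
by apply: (@slt_sbnd _ _ _ V (size u)) => //; apply/(fdegree_slt u0).
Qed.

Lemma fdegree_neq0 x : (0 < fdegree x)%N -> x != 0.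
Proof. by apply: contraTneq => ->; rewrite fdegree0. Qed.

Lemma fdegree_eq0 x : fdegree x = 0%N -> exists c, x = c *: 1.
Proof.
move=> d0; exists (mcoeff (FMonom [::]) x); apply: (co_inj (V := V)) => w /=.
rewrite mcoeffZ; case: w => [|i w].
  by rewrite (_ : 1 = word_mon F [::]) ?mcoeffUU ?mulr1 // -(mon_nil V).
have lt : (fdegree x < 1)%N by rewrite d0.
have -> : mcoeff (FMonom (i :: w)) x = 0.
  apply/eqP/negPn/negP => nz.
  by move: (lt) => /(fdegree_slt (ltn0Sn 0))/(_ _ nz).
rewrite -(mon_nil V) /= mcoeffU1; case: eqP => [|_]; last by rewrite mulr0.
by case.
Qed.

End Degree.

(** * Automorphisms as pairs of images, and the degree reduction *)

Section Automorphisms.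
Variable F : fieldType.
Notation A := (freeAlg2 F).
Notation V := (free_wordval F).
Implicit Types (x y z f g : A) (c : F).
Notation X := (fx F).
Notation Y := (fy F).

Lemma letter_split (i : 'I_2) : i = 0 \/ i = 1.
Proof. by case: i => -[|[|//]] h; [left|right]; apply: val_inj. Qed.

Definition algmorph (phi : A -> A) := linear phi /\ monoid_morphism phi.

Lemma word_mon_cons i w : word_mon F (i :: w) = (if i == 0 then X else Y) * word_mon F w.
Proof.
have -> : (if i == 0 then X else Y) = word_mon F [:: i].
  by case: (letter_split i) => ->; rewrite /= /fx /fy fmuE.
exact: (mon_cat V [:: i] w).
Qed.

Lemma algmorph_sum phi z : algmorph phi ->
  phi z = \sum_(k <- msupp z) (mcoeff k z) *: phi (word_mon F (fmonom_val k)).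
Proof.
move=> [lp _]; have p0 : phi 0 = 0 by have := lp (-1) 0 0; rewrite scaler0 addr0 scaleN1r addNr.
rewrite {1}[z]monalgE; elim: (enum_fset _) => [|k r IH]; first by rewrite !big_nil.
rewrite !big_cons -IH -lp; congr (phi (_ + _)); apply/malgP => l.
by rewrite mcoeffZ !mcoeffU mulr_natr; case: k {IH}.
Qed.

Lemma algmorph_ext phi psi : algmorph phi -> algmorph psi ->
  phi X = psi X -> phi Y = psi Y -> phi =1 psi.
Proof.
move=> mp ms eX eY z; rewrite (algmorph_sum _ mp) (algmorph_sum _ ms).
apply: eq_bigr => k _; congr (_ *: _); elim: (fmonom_val k) => [|i w IH].
  by rewrite (mon_nil V : word_mon F [::] = 1) mp.2.1 ms.2.1.
by rewrite word_mon_cons mp.2.2 ms.2.2 IH; case: ifP => _; rewrite ?eX ?eY.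
Qed.

Lemma algmorph_id : algmorph id.
Proof. by split. Qed.

Lemma algmorph_comp phi psi : algmorph phi -> algmorph psi -> algmorph (phi \o psi).
Proof.
move=> [l1 [one1 m1]] [l2 [one2 m2]]; split; first by move=> c x y /=; rewrite l2 l1.
by split=> [|x y] /=; rewrite ?one2 ?one1 // m2 m1.
Qed.

Section Eval.
Variables f g : A.
Definition evalw (k : fmonom 'I_2) : A := \prod_(i <- fmonom_val k) (if i == 0 then f else g).
Lemma evalw_morph : mmorphism evalw.
Proof.
split=> [k l|]; rewrite /evalw; last by rewrite /mone /= /fmone fmE /= big_nil.
by rewrite /mmul /= /fmmul fmE /= big_cat.
Qed.
HB.instance Definition _ := isMultiplicative.Build (fmonom 'I_2) A evalw evalw_morph.

Definition eval : A -> A := mmap (@mkmalgU (fmonom 'I_2) F mone) evalw.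

Lemma eval_algmorph : algmorph eval.
Proof.
split.
  move=> c x y; rewrite /eval mmapD; congr (_ + _).
  by rewrite mmapZ mul_malgC.
have [mm m1] : GRing.multiplicative eval.
  by apply: commr_mmap_is_multiplicative => z k l; apply: scalarC.
by split.
Qed.

Lemma evalX : eval X = f.
Proof.
rewrite /eval /fx mmapU -[RHS]mul1r; congr (_ * _).
by rewrite /evalw fmuE big_seq1.
Qed.
Lemma evalY : eval Y = g.
Proof.
rewrite /eval /fy mmapU -[RHS]mul1r; congr (_ * _).
by rewrite /evalw fmuE big_seq1.
Qed.
End Eval.

Definition autpair f g := exists phi : A -> A, [/\ is_alg_automorphism phi, phi X = f & phi Y = g].

Lemma autpair_eval f g f' g' : eval f g f' = X -> eval f g g' = Y ->
  eval f' g' f = X -> eval f' g' g = Y -> is_alg_automorphism (eval f g).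
Proof.
move=> e1 e2 e3 e4; have [l m] := eval_algmorph f g; split=> //.
have inv a b a' b' : eval a b a' = X -> eval a b b' = Y -> cancel (eval a' b') (eval a b).
  move=> h1 h2; apply: algmorph_ext (algmorph_comp (eval_algmorph a b) (eval_algmorph a' b')) algmorph_id _ _.
    by rewrite /= evalX.
  by rewrite /= evalY.
by exists (eval f' g'); apply: inv.
Qed.

Lemma autpair_comp f g f' g' : autpair f g -> is_alg_automorphism (eval f' g') ->
  autpair (eval f g f') (eval f g g').
Proof.
case=> phi [[lp mp bp] eX eY] [lq mq bq].
have e : eval f g =1 phi.
  exact: algmorph_ext (eval_algmorph f g) (conj lp mp) (etrans (evalX f g) (esym eX))
    (etrans (evalY f g) (esym eY)).
exists (phi \o eval f' g'); split.
- have [l m] := algmorph_comp (conj lp mp) (conj lq mq).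
  by split=> //; apply: bij_comp.
- by rewrite /= evalX e.
- by rewrite /= evalY e.
Qed.

Lemma evalZ f g c z : eval f g (c *: z) = c *: eval f g z.
Proof. by rewrite /eval mmapZ mul_malgC. Qed.

Lemma eval_scale f g c z k : eval f g (c *: z ^+ k) = c *: eval f g z ^+ k.
Proof.
have [_ [m1 m]] := eval_algmorph f g.
rewrite evalZ; congr (_ *: _).
by elim: k => [|k IH]; [exact: m1|rewrite !exprS m IH].
Qed.

Lemma evalD f g x y : eval f g (x + y) = eval f g x + eval f g y.
Proof. by rewrite /eval mmapD. Qed.

Lemma autpair_elementary f g c k : autpair f g -> autpair f (g + c *: f ^+ k).
Proof.
move=> ap.
have eY d e : eval X (Y + d *: X ^+ k) (Y + e *: X ^+ k) = Y + (d + e) *: X ^+ k.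
  by rewrite evalD eval_scale evalX evalY -addrA scalerDl.
have aut : is_alg_automorphism (eval X (Y + c *: X ^+ k)).
  apply: (autpair_eval (f' := X) (g' := Y + (- c) *: X ^+ k)); rewrite ?evalX ?eY //.
    by rewrite addrN scale0r addr0.
  by rewrite addNr scale0r addr0.
have := autpair_comp ap aut.
by rewrite evalX evalD evalY eval_scale evalX.
Qed.

Lemma autpair_swap f g : autpair f g -> autpair g f.
Proof.
move=> ap; have aut : is_alg_automorphism (eval Y X).
  by apply: (autpair_eval (f' := Y) (g' := X)); rewrite ?evalX ?evalY.
by have := autpair_comp ap aut; rewrite evalX evalY.
Qed.

(** Both one-sided closures are recorded because the mirror-image argument takes place in the
    converse ring. *)
Lemma autpair_gen f g : autpair f g -> generate V f g /\
  (forall W : A -> Prop, subspace V W -> W 1 ->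
  (forall x, W x -> W (x * f)) -> (forall x, W x -> W (x * g)) -> forall x, W x).
Proof.
case=> phi [[lp [p1 pm] [psi _ can]] eX eY].
have mp : algmorph phi by split.
have sub (W : A -> Prop) : subspace V W -> (forall w, W (phi (word_mon F w))) -> forall x, W x.
  move=> [W0 WD WZ] h x; rewrite -[x]can (algmorph_sum _ mp).
  elim/big_rec: _ => // k y _ Wy; apply: WD => //.
  by rewrite -mul_malgC; apply: WZ.
have p0 : phi (word_mon F [::]) = 1 by rewrite (mon_nil V : word_mon F [::] = 1).
split=> W sW W1 Wf Wg; apply: sub => // w.
  elim: w => [|i w IH]; first by rewrite p0.
  by rewrite word_mon_cons pm; case: ifP => _; rewrite ?eX ?eY; [apply: Wf|apply: Wg].
elim/last_ind: w => [|w i IH]; first by rewrite p0.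
have -> : word_mon F (rcons w i) = word_mon F w * word_mon F [:: i].
  by rewrite -cats1; apply: (mon_cat V w [:: i]).
have -> : word_mon F [:: i] = (if i == 0 then X else Y).
  by case: (letter_split i) => ->; rewrite /= /fx /fy fmuE.
by rewrite pm; case: ifP => _; rewrite ?eX ?eY; [apply: Wf|apply: Wg].
Qed.

Lemma autpair_fdegree_gt0 f g : autpair f g -> (0 < fdegree f)%N.
Proof.
case=> phi [[lp [p1 pm] bp] eX eY]; rewrite lt0n; apply/eqP => /fdegree_eq0[c ec].
have p0 : phi 0 = 0 by have := lp (-1) 0 0; rewrite scaler0 addr0 scaleN1r addNr.
have : phi X = phi (c *: 1 + 0) by rewrite lp p1 p0 addr0 eX.
move/(bij_inj bp)/(congr1 (mcoeff (FMonom [:: 0]))).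
rewrite addr0 mcoeffZ /fx fmuE mcoeffUU -(mon_nil V) /= mcoeffU1.
by rewrite eqE /= mulr0 => /eqP; rewrite oner_eq0.
Qed.

Lemma autpair_reduce p f g : p \in [pchar F] -> autpair f g -> (fdegree f <= fdegree g)%N ->
  (1 < fdegree g)%N -> exists k c, [/\ (0 < k)%N, c != 0, fdegree g = (k * fdegree f)%N &
    (fdegree (g - c *: f ^+ k)%R < fdegree g)%N].
Proof.
move=> pF.
have power f1 g1 : autpair f1 g1 -> (fdegree f1 <= fdegree g1)%N -> (1 < fdegree g1)%N ->
    exists u k, [/\ lead V f1 u, lead V g1 (wpow u k), (0 < k)%N & (0 < size u)%N].
  move=> ap le1 gt1; have [gl gr] := autpair_gen ap.
  have f0 := autpair_fdegree_gt0 ap.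
  have [u lu] := lead_exists V (fdegree_neq0 f0).
  have [v lv] := lead_exists V (fdegree_neq0 (ltnW gt1)).
  have du := fdegree_lead lu; have dv := fdegree_lead lv.
  have n01 : (0 : 'I_2) != 1 by [].
  have u0 : (0 < size u)%N by rewrite -du.
  have v0 : (0 < size v)%N by rewrite -dv ltnW.
  have [[k ev]|[k eu]|[_ sv]] := lead_powers gl gr n01 pF lu lv.
  - exists u, k; split=> //; first by rewrite -ev.
    by case: k ev => // ev; rewrite ev in v0.
  - exists u, 1%N; split=> //; rewrite wpow1.
    suff -> : u = v by [].
    case: k eu => [|[|k]] eu; first by rewrite eu in u0.
      by rewrite eu wpow1.
    move: le1; rewrite du dv eu size_wpow => le1.
    have : (2 * size v <= size v)%N by apply: leq_trans le1; rewrite leq_mul2r orbT.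
    lia.
  - by move: gt1; rewrite dv sv.
move=> ap le1 gt1; have [u [k [lf lg k0 u0]]] := power f g ap le1 gt1.
have lfk := leadX k lf; have [_ bg] := lg.
have sb := reduce lfk bg; set c := (_ / _) in sb.
have dg : fdegree g = (k * fdegree f)%N.
  by rewrite (fdegree_lead lg) (fdegree_lead lf) size_wpow.
have nc : c != 0 by rewrite mulf_neq0 ?invr_eq0 //; [case: lg|case: lfk].
exists k, c; split=> //.
have eg : g - c *: f ^+ k = g - sc V c * f ^+ k by rewrite /= mul_malgC.
have [lt|ge] := ltnP (fdegree (g - c *: f ^+ k)) (fdegree g) => //.
(* So far only the leading word is known to drop. If the degree did not, the same power statement
   for the new pair would give it a leading word u^k' with [k <= k'], which is not below u^k. *)
have ap' : autpair f (g - c *: f ^+ k) by rewrite -scaleNr; apply: autpair_elementary.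
have [u' [k' [lf' lg' k0' _]]] := power _ _ ap' (leq_trans le1 ge) (leq_trans gt1 ge).
have eu := lead_uniq lf lf'; subst u'; rewrite eg in lg'.
have := lead_sbnd lg' sb.
have : (k <= k')%N.
  rewrite -(leq_pmul2r u0) -!size_wpow -(fdegree_lead lg) -(fdegree_lead lg') -eg.
  exact: ge.
rewrite leq_eqVlt => /orP[/eqP->|lt]; first by rewrite ltnn.
have := ord_size V (u := wpow u k) (v := wpow u k').
rewrite !size_wpow ltn_pmul2r // => /(_ lt) lt1 lt2.
by have := ltn_trans lt1 lt2; rewrite ltnn.
Qed.

End Automorphisms.

(** * Counting pairs of generators *)

Section Counts.
Implicit Types T U : eqType.

(** Cardinality inside a possibly infinite type, witnessed by a duplicate-free list, so that
    predicates involving the existence of an automorphism can stay propositional. *)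
Definition counts T (S : T -> Prop) (N : nat) :=
  exists L : seq T, [/\ uniq L, forall x, S x <-> x \in L & size L = N].

Lemma counts_uniq T (S : T -> Prop) N N' : counts S N -> counts S N' -> N = N'.
Proof.
move=> [L [uL hL <-]] [L' [uL' hL' <-]]; apply: perm_size.
by apply: uniq_perm => // x; apply/idP/idP => [/hL/hL'|/hL'/hL].
Qed.

Lemma counts_image T U (S : T -> Prop) (S' : U -> Prop) (h : T -> U) N :
  counts S N -> (forall x y, S x -> S y -> h x = h y -> x = y) ->
  (forall y, S' y <-> exists2 x, S x & y = h x) -> counts S' N.
Proof.
move=> [L [uL hL <-]] inj im; exists (map h L); split; last by rewrite size_map.
  by rewrite map_inj_in_uniq // => x y /hL Sx /hL Sy; apply: inj.
move=> y; split=> [/im[x /hL Lx ->]|/mapP[x /hL Sx ->]]; first exact: map_f.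
by apply/im; exists x.
Qed.

Lemma counts_ext T (S S' : T -> Prop) N : counts S N -> (forall x, S x <-> S' x) -> counts S' N.
Proof.
by move=> [L [uL hL <-]] e; exists L; split=> // x; rewrite -e.
Qed.

Lemma counts_prod T U (S : T -> Prop) (S' : U -> Prop) N N' : counts S N -> counts S' N' ->
  counts (fun p : T * U => S p.1 /\ S' p.2) (N * N').
Proof.
move=> [L [uL hL <-]] [L' [uL' hL' <-]]; exists [seq (x, y) | x <- L, y <- L'].
split; last by rewrite size_allpairs.
  by apply: allpairs_uniq => // -[a b] [c d] _ _ [-> ->].
move=> [a b]; rewrite /=; split=> [[/hL La /hL' Lb]|/allpairsP[[c d] /= [/hL Sc /hL' Sd [-> ->]]]] //.
by apply/allpairsP; exists (a, b).
Qed.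

Lemma counts_or T (S S' : T -> Prop) N N' : counts S N -> counts S' N' ->
  (forall x, S x -> ~ S' x) -> counts (fun x => S x \/ S' x) (N + N').
Proof.
move=> [L [uL hL <-]] [L' [uL' hL' <-]] dis; exists (L ++ L'); rewrite size_cat; split=> //.
  rewrite cat_uniq uL uL' andbT; apply/hasPn => x /hL' h'; apply/negP => /hL h.
  exact: dis h h'.
move=> x; rewrite mem_cat; split=> [[/hL ->|/hL' ->]|/orP[/hL|/hL']]; rewrite ?orbT //; by [left|right].
Qed.

Lemma counts_none T (S : T -> Prop) : (forall x, ~ S x) -> counts S 0.
Proof. by move=> h; exists [::]; split=> // x; split=> // /h. Qed.

Lemma counts_big T (I : eqType) (r : seq I) (E : I -> T -> Prop) (N : I -> nat) : uniq r ->
  (forall i, i \in r -> counts (E i) (N i)) ->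
  (forall i j x, i \in r -> j \in r -> E i x -> E j x -> i = j) ->
  counts (fun x => exists2 i, i \in r & E i x) (\sum_(i <- r) N i).
Proof.
elim: r => [|i r IH] /=; first by rewrite big_nil => _ _ _; apply: counts_none => x [].
move=> /andP[ir ur] hc dis; rewrite big_cons.
have h1 := hc i (mem_head i r).
have h2 : counts (fun x => exists2 i, i \in r & E i x) (\sum_(j <- r) N j).
  apply: IH => // [j jr|j k x jr kr]; first by apply: hc; rewrite inE jr orbT.
  by apply: dis; rewrite inE ?jr ?kr orbT.
apply: counts_ext (counts_or h1 h2 _) _.
  move=> x Ei [j jr Ej]; move: ir.
  by rewrite (dis i j x) ?jr // ?mem_head // inE jr orbT.
move=> x; split=> [[Ei|[j jr Ej]]|[j]]; first by exists i; rewrite ?mem_head.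
  by exists j => //; rewrite inE jr orbT.
by rewrite inE => /orP[/eqP ->|jr] Ej; [left|right; exists j].
Qed.

Lemma counts_fin (T : finType) : counts (fun _ : T => True) #|T|.
Proof. by exists (enum T); split; [exact: enum_uniq|move=> x; rewrite mem_enum|rewrite -cardE]. Qed.

Lemma counts_pred (T : finType) (P : pred T) : counts (fun x : T => P x) #|P|.
Proof.
exists (enum P); split; [exact: enum_uniq| |by rewrite -cardE].
by move=> x; rewrite mem_enum.
Qed.

End Counts.

Lemma sub_sub_of_addE (V : zmodType) (a b u v : V) : a + u = b + v -> b - a = u - v.
Proof. by move/(congr1 (fun z => z - a - v)); rewrite [a + u]addrC addrK [RHS]addrAC addrK => ->. Qed.

Section CountPairs.
Variable F : finFieldType.
Notation A := (freeAlg2 F).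
Notation q := #|F|.
Implicit Types (f g : A) (c : F).

Lemma pchar_exists : exists p, p \in [pchar F].
Proof. by have [p _ h] := finPcharP F; exists p. Qed.

Definition pairs_eq d n (p : A * A) := [/\ autpair p.1 p.2, fdegree p.1 = d & fdegree p.2 = n].
Definition pairs_lt d n (p : A * A) := [/\ autpair p.1 p.2, fdegree p.1 = d & (fdegree p.2 < n)%N].

Lemma pairs_multiple d n p : (1 < n)%N -> (d <= n)%N -> pairs_eq d n p ->
  exists k c, [/\ (0 < k)%N, c != 0, n = (k * d)%N & pairs_lt d n (p.1, p.2 - c *: p.1 ^+ k)].
Proof.
move=> n1 dn [ap ed en]; have [pr pF] := pchar_exists.
have R := autpair_reduce pF ap; rewrite ed en in R.
have [k [c [k0 nc e lt]]] := R dn n1.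
exists k, c; split=> //; split=> //=.
by rewrite -scaleNr; apply: autpair_elementary.
Qed.

(** The bijection sends [(c, (f, g))] to [(f, g + c f^k)]. Changing [c] alters the part of degree
    [k * d], which a second entry of smaller degree cannot compensate. *)
Lemma counts_pairs_eq d k M : (0 < k)%N -> (1 < k * d)%N -> counts (pairs_lt d (k * d)) M ->
  counts (pairs_eq d (k * d)) (q.-1 * M).
Proof.
move=> k0 kd cM.
have d0 : (0 < d)%N by move: kd; case: (d) => //; rewrite muln0.
have cF : counts (fun c : F => c != 0) q.-1.
  have := counts_pred (fun c : F => c != 0).
  by rewrite (_ : #|_| = q.-1) // -(cardC1 (0 : F)).
pose h (x : F * (A * A)) := (x.2.1, x.2.2 + x.1 *: x.2.1 ^+ k).
have degk c f : c != 0 -> fdegree f = d -> fdegree (c *: f ^+ k) = (k * d)%N.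
  move=> nc df; have nf : f != 0 by apply: fdegree_neq0; rewrite df.
  by rewrite fdegreeZ // (fdegreeX k nf).2 df.
apply: (counts_image (h := h) (counts_prod cF cM)).
  move=> [c [f g]] [c' [f' g']] /= [nc [ap df dg]] [nc' [ap' df' dg']].
  move=> e; have ef : f = f' := congr1 fst e; subst f'.
  have {e}eg : g + c *: f ^+ k = g' + c' *: f ^+ k := congr1 snd e.
  have [ec|ncc] := eqVneq c c'; first by rewrite ec in eg *; rewrite (addIr _ eg).
  have lt : (fdegree ((g' : A) - g)%R < k * d)%N by apply: fdegreeD_lt; rewrite ?fdegreeN.
  have e1 : (g' : A) - g = (c - c') *: f ^+ k by rewrite scalerBl; apply: sub_sub_of_addE.
  have nd : c - c' != 0 by rewrite subr_eq0.
  by move: lt; rewrite e1 (degk _ _ nd df) ltnn.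
move=> [f g]; split=> [P|[[c [f' g']] /= [nc [ap df dg]] [-> ->]]].
  have [||k' [c [k0' nc ek [ap df dg]]]] := pairs_multiple _ _ P => //.
    by rewrite leq_pmull.
  have ekk : k' = k by apply/eqP; rewrite -(eqn_pmul2r d0) -ek.
  subst k'; exists (c, (f, g - c *: f ^+ k)); last by rewrite /h /= subrK.
  by split.
split=> //=; first exact: autpair_elementary.
by rewrite addrC fdegreeDl degk.
Qed.

(** By the reduction no degree lies strictly between [k * d] and [k.+1 * d], so the [M] pairs are
    joined by the [q.-1 * M] pairs of degree exactly [k * d]. *)
Lemma counts_pairs_lt_succ d k M : (0 < k)%N -> (1 < k * d)%N -> counts (pairs_lt d (k * d)) M ->
  counts (pairs_lt d (k.+1 * d)) (q * M).
Proof.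
move=> k0 kd cM; have cE := counts_pairs_eq k0 kd cM.
have q0 : (0 < q)%N by apply/card_gt0P; exists 0.
have d0 : (0 < d)%N by move: kd; case: (d) => //; rewrite muln0.
rewrite -(prednK q0) [(_.+1 * M)%N]mulSn; apply: counts_ext (counts_or cM cE _) _.
  by move=> p [_ _ lt] [_ _ e]; rewrite e ltnn in lt.
move=> p; split=> [[[ap df dg]|[ap df dg]]|[ap df dg]].
- by split=> //; apply: leq_trans dg _; rewrite leq_pmul2r.
- by split=> //; rewrite dg ltn_pmul2r.
have [lt|ge] := ltnP (fdegree p.2) (k * d); [by left|right].
have n1 : (1 < fdegree p.2)%N by apply: leq_trans kd ge.
have dn : (d <= fdegree p.2)%N by apply: leq_trans ge; rewrite leq_pmull.
have [k' [c [k0' nc ek _]]] := pairs_multiple n1 dn (And3 ap df erefl).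
split=> //; rewrite ek; congr (_ * _)%N; apply/eqP; rewrite eqn_leq.
by rewrite -ltnS -(ltn_pmul2r d0) -ek dg -(leq_pmul2r d0) -ek ge.
Qed.

Lemma counts_pairs_lt d k M : (1 < d)%N -> counts (pairs_lt d d) M ->
  counts (pairs_lt d (k.+1 * d)) (q ^ k * M).
Proof.
move=> d1 cM; elim: k => [|k IH]; first by rewrite !mul1n.
rewrite expnS -mulnA; apply: counts_pairs_lt_succ => //.
by rewrite mulSn (leq_trans d1) // leq_addr.
Qed.

(** The reduction needs a degree above 1; for [d = 1] the affine pairs, with bound 2, are therefore
    the base of the induction. *)
Lemma counts_pairs_lt1 k M : counts (pairs_lt 1 2) M -> counts (pairs_lt 1 k.+2) (q ^ k * M).
Proof.
move=> cM; elim: k => [|k IH]; first by rewrite mul1n.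
by rewrite expnS -mulnA -[k.+3]muln1; apply: counts_pairs_lt_succ; rewrite ?muln1.
Qed.

Lemma counts_swap (S S' : A * A -> Prop) N : (forall p, S' p <-> S (p.2, p.1)) ->
  counts S N -> counts S' N.
Proof.
move=> e cS; apply: (counts_image (h := fun p : A * A => (p.2, p.1)) cS).
  move=> [a b] [a' b'] _ _ ee; have ea : a = a' := congr1 snd ee.
  by have eb : b = b' := congr1 fst ee; rewrite ea eb.
move=> p; rewrite e; split=> [h|[p' h ->]]; first by exists (p.2, p.1); rewrite -?surjective_pairing.
by rewrite -surjective_pairing.
Qed.

Variable p1 : nat.
Hypothesis count1 : counts (pairs_lt 1 2) (q * p1).

(* pairs_lt 1 1 is empty; a 1 = p1 is instead the value for which
   pairs_lt d (k * d) still has q ^ k.-1 * a d elements when d = 1 < k. *)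
Lemma counts_pairs_rec n (a : nat -> nat) : (1 < n)%N -> a 1%N = p1 ->
  (forall d, (1 < d < n)%N -> counts (pairs_lt d d) (a d)) ->
  counts (pairs_lt n n) (\sum_(d <- divisors n | (d < n)%N) q.-1 * (q ^ (n %/ d).-1 * a d)).
Proof.
move=> n1 a1 ca; rewrite -big_filter.
pose E d (p : A * A) := pairs_eq d n p.
have n0 : (0 < n)%N by apply: ltnW.
have cE : counts (fun p => exists2 d, d \in [seq d <- divisors n | (d < n)%N] & E d p)
    (\sum_(d <- [seq d <- divisors n | (d < n)%N]) q.-1 * (q ^ (n %/ d).-1 * a d)).
  apply: counts_big; first by rewrite filter_uniq ?divisors_uniq.
    move=> d; rewrite mem_filter -dvdn_divisors // => /andP[dn ddn].
    have d0 : (0 < d)%N by rewrite (dvdn_gt0 n0).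
    have en : n = ((n %/ d).-1.+1 * d)%N by rewrite prednK ?divnK // divn_gt0 // dvdn_leq.
    have k1 : (1 < n %/ d)%N by rewrite ltn_divRL // mul1n.
    rewrite {1}/E {1}en; apply: counts_pairs_eq => //; first by rewrite -en.
    have [d1|d1] := ltnP 1 d; first by apply: counts_pairs_lt => //; apply: ca; rewrite d1.
    have e1 : d = 1%N by apply/eqP; rewrite eqn_leq d1.
    subst d; rewrite divn1 muln1 a1 prednK //.
    case: n n1 {en ca E n0 dn ddn k1} => [|[|n]] //= _.
    by rewrite expnSr -mulnA; apply: counts_pairs_lt1.
  by move=> d d' p _ _ [_ <- _] [_ <- _].
apply: counts_swap cE => -[f g] /=; split.
  case=> ap df dg; have ap' := autpair_swap ap.
  have [k [c [k0 nc ek _]]] :=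
    @pairs_multiple (fdegree g) n (g, f) n1 (ltnW dg) (And3 ap' erefl df).
  exists (fdegree g); last by split.
  by rewrite mem_filter dg -dvdn_divisors // ek dvdn_mull.
case=> d; rewrite mem_filter => /andP[dn _] [/= ap df dg].
by split=> //=; [exact: autpair_swap|rewrite df].
Qed.

Lemma counts_pairs_exist : exists a : nat -> nat, [/\ a 1%N = p1,
  forall n, (1 < n)%N -> counts (pairs_lt n n) (a n) &
  forall n, (1 < n)%N -> a n = (\sum_(d <- divisors n | (d < n)%N) q.-1 * (q ^ (n %/ d).-1 * a d))%N].
Proof.
have ex n : exists N, ((n == 1%N) -> N = p1) /\ ((1 < n)%N -> counts (pairs_lt n n) N).
  have [m] := ubnP n; elim: m n => // m IH n lt.
  have [n1|n1] := ltnP 1 n; last first.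
    by exists p1; split=> //; rewrite ltnNge n1.
  have {}IH k : exists N, (k < n)%N -> ((k == 1%N) -> N = p1) /\
      ((1 < k)%N -> counts (pairs_lt k k) N).
    have [kn|kn] := ltnP k n; last by exists 0%N.
    by have [|N hN] := IH k; [apply: leq_trans kn _; rewrite -ltnS|exists N].
  have [b hb] := choice IH.
  exists (\sum_(d <- divisors n | (d < n)%N) q.-1 * (q ^ (n %/ d).-1 * b d))%N.
  split=> [/eqP n1'|_]; first by rewrite n1' in n1.
  apply: counts_pairs_rec => //; first by apply: (hb 1%N n1).1.
  by move=> d /andP[d1 dn]; apply: (hb d dn).2.
have [a ha] := choice ex; exists a.
have a1 : a 1%N = p1 by apply: (ha 1%N).1.
have ca n : (1 < n)%N -> counts (pairs_lt n n) (a n) by apply: (ha n).2.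
split=> // n n1; apply: counts_uniq (ca n n1) (counts_pairs_rec n1 a1 _).
by move=> d /andP[d1 _]; apply: ca.
Qed.

Definition pairs_max n (p : A * A) := autpair p.1 p.2 /\ maxn (fdegree p.1) (fdegree p.2) = n.

(** The maximum is attained by the first entry only, by the second only, or by both:
    [N + N + q.-1 * N]. *)
Lemma counts_pairs_max n N : (1 < n)%N -> counts (pairs_lt n n) N -> counts (pairs_max n) (q.+1 * N).
Proof.
move=> n1 cN.
have q0 : (0 < q)%N by apply/card_gt0P; exists 0.
have cS : counts (fun p : A * A => pairs_lt n n (p.2, p.1)) N by apply: counts_swap cN.
have cE : counts (pairs_eq n n) (q.-1 * N).
  by have := @counts_pairs_eq n 1 N; rewrite mul1n; apply.
have -> : (q.+1 * N = N + (N + q.-1 * N))%N by rewrite -(prednK q0) !mulSn.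
apply: counts_ext (counts_or cN (counts_or cS cE _) _) _.
- by move=> p [_ e lt] [_ e' _]; rewrite /= e' ltnn in lt.
- move=> p [_ e lt] [[_ e' lt']|[_ e' e2]]; last by rewrite e2 ltnn in lt.
  by rewrite /= in e' lt'; rewrite e' ltnn in lt.
move=> p; rewrite /pairs_max; split.
  case=> [[ap e lt]|[[ap e lt]|[ap e e2]]].
  - by split=> //; rewrite e; apply/maxn_idPl/ltnW.
  - by split; [exact: autpair_swap|rewrite e; apply/maxn_idPr/ltnW].
  - by split=> //; rewrite e e2 maxnn.
case=> ap; case: (ltngtP (fdegree p.1) (fdegree p.2)) => h mx.
- by right; left; rewrite -mx; split; [exact: autpair_swap| |].
- by left; rewrite -mx.
- by right; right; rewrite -mx.
Qed.

End CountPairs.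

(** * Affine pairs *)

Lemma scale_lincomb (R : pzRingType) (W : lmodType R) (x y z : W) s t u a b c a' b' c' :
  s *: (a *: x + b *: y + c *: z) + t *: (a' *: x + b' *: y + c' *: z) + u *: z =
  (s * a + t * a') *: x + (s * b + t * b') *: y + (s * c + t * c' + u) *: z.
Proof.
rewrite !scalerDr !scalerA addrACA.
by rewrite (addrACA (_ *: x)) -!scalerDl -[LHS]addrA -scalerDl.
Qed.

Lemma linear_lincomb (R : pzRingType) (W : lmodType R) (phi : W -> W) (x y z : W) (a b c : R) :
  linear phi -> phi (a *: x + b *: y + c *: z) = a *: phi x + b *: phi y + c *: phi z.
Proof.
move=> lp; have p0 : phi 0 = 0 by have := lp (-1) 0 0; rewrite scaler0 addr0 scaleN1r addNr.
have pZ v : phi (c *: v) = c *: phi v by have := lp c v 0; rewrite p0 !addr0.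
by rewrite -addrA lp lp pZ addrA.
Qed.

Section LinearCombination.
Variables (T : eqType) (F : fieldType) (A : nzRingType) (V : wordval T F A) (u v : seq T).
Hypotheses (u1 : size u = 1%N) (v1 : size v = 1%N) (uv : u != v).
Implicit Types a b c : F.

Definition lincomb a b c : A := sc V a * mon V u + sc V b * mon V v + sc V c * mon V [::].

Lemma lincomb_co a b c w :
  co V (lincomb a b c) w = a * (u == w)%:R + b * (v == w)%:R + c * ([::] == w)%:R.
Proof. by rewrite !co_add !co_sc !co_mon. Qed.

Let nu : ([::] == u) = false. Proof. by apply/eqP => e; move: u1; rewrite -e. Qed.
Let nv : ([::] == v) = false. Proof. by apply/eqP => e; move: v1; rewrite -e. Qed.

Lemma lincomb_co_fst a b c : co V (lincomb a b c) u = a.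
Proof. by rewrite lincomb_co eqxx eq_sym (negbTE uv) nu !mulr0 !addr0 mulr1. Qed.

Lemma lincomb_co_snd a b c : co V (lincomb a b c) v = b.
Proof. by rewrite lincomb_co eqxx (negbTE uv) nv !mulr0 addr0 add0r mulr1. Qed.

Lemma lincomb_co_nil a b c : co V (lincomb a b c) [::] = c.
Proof. by rewrite lincomb_co eqxx ![_ == [::]]eq_sym nu nv !mulr0 !add0r mulr1. Qed.

Lemma lincomb_slt a b c : slt V 2 (lincomb a b c).
Proof.
move=> w; rewrite lincomb_co; case: (u =P w) => [<-|_]; first by rewrite u1.
case: (v =P w) => [<-|_]; first by rewrite v1.
by case: ([::] =P w) => [<-|_] //; rewrite !mulr0 !addr0 eqxx.
Qed.

Lemma slt2_lincomb f : (forall w, (size w < 2)%N -> [\/ w = u, w = v | w = [::]]) ->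
  slt V 2 f -> f = lincomb (co V f u) (co V f v) (co V f [::]).
Proof.
move=> hw sf; apply: (co_inj (V := V)) => w.
have [/hw[->|->|->]|ge] := ltnP (size w) 2.
- by rewrite lincomb_co_fst.
- by rewrite lincomb_co_snd.
- by rewrite lincomb_co_nil.
have nz (x : A) : slt V 2 x -> co V x w = 0.
  by move=> sx; apply/eqP/negPn/negP => /sx; rewrite ltnNge ge.
by rewrite !nz //; apply: lincomb_slt.
Qed.
End LinearCombination.

Section Affine.
Variable F : fieldType.
Notation A := (freeAlg2 F).
Notation X := (fx F).
Notation Y := (fy F).
Notation V := (free_wordval F).
Implicit Types (f g : A) (a b c : F) (M : 'M[F]_2).

Definition affine a b c : A := a *: X + b *: Y + c *: 1.

Definition word_x : seq 'I_2 := [:: 0].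
Definition word_y : seq 'I_2 := [:: 1].

Lemma fx_mon : X = mon V word_x.
Proof. by rewrite [RHS]/(word_mon F [:: 0]) /word_mon /fx fmuE. Qed.

Lemma fy_mon : Y = mon V word_y.
Proof. by rewrite [RHS]/(word_mon F [:: 1]) /word_mon /fy fmuE. Qed.

Lemma affineE a b c : affine a b c = lincomb V word_x word_y a b c.
Proof. by rewrite /affine /lincomb -fx_mon -fy_mon -(mon_nil V) -!mul_malgC. Qed.

Lemma affine_coX a b c : co V (affine a b c) word_x = a.
Proof. by rewrite affineE; apply: lincomb_co_fst. Qed.

Lemma affine_coY a b c : co V (affine a b c) word_y = b.
Proof. by rewrite affineE; apply: lincomb_co_snd. Qed.

Lemma affine_co1 a b c : co V (affine a b c) [::] = c.
Proof. by rewrite affineE; apply: lincomb_co_nil. Qed.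

Lemma word_letter (w : seq 'I_2) : (size w < 2)%N -> [\/ w = word_x, w = word_y | w = [::]].
Proof.
case: w => [|i [|j w]] // _; first by constructor 3.
by case: (letter_split i) => ->; [constructor 1|constructor 2].
Qed.

Lemma fdegree_affine a b c : (fdegree (affine a b c) < 2)%N.
Proof. by apply/(fdegree_slt _ (isT : (0 < 2)%N)); rewrite affineE; apply: lincomb_slt. Qed.

Lemma fdegree_lt2 f : (fdegree f < 2)%N -> f = affine (co V f word_x) (co V f word_y) (co V f [::]).
Proof.
move=> /(fdegree_slt _ (isT : (0 < 2)%N)) sf.
by rewrite affineE; apply: slt2_lincomb => // w /word_letter.
Qed.

Lemma affineX : affine 1 0 0 = X.
Proof. by rewrite /affine scale1r !scale0r !addr0. Qed.
Lemma affineY : affine 0 1 0 = Y.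
Proof. by rewrite /affine scale1r !scale0r addr0 add0r. Qed.

Lemma affineD s t u a b c a' b' c' :
  s *: affine a b c + t *: affine a' b' c' + u *: 1 =
  affine (s * a + t * a') (s * b + t * b') (s * c + t * c' + u).
Proof.
exact: scale_lincomb.
Qed.

Lemma algmorph_affine phi s t u : algmorph phi ->
  phi (affine s t u) = s *: phi X + t *: phi Y + u *: 1.
Proof. by case=> lp [p1 _]; rewrite -p1; apply: linear_lincomb. Qed.

Lemma eval_affine a b c a' b' c' s t u :
  eval (affine a b c) (affine a' b' c') (affine s t u) =
  affine (s * a + t * a') (s * b + t * b') (s * c + t * c' + u).
Proof.
by rewrite (algmorph_affine _ _ _ (eval_algmorph _ _)) evalX evalY; apply: affineD.
Qed.

Lemma affine_inj a b c a' b' c' : affine a b c = affine a' b' c' -> [/\ a = a', b = b' & c = c'].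
Proof.
move=> e; split; first by rewrite -(affine_coX a b c) e affine_coX.
  by rewrite -(affine_coY a b c) e affine_coY.
by rewrite -(affine_co1 a b c) e affine_co1.
Qed.

Definition affine_pair M c c' : A * A := (affine (M 0 0) (M 0 1) c, affine (M 1 0) (M 1 1) c').

Lemma affine_pair_inj M M' c c' d d' : affine_pair M c c' = affine_pair M' d d' ->
  [/\ M = M', c = d & c' = d'].
Proof.
move=> e.
have ef : affine (M 0 0) (M 0 1) c = affine (M' 0 0) (M' 0 1) d := congr1 fst e.
have eg : affine (M 1 0) (M 1 1) c' = affine (M' 1 0) (M' 1 1) d' := congr1 snd e.
have [e00 e01 ec] := affine_inj ef; have [e10 e11 ec'] := affine_inj eg.
clear e ef eg; split=> //.
by apply/matrixP => i j; case: (letter_split i) => ->; case: (letter_split j) => ->.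
Qed.

Lemma mul2E M (N : 'M[F]_2) i k : (M *m N) i k = M i 0 * N 0 k + M i 1 * N 1 k.
Proof. by rewrite mxE big_ord_recl big_ord1; congr (_ + M i _ * N _ k); apply/val_inj. Qed.

Lemma affine_pair_autpair M c c' : M \in unitmx ->
  autpair (affine_pair M c c').1 (affine_pair M c c').2.
Proof.
move=> uM; pose N := invmx M.
have NM i k : N i 0 * M 0 k + N i 1 * M 1 k = (i == k)%:R by rewrite -mul2E mulVmx // mxE.
have MN i k : M i 0 * N 0 k + M i 1 * N 1 k = (i == k)%:R by rewrite -mul2E mulmxV // mxE.
(* The translation part of the inverse affine map. *)
pose u i := - (N i 0 * c + N i 1 * c').
have Mu i : M i 0 * u 0 + M i 1 * u 1 = - ((i == 0)%:R * c + (i == 1)%:R * c').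
  by rewrite -!MN /u; ring.
exists (eval (affine_pair M c c').1 (affine_pair M c c').2); split; rewrite ?evalX ?evalY //.
apply: (autpair_eval (f' := affine (N 0 0) (N 0 1) (u 0)) (g' := affine (N 1 0) (N 1 1) (u 1)));
  rewrite eval_affine ?NM ?MN ?Mu /= -1?[X]affineX -1?[Y]affineY; congr affine.
- by rewrite /u subrr.
- by rewrite /u subrr.
- by rewrite mul1r mul0r addr0 addNr.
- by rewrite mul1r mul0r add0r addNr.
Qed.

(** A non-zero vector in the left kernel of [M] gives a linear form that [phi] sends to a constant;
    [phi] sends that constant to itself, contradicting injectivity. *)
Lemma autpair_affine M c c' : autpair (affine_pair M c c').1 (affine_pair M c c').2 -> M \in unitmx.
Proof.
move=> [phi [[lp mp bp] eX eY]]; have hp : algmorph phi by split.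
have h s t u :
    phi (affine s t u) = affine (s * M 0 0 + t * M 1 0) (s * M 0 1 + t * M 1 1) (s * c + t * c' + u).
  have e := algmorph_affine s t u hp.
  rewrite eX in e.
  rewrite eY in e.
  rewrite e.
  exact: affineD.
rewrite -row_free_unit -kermx_eq0; apply/negPn/negP => nk.
have /rowV0Pn[v /sub_kermxP vM nv] := nk.
have vMk k : v 0 0 * M 0 k + v 0 1 * M 1 k = 0.
  transitivity ((v *m M) 0 k); last by rewrite vM mxE.
  by rewrite mxE big_ord_recl big_ord1; congr (_ + v 0 _ * M _ k); apply/val_inj.
have e1 := h (v 0 0) (v 0 1) 0.
have e2 := h 0 0 (v 0 0 * c + v 0 1 * c').
rewrite !vMk addr0 in e1.
rewrite !mul0r !add0r in e2.
have e3 := etrans e1 (esym e2).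
have := bij_inj bp e3.
move/affine_inj => [v0 v1 _]; case/eqP: nv; apply/rowP => i; rewrite mxE.
by case: (letter_split i) => ->.
Qed.

End Affine.

Section CountAffine.
Variable F : finFieldType.
Notation A := (freeAlg2 F).
Notation q := #|F|.
Notation X := (fx F).
Notation Y := (fy F).
Notation V := (free_wordval F).

(** An invertible matrix and a translation: q (q-1)^2 (q+1) times q^2 choices. One factor [q] is
    split off to fit the hypothesis [count1]. *)
Lemma counts_affine : counts (pairs_lt (F := F) 1 2) (q * (q ^ 2 * q.-1 ^ 2 * q.+1)).
Proof.
have -> : (q * (q ^ 2 * q.-1 ^ 2 * q.+1) = #|'GL_2[F]%g| * #|{: F * F}|)%N.
  by rewrite card_GL_2 card_prod; ring.
have cG := counts_prod (counts_pred (mem 'GL_2[F]%g)) (counts_fin {: F * F}).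
refine (@counts_image _ _ _ _ (fun x : {'GL_2[F]} * (F * F) => affine_pair (GLval x.1) x.2.1 x.2.2) _ cG _ _).
  move=> [m [c c']] [m' [d d']] _ _ /= /affine_pair_inj[e -> ->].
  by congr (_, _); apply: val_inj.
move=> p; split.
  case=> ap df dg.
  pose M : 'M[F]_2 := \matrix_(i, j) co V (if i == 0 then p.1 else p.2) (if j == 0 then word_x else word_y).
  have ep : p = affine_pair M (co V p.1 [::]) (co V p.2 [::]).
    rewrite /affine_pair !mxE /= -!fdegree_lt2 ?df -?surjective_pairing //.
  have uM : M \in unitmx by apply: (@autpair_affine _ M (co V p.1 [::]) (co V p.2 [::])); rewrite -ep.
  by exists (Sub M uM, (co V p.1 [::], co V p.2 [::])); rewrite /= ?inE.
case=> -[m [c c']] _ ->; have ap := affine_pair_autpair c c' (valP m).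
split=> //; last exact: fdegree_affine.
by apply/eqP; rewrite eqn_leq (autpair_fdegree_gt0 ap) andbT -ltnS fdegree_affine.
Qed.

Lemma counts_pairs_max1 : counts (pairs_max (F := F) 1) (q ^ 3 * q.-1 ^ 2 * q.+1).
Proof.
have -> : (q ^ 3 * q.-1 ^ 2 * q.+1 = q * (q ^ 2 * q.-1 ^ 2 * q.+1))%N by ring.
apply: counts_ext counts_affine _ => p; split=> [[ap df dg]|[ap e]].
  by split=> //; rewrite df; apply/maxn_idPl; rewrite -ltnS.
have d1 := leq_maxl (fdegree p.1) (fdegree p.2); have d2 := leq_maxr (fdegree p.1) (fdegree p.2).
rewrite e in d1 d2; split=> //.
by apply/eqP; rewrite eqn_leq d1 (autpair_fdegree_gt0 ap).
Qed.

Lemma num_automorphisms_counts n N : counts (pairs_max (F := F) n) N -> num_automorphisms F n = N.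
Proof.
move=> [L [uL hL <-]]; rewrite /num_automorphisms.
have ex (p : A * A) : exists phi : A -> A, p \in L -> 
    [/\ is_alg_automorphism phi, phi X = p.1 & phi Y = p.2].
  case: (boolP (p \in L)) => [/hL[[phi h] _]|_]; first by exists phi.
  by exists id.
have [h hh] := choice ex.
have -> : automorphisms_of_degree F n = [set` [fset h p | p in L]%fset]%classic.
  apply/seteqP; split=> phi /=.
    case=> aphi e; have Lp : (phi X, phi Y) \in L by apply/hL; split=> //; exists phi.
    have [[l m b] eX eY] := hh _ Lp; case: (aphi) => l' m' _.
    apply/imfsetP; exists (phi X, phi Y) => //.
    by apply/funext => z; exact: (algmorph_ext (conj l' m') (conj l m) (esym eX) (esym eY) z).
  case/imfsetP => p /= Lp ->; have [ah eX eY] := hh _ Lp.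
  by split=> //; rewrite eX eY; have /hL[] := Lp.
rewrite set_fsetK card_in_imfset; first by rewrite /= undup_id.
move=> p p' Lp Lp' e; have [_ eX eY] := hh _ Lp; have [_ eX' eY'] := hh _ Lp'.
by rewrite [p]surjective_pairing [p']surjective_pairing -eX -eY -eX' -eY' e.
Qed.

Lemma num_automorphisms_rec : num_automorphisms F 1 = (q ^ 3 * q.-1 ^ 2 * q.+1)%N /\
  exists a : nat -> nat, [/\ a 1%N = (q ^ 2 * q.-1 ^ 2 * q.+1)%N,
  forall n, (1 < n)%N -> num_automorphisms F n = (q.+1 * a n)%N &
  forall n, (1 < n)%N -> a n = (\sum_(d <- divisors n | (d < n)%N) q.-1 * (q ^ (n %/ d).-1 * a d))%N].
Proof.
split; first exact: num_automorphisms_counts counts_pairs_max1.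
have [a [a1 ca ha]] := counts_pairs_exist counts_affine; exists a; split=> // n n1.
exact/num_automorphisms_counts/counts_pairs_max/ca.
Qed.

End CountAffine.

(** * Ordered factorizations and Dirichlet series *)

Section Factorizations.

(* The first argument is fuel. *)
Fixpoint facts_rec (m n : nat) : seq (seq nat) :=
  if m is m'.+1 then
    if n == 1%N then [:: [::]]
    else [seq e :: s | e <- [seq e <- divisors n | (1 < e)%N], s <- facts_rec m' (n %/ e)]
  else [::].

(** For [n = 1] the list holds the empty factorization, the initial value for the recursion on the
    first entry; for [n > 1] that factorization cannot occur, in agreement with
    [ordered_factorizations]. *)
Definition facts n := facts_rec n n.

Lemma divn_divisor_lt n e : (0 < n)%N -> e \in [seq e <- divisors n | (1 < e)%N] ->
  (0 < n %/ e < n)%N.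
Proof.
move=> n0; rewrite mem_filter -dvdn_divisors // => /andP[e1 en].
by rewrite divn_gt0 ?(dvdn_leq n0 en) ?(ltn_Pdiv e1 n0) // ltnW.
Qed.

Lemma facts_rec_fuel m m' n : (0 < n)%N -> (n <= m)%N -> (n <= m')%N -> facts_rec m n = facts_rec m' n.
Proof.
elim: m m' n => [|m IH] [|m'] [|n] // _ nm nm' /=; case: eqP => // _.
congr flatten; apply/eq_in_map => e he.
have /andP[h0 h1] := divn_divisor_lt (ltn0Sn n) he.
by rewrite (IH m') //; lia.
Qed.

Lemma factsE n : (1 < n)%N ->
  facts n = [seq e :: s | e <- [seq e <- divisors n | (1 < e)%N], s <- facts (n %/ e)].
Proof.
case: n => // n n1; rewrite {1}/facts /=; case: eqP => [e|_]; first by rewrite e in n1.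
congr flatten; apply/eq_in_map => e he.
have /andP[h0 h1] := divn_divisor_lt (ltn0Sn n) he.
by congr map; apply: facts_rec_fuel => //; rewrite -ltnS.
Qed.

Lemma facts1 : facts 1 = [:: [::]]. Proof. by []. Qed.

Lemma mem_facts n s : (0 < n)%N -> (s \in facts n) = all (ltn 1) s && (\prod_(m <- s) m == n)%N.
Proof.
elim: s n => [|e s IH] n n0.
  rewrite big_nil /=; have [<-|ne] := eqVneq 1%N n; first by rewrite facts1 mem_seq1.
  rewrite factsE; last by rewrite ltn_neqAle ne.
  by apply/negP => /allpairsPdep[x [y [_ _]]].
rewrite big_cons /=; apply/idP/idP; last first.
  case/andP=> /andP[e1 hs] /eqP en; have e0 : (0 < e)%N by apply: ltnW.
  have s0 : (0 < \prod_(m <- s) m)%N by move: n0; rewrite -en muln_gt0 => /andP[].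
  rewrite factsE; last by rewrite -en (leq_trans e1) // leq_pmulr.
  apply/allpairsPdep; exists e, s; split=> //.
    by rewrite mem_filter e1 -dvdn_divisors // -en dvdn_mulr.
  by rewrite IH -en mulKn // hs eqxx.
have [n1|n1] := ltnP 1 n; last first.
  have -> : n = 1%N by lia.
  by rewrite facts1 mem_seq1.
rewrite factsE // => /allpairsPdep[e' [s' [he hs [ee es]]]]; move: he hs; rewrite -ee -es => he.
have /andP[h0 _] := divn_divisor_lt n0 he.
move: he; rewrite mem_filter -dvdn_divisors // IH // => /andP[-> en] /andP[-> /eqP ->].
by rewrite mulnC divnK ?eqxx.
Qed.

Lemma facts_uniq n : uniq (facts n).
Proof.
have [m] := ubnP n; elim: m n => // m IH n lt.
have [n1|n1] := ltnP 1 n; last by case: n n1 {lt} => [|[]].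
rewrite factsE //; apply: allpairs_uniq_dep.
- by rewrite filter_uniq ?divisors_uniq.
- move=> e he; apply: IH; have /andP[_ h] := divn_divisor_lt (ltnW n1) he.
  by apply: leq_trans h _; rewrite -ltnS.
by move=> [e s] [e' s'] _ _ /= [-> ->].
Qed.

Lemma ordered_factorizationsE n : (1 < n)%N -> ordered_factorizations n = [set` facts n]%classic.
Proof.
move=> n1; apply/seteqP; split=> s /=; rewrite mem_facts ?(ltnW n1) //.
  by case=> _ -> ->; rewrite eqxx.
case/andP=> hs /eqP e; split=> //; case: s e {hs} => //.
by rewrite big_nil => e; rewrite -e in n1.
Qed.

Lemma divisors_codivisors n : (0 < n)%N ->
  perm_eq [seq d <- divisors n | (d < n)%N] [seq (n %/ e)%N | e <- divisors n & (1 < e)%N].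
Proof.
move=> n0; apply: uniq_perm; first by rewrite filter_uniq ?divisors_uniq.
  rewrite map_inj_in_uniq ?filter_uniq ?divisors_uniq // => d e.
  rewrite !mem_filter -!dvdn_divisors // => /andP[_ dn] /andP[_ en] eq.
  have /divnK e1 := dn; have /divnK e2 := en; have c0 : (0 < n %/ e)%N by rewrite divn_gt0 ?(dvdn_leq n0 en) // (dvdn_gt0 n0).
  by apply/eqP; rewrite -(eqn_pmul2l c0) e2 -eq e1.
move=> d; rewrite mem_filter -dvdn_divisors //; apply/idP/idP.
  case/andP=> dn dd; apply/mapP; exists (n %/ d)%N; last by rewrite divnA // mulKn.
  have d0 := dvdn_gt0 n0 dd.
  by rewrite mem_filter -dvdn_divisors // dvdn_div // ltn_divRL // mul1n dn.
case/mapP => e; rewrite mem_filter -dvdn_divisors // => /andP[e1 en] ->.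
by rewrite dvdn_div // ltn_Pdiv.
Qed.

Lemma big_codivisors (R : nmodType) n (f : nat -> R) : (0 < n)%N ->
  \sum_(d <- divisors n | (d < n)%N) f d = \sum_(e <- divisors n | (1 < e)%N) f (n %/ e)%N.
Proof.
by move=> n0; rewrite -big_filter (perm_big _ (divisors_codivisors n0)) big_map big_filter.
Qed.

Lemma big_divisors1 (R : nmodType) n (f : nat -> R) : (0 < n)%N ->
  \sum_(e <- divisors n) f e = f 1%N + \sum_(e <- divisors n | (1 < e)%N) f e.
Proof.
move=> n0; rewrite (bigD1_seq 1%N) ?divisor1 ?divisors_uniq //=; congr (_ + _).
rewrite big_seq_cond [RHS]big_seq_cond; apply: eq_bigl => e.
case: (boolP (e \in divisors n)) => //=; rewrite -dvdn_divisors // => en.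
by have := dvdn_gt0 n0 en; lia.
Qed.

End Factorizations.

Section FactorizationSums.
Variables (R : comNzRingType) (v : nat -> R).

Definition facts_sum n : R := \sum_(s <- facts n) \prod_(e <- s) v e.

Lemma facts_sum1 : facts_sum 1 = 1.
Proof. by rewrite /facts_sum facts1 big_seq1 big_nil. Qed.

Lemma facts_sum_rec n : (1 < n)%N ->
  facts_sum n = \sum_(e <- divisors n | (1 < e)%N) v e * facts_sum (n %/ e)%N.
Proof.
move=> n1; rewrite /facts_sum factsE // big_allpairs_dep /= big_filter.
apply: eq_bigr => e _; rewrite big_distrr /=; apply: eq_bigr => s _.
by rewrite big_cons.
Qed.

Lemma facts_sum_unique (b : nat -> R) :
  (forall n, (1 < n)%N -> b n = \sum_(e <- divisors n | (1 < e)%N) v e * b (n %/ e)%N) ->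
  forall n, (0 < n)%N -> b n = b 1%N * facts_sum n.
Proof.
move=> hb n; have [m] := ubnP n; elim: m n => // m IH n lt n0.
have [n1|n1] := ltnP 1 n; last first.
  by have -> : n = 1%N by [lia]; rewrite facts_sum1 mulr1.
rewrite hb // facts_sum_rec // big_distrr /= -big_filter -[RHS]big_filter.
apply: eq_big_seq => e he.
have /andP[h0 h1] := divn_divisor_lt n0 he.
by rewrite IH //; [exact: mulrCA|lia].
Qed.

End FactorizationSums.

Section Dirichlet.

Lemma dmul_divisors (a b : nat -> rat) k :
  dmul (dseries a) (dseries b) k = \sum_(e <- divisors k.+1) a e * b (k.+1 %/ e)%N.
Proof.
rewrite /dmul /dseries.
pose G (e : nat) : rat := if (e %| k.+1)%N then a e * b (k.+1 %/ e)%N else 0.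
transitivity (\sum_(i < k.+1) G i.+1).
  apply: eq_bigr => i _; rewrite /G; case: ifPn => [dv|nd]; last first.
    rewrite big1 // => j /eqP e; case/negP: nd.
    by apply/dvdnP; exists j.+1; rewrite mulnC; apply: esym.
  have lt : ((k.+1 %/ i.+1).-1 < k.+1)%N.
    by apply: (@leq_ltn_trans (k.+1 %/ i.+1).-1) => //; have := leq_div k.+1 i.+1; lia.
  have d0 : (0 < k.+1 %/ i.+1)%N by rewrite divn_gt0 // dvdn_leq.
  rewrite (bigD1 (Ordinal lt)) /=; last by rewrite prednK // mulnC divnK.
  rewrite prednK // big1 ?addr0 // => j /andP[/eqP e /eqP ne]; case: ne.
  by apply: val_inj; have /= := congr1 (divn^~ i.+1) e; rewrite mulKn // => <-.
rewrite -(big_mkord xpredT (fun i => G i.+1)) -(big_add1 _ _ 0 k.+2 xpredT G).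
rewrite /G -big_mkcond -big_filter; apply: perm_big; apply: uniq_perm.
- by rewrite filter_uniq ?iota_uniq.
- exact: divisors_uniq.
move=> e; rewrite mem_filter mem_index_iota -dvdn_divisors //.
by case: (boolP (e %| k.+1)%N) => //= dv; rewrite (dvdn_gt0 _ dv) // ltnS dvdn_leq.
Qed.

Lemma dconst_mul c (x : dirichlet) k : (dconst c * x) k = c * x k.
Proof.
apply: (etrans (dmul_divisors (fun n => c *+ (n == 1)%N) (fun n => x n.-1) k)); rewrite big_divisors1 //.
rewrite divn1 /= mulr1n big1 ?addr0 // => e e1.
by rewrite (_ : e == 1%N = false) ?mulr0n ?mul0r // gtn_eqF.
Qed.

(** Formally [facts_sum] is the geometric series in [r * rho]; its recursion on the first entry says
    that the convolution with [1 - r * rho] vanishes beyond the first coefficient. *)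
Lemma dseries_facts_sum_inv (q : nat) (r : rat) :
  dseries (facts_sum (fun e => r * q%:R ^+ e)) * (1 - dconst r * rho q) = 1.
Proof.
set v := fun e : nat => _; set b : nat -> rat := fun e => if e == 1%N then 1 else - v e.
have -> : 1 - dconst r * rho q = dseries b.
  apply: dseriesP => k.
  rewrite [LHS]/(dconst 1 k - (dconst r * rho q) k) dconst_mul /rho /dconst /dseries /b /v eqSS.
  by case: k => [|k]; [exact: (etrans (congr1 (fun z => 1 - z) (mulr0 r)) (subr0 1))|exact: sub0r].
rewrite mulrC; apply/funext => k.
apply: (etrans (dmul_divisors b (facts_sum v) k)).
rewrite big_divisors1 // divn1 {1}/b /= mul1r.
rewrite [RHS]/(1 *+ _) eqSS; case: k => [|k].
  by rewrite facts_sum1 (_ : divisors 1 = [:: 1%N]) // big_cons big_nil /= addr0.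
rewrite facts_sum_rec // -big_split /= big1 // => e e1.
by rewrite /b (gtn_eqF e1) mulNr subrr.
Qed.

End Dirichlet.

(** * Bounds *)

Lemma leq_sum_prod (s : seq nat) : s != [::] -> all (ltn 1) s -> (\sum_(m <- s) m <= \prod_(m <- s) m)%N.
Proof.
elim: s => // e s IH _ /= /andP[e1 hs]; rewrite !big_cons.
have [->|ns] := eqVneq s [::]; first by rewrite !big_nil addn0 muln1.
have le := IH ns hs.
have s2 : (1 < \sum_(m <- s) m)%N.
  case: s ns hs {IH le} => // m s _ /= /andP[m1 _]; rewrite big_cons.
  exact: leq_trans m1 (leq_addr _ _).
move: le s2; move: (\sum_(m <- s) m)%N (\prod_(m <- s) m)%N => x y; nia.
Qed.

(* This is (e - 2) * (m - 2) >= 0 for n = e * m, since the entries after the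
   first have product m and sum at most m. *)
Lemma facts_long n s : (1 < n)%N -> s \in facts n -> s != [:: n] ->
  (1 < size s)%N /\ (2 * \sum_(m <- s) m <= n + 4)%N.
Proof.
move=> n1; rewrite mem_facts ?(ltnW n1) // => /andP[hs /eqP en] ns.
case: s hs en ns => [_|e [|e' s] hs en ns]; first by rewrite big_nil => e; rewrite -e in n1.
  by case/eqP: ns; rewrite -en big_seq1.
split=> //; move: hs => /= /andP[e1 hs].
have le := @leq_sum_prod (e' :: s) isT hs.
have m1 : (1 < \prod_(m <- e' :: s) m)%N.
  have /= /andP[h _] := hs; apply: leq_trans le; rewrite big_cons.
  exact: leq_trans h (leq_addr _ _).
move: en le m1; rewrite big_cons [X in (2 * X)%N]big_cons.
move: (\sum_(m <- e' :: s) m)%N (\prod_(m <- e' :: s) m)%N => x y; nia.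
Qed.

Lemma inv_sqr_le (R : realFieldType) (x : R) : 0 < x -> ((x + 1) ^+ 2)^-1 <= x^-1 - (x + 1)^-1.
Proof.
move=> x0; have x1 : 0 < x + 1 by lra.
have -> : x^-1 - (x + 1)^-1 = (x * (x + 1))^-1 by field; rewrite !gt_eqF.
by rewrite lef_pV2 ?posrE ?exprn_gt0 ?mulr_gt0 // expr2 ler_pM2r; lra.
Qed.

Lemma sum_inv_sqr (n : nat) :
  \sum_(2 <= e < n.+2) (e%:R ^+ 2)^-1 <= 1 - (n.+1%:R)^-1 :> rat.
Proof.
elim: n => [|n IH]; first by rewrite big_geq // invr1 subrr.
rewrite big_nat_recr //=.
have x0 : 0 < n.+1%:R :> rat by rewrite ltr0n.
have := lerD IH (inv_sqr_le x0); rewrite natr1.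
by rewrite [1 - _ + _]addrA subrK.
Qed.

Lemma size_factsE (R : comNzRingType) n : (size (facts n))%:R = facts_sum (fun _ => 1) n :> R.
Proof.
rewrite /facts_sum (eq_bigr (fun _ => 1)); first by rewrite big_const_seq count_predT iter_addr_0.
by move=> s _; rewrite big1.
Qed.

(** By induction on the first entry, the count is at most n^2 times the sum of 1 / e^2 over divisors
    e > 1, and by telescoping the sum over all e >= 2 is at most 1. *)
Lemma size_facts_le n : (0 < n)%N -> (size (facts n) <= n ^ 2)%N.
Proof.
have [m] := ubnP n; elim: m n => // m IH n lt n0.
have [n1|n1] := ltnP 1 n; last by have -> : n = 1%N by lia.
have n0' : n%:R != 0 :> rat by rewrite pnatr_eq0 -lt0n.
rewrite -(ler_nat rat) size_factsE facts_sum_rec //.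
apply: (@le_trans _ _ (\sum_(e <- divisors n | (1 < e)%N) n%:R ^+ 2 * (e%:R ^+ 2)^-1)).
  rewrite -big_filter -[leRHS]big_filter big_seq [leRHS]big_seq; apply: ler_sum => e he.
  have /andP[h0 h1] := divn_divisor_lt n0 he.
  rewrite mul1r -size_factsE -exprVn -exprMn.
  move: he; rewrite mem_filter -dvdn_divisors // => /andP[e1 en].
  have -> : n%:R / e%:R = (n %/ e)%:R :> rat.
    by rewrite natf_div.
  by rewrite -natrX ler_nat IH //; lia.
rewrite -big_distrr /= natrX ler_piMr ?sqr_ge0 //.
apply: (@le_trans _ _ (\sum_(2 <= e < n.+1) (e%:R ^+ 2)^-1)); last first.
  have := sum_inv_sqr n.-1; rewrite prednK // => h; apply: (le_trans h).
  by rewrite gerBl invr_ge0.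
rewrite -[leLHS]big_filter.
have -> : \sum_(e <- [seq e <- divisors n | (1 < e)%N]) (e%:R ^+ 2)^-1 =
    \sum_(2 <= e < n.+1 | (e %| n)%N) (e%:R ^+ 2)^-1 :> rat.
  rewrite -[RHS]big_filter; apply: perm_big; apply: uniq_perm.
  - by rewrite filter_uniq ?divisors_uniq.
  - by rewrite filter_uniq ?iota_uniq.
  move=> e; rewrite !mem_filter mem_index_iota -dvdn_divisors // ltnS andbC.
  by case: (boolP (e %| n)%N) => //= dv; rewrite (dvdn_leq n0 dv) andbT.
by rewrite big_mkcond; apply: ler_sum => e _; case: ifP => // _; rewrite invr_ge0 sqr_ge0.
Qed.

(** Below 16 the bound n^2 exceeds the power of the logarithm, so the counts are computed. Without
    the trivial factorization they are at most 0, 2 and 7, to be compared with 0, 2^2 and 3^3. *)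
Lemma size_facts_small n : (1 < n < 16)%N ->
  (size (facts n) <= if (n < 4)%N then 1 else if (n < 8)%N then 3 else 8)%N.
Proof.
have : all (fun n => (size (facts n) <= if (n < 4)%N then 1 else if (n < 8)%N then 3 else 8)%N)
  (iota 2 14) by vm_compute.
by move=> /allP h /andP[n1 n2]; apply: h; rewrite mem_iota n1.
Qed.

Section FactsSumBounds.
Variables (K : realFieldType) (q : nat) (r : K).
Hypothesis r0 : 0 <= r.

Lemma facts_weight (s : seq nat) : \prod_(e <- s) (r * q%:R ^+ e) =
  r ^+ size s * q%:R ^+ (\sum_(m <- s) m)%N.
Proof.
elim: s => [|e s IH]; first by rewrite !big_nil mulr1.
by rewrite !big_cons IH exprS exprD mulrACA.
Qed.

Lemma facts_sum_split n : (1 < n)%N -> facts_sum (fun e => r * q%:R ^+ e) n = r * q%:R ^+ n +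
  \sum_(s <- facts n | s != [:: n]) r ^+ size s * q%:R ^+ (\sum_(m <- s) m)%N.
Proof.
move=> n1; rewrite /facts_sum (bigD1_seq [:: n]) ?facts_uniq //=; last first.
  by rewrite mem_facts ?(ltnW n1) //= n1 big_seq1 eqxx.
by rewrite big_seq1; congr (_ + _); apply: eq_bigr => s _; apply: facts_weight.
Qed.

Lemma facts_sum_ge n : (1 < n)%N -> r * q%:R ^+ n <= facts_sum (fun e => r * q%:R ^+ e) n.
Proof.
move=> n1; rewrite facts_sum_split // lerDl; apply: sumr_ge0 => s _.
by rewrite mulr_ge0 ?exprn_ge0.
Qed.

Lemma facts_sum_le n B : (1 < n)%N -> 
  (forall k m, (1 < k)%N -> (2 * m <= n + 4)%N -> r ^+ k * q%:R ^+ m <= B) ->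
  facts_sum (fun e => r * q%:R ^+ e) n <= r * q%:R ^+ n + (size (facts n)).-1%:R * B.
Proof.
move=> n1 hB; rewrite facts_sum_split // lerD2l.
have mn : [:: n] \in facts n by rewrite mem_facts ?(ltnW n1) //= n1 big_seq1 eqxx.
have -> : (size (facts n)).-1%:R * B = \sum_(s <- facts n | s != [:: n]) B.
  have e : (size (facts n))%:R * B = B + \sum_(s <- facts n | s != [:: n]) B.
    rewrite -(bigD1_seq [:: n] (F := fun _ => B)) ?facts_uniq //=.
    by rewrite big_const_seq count_predT iter_addr_0 mulr_natl.
  have s0 : (0 < size (facts n))%N by case: (facts n) mn.
  by move: e; rewrite -(prednK s0) -natr1 mulrDl mul1r addrC => /addrI.
rewrite big_seq_cond [leRHS]big_seq_cond; apply: ler_sum => s /andP[hs ns].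
by have [h1 h2] := facts_long n1 hs ns; apply: hB.
Qed.

End FactsSumBounds.

Section Count.
Variable F : finFieldType.
Notation q := #|F|.
Notation p := (num_automorphisms F).

Lemma num_automorphisms1 (K : numFieldType) :
  (p 1)%:R = q%:R ^+ 3 * (q%:R - 1) ^+ 2 * (q%:R + 1) :> K.
Proof.
have [-> _] := num_automorphisms_rec F.
have q0 : (0 < q)%N by apply/card_gt0P; exists 0.
by rewrite natrM natrM !natrX -(natrB _ q0) -natr1 subn1.
Qed.

(** The prefactor is [q.+1 * a 1], and each weight [q.-1 * q ^ e.-1] in the recursion is (q-1)/q
    times q^e. *)
Lemma num_automorphisms_facts (K : numFieldType) n : (1 < n)%N ->
  (p n)%:R = (q%:R * (q%:R - 1) * (q%:R + 1)) ^+ 2 *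
    facts_sum (fun e => (q%:R - 1) / q%:R * q%:R ^+ e) n :> K.
Proof.
move=> n1; have [_ [a [a1 -> // ha]]] := num_automorphisms_rec F.
have q0 : (0 < q)%N by apply/card_gt0P; exists 0.
have qK : q%:R != 0 :> K by rewrite pnatr_eq0 -lt0n.
rewrite natrM (@facts_sum_unique _ (fun e => (q%:R - 1) / q%:R * q%:R ^+ e) (fun n => (a n)%:R)) //; last first.
- exact: ltnW.
- move=> {n1}n n1; rewrite ha // natr_sum (big_codivisors _ (ltnW n1)) -big_filter -[RHS]big_filter.
  apply: eq_big_seq => e; rewrite mem_filter -dvdn_divisors ?(ltnW n1) // => /andP[e1 en].
  rewrite divnA // mulKn ?(ltnW n1) // !natrM natrX -subn1 natrB // mulrA.
  congr (_ * _); rewrite -[e in RHS]prednK ?(ltnW e1) // exprS.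
  by rewrite mulrA divfK.
rewrite a1 natrM natrM !natrX -natr1 -subn1 natrB // mulrA; congr (_ * _); ring.
Qed.

End Count.

(** * Estimates with logarithms and real powers *)

Section Logarithm.
Variable R : realType.

Lemma log2_ge (n m : nat) : (2 ^ m <= n)%N -> m%:R <= log2 (n%:R : R).
Proof.
move=> h; have l2 : 0 < ln (2 : R) by rewrite ln_gt0 // ltr1n.
rewrite /log2 ler_pdivlMr // mulr_natl -lnXn // ler_ln ?posrE ?exprn_gt0 //.
  by rewrite -natrX ler_nat.
by rewrite ltr0n (leq_trans _ h) // expn_gt0.
Qed.

Lemma log2_powR_ge (n m : nat) : (0 < m)%N -> (2 ^ m <= n)%N ->
  m%:R ^+ m <= log2 (n%:R : R) `^ log2 (n%:R : R).
Proof.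
move=> m0 h; have le := log2_ge h.
rewrite -powR_mulrn //; apply: (@le_trans _ _ (m%:R `^ log2 (n%:R : R))).
  by apply: ler_powR => //; rewrite ler1n.
by apply: ge0_ler_powR => //; rewrite ?nnegrE ?(le_trans _ le).
Qed.

(** n^2 is 4 to the power [log2 n], and [log2 n] is at least 4. *)
Lemma sqr_le_log2_powR n : (16 <= n)%N -> n%:R ^+ 2 <= log2 (n%:R : R) `^ log2 (n%:R : R).
Proof.
move=> h; have le := @log2_ge n 4 h; set L := log2 _ in le *.
have l2 : 0 < ln (2 : R) by rewrite ln_gt0 // ltr1n.
have n0 : 0 < n%:R :> R by rewrite ltr0n; lia.
have -> : n%:R ^+ 2 = 4 `^ L.
  rewrite (_ : 4 = 2 ^+ 2); last by rewrite -natrX.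
  rewrite -[2 ^+ 2]powR_mulrn // -powRrM mulrC powRrM powR_mulrn ?powR_ge0 //; congr (_ ^+ 2).
  by rewrite /powR gt_eqF // /L /log2 divfK ?lnK ?gt_eqF.
by apply: ge0_ler_powR => //; rewrite ?nnegrE; lra.
Qed.

Lemma size_facts_log2 n : (1 < n)%N ->
  (size (facts n)).-1%:R <= log2 (n%:R : R) `^ log2 (n%:R : R).
Proof.
move=> n1; have [n16|n16] := leqP 16 n.
  apply: le_trans (sqr_le_log2_powR n16); rewrite -natrX ler_nat.
  by apply: leq_trans (leq_pred _) (size_facts_le _); apply: ltnW.
have /size_facts_small : (1 < n < 16)%N by rewrite n1.
case: ltnP => n4 h.
  by rewrite (_ : (size (facts n)).-1 = 0%N) ?powR_ge0 //; lia.
case: ltnP h => n8 h.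
  by apply: (le_trans _ (@log2_powR_ge n 2 isT n4)); rewrite -natrX ler_nat; lia.
by apply: (le_trans _ (@log2_powR_ge n 3 isT n8)); rewrite -natrX ler_nat; lia.
Qed.

Lemma sqr_le_expR (x : R) : 0 <= x -> x ^+ 2 / 4 <= expR x.
Proof.
move=> x0; have h : x / 2 <= expR (x / 2).
  by apply: le_trans (expR_ge1Dx _); rewrite lerDr.
have -> : x = 2%:R * (x / 2) by rewrite mulrC divfK.
rewrite expRM_natl; set y := x / 2 in h *.
have y0 : 0 <= y by rewrite divr_ge0.
by apply: (@le_trans _ _ (y ^+ 2)); [lra|rewrite lerXn2r // nnegrE expR_ge0].
Qed.

(** Taking x = n eps ln q in x^2 / 4 <= exp x absorbs n^2 into q^(n eps). *)
Lemma powR_error (q : R) (eps : R) (n : nat) : 1 < q -> 0 < eps ->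
  n%:R ^+ 2 * q `^ (n%:R / 2 + 8) <=
    4 / (eps * ln q) ^+ 2 * q ^+ 8 * q `^ (n%:R * (1 / 2 + eps)).
Proof.
move=> q1 e0; have lq : 0 < ln q by apply: ln_gt0.
have q0 : 0 < q by lra.
have -> : n%:R * (1 / 2 + eps) = n%:R / 2 + n%:R * eps by ring.
have hD x y : q `^ (x + y) = q `^ x * q `^ y by rewrite powRD // (gt_eqF q0) implybT.
rewrite 2!(hD (n%:R / 2)) powR_mulrn ?(ltW q0) //.
set u := q `^ _; set w := q `^ _; set c := eps * ln q.
have c0 : 0 < c by rewrite mulr_gt0.
have -> : 4 / c ^+ 2 * q ^+ 8 * (u * w) = (4 / c ^+ 2 * w) * (u * q ^+ 8) by ring.
rewrite ler_wpM2r ?mulr_ge0 ?powR_ge0 ?exprn_ge0 ?(ltW q0) //.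
have ew : w = expR (n%:R * c) by rewrite /w /powR gt_eqF // /c mulrA.
have := @sqr_le_expR (n%:R * c); rewrite mulr_ge0 ?(ltW c0) // => /(_ isT); rewrite -ew => h.
rewrite mulrAC ler_pdivlMr ?exprn_gt0 // -exprMn; lra.
Qed.

End Logarithm.

Lemma leading_term (K : fieldType) (x y : K) : x != 0 ->
  (x - 1) ^+ 3 * (x + 1) ^+ 2 * (x * y) = (x * (x - 1) * (x + 1)) ^+ 2 * ((x - 1) / x * y).
Proof. by move=> hx; field. Qed.

Lemma error_term (K : fieldType) (x : K) : x != 0 ->
  (x * (x - 1) * (x + 1)) ^+ 2 * ((x - 1) / x) ^+ 2 = (x - 1) ^+ 2 * ((x - 1) * (x + 1)) ^+ 2.
Proof. by move=> hx; field. Qed.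

Lemma affine_term (K : fieldType) (x : K) : x + 1 != 0 ->
  x ^+ 3 * (x - 1) ^+ 2 * (x + 1) = (x * (x - 1) * (x + 1)) ^+ 2 * (1 - 1 / (x + 1)).
Proof. by move=> hx; field. Qed.

(** * The two-sided bound and the asymptotic formula *)

Section Bounds.
Variables (R : realType) (F : finFieldType).
Notation q := #|F|.
Notation qR := (q%:R : R).
Notation p := (num_automorphisms F).
Notation main n := ((qR - 1) ^+ 3 * (qR + 1) ^+ 2 * qR ^+ n.+1).

Lemma qR_gt1 : 1 < qR.
Proof. by rewrite ltr1n; apply: finNzRing_gt1. Qed.

Lemma num_automorphisms_ge n : (1 < n)%N -> main n <= (p n)%:R.
Proof.
move=> n1; rewrite num_automorphisms_facts //; have q1 := qR_gt1; have q0 : 0 < qR by lra.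
set r := (qR - 1) / qR; have r0 : 0 <= r by rewrite divr_ge0 //; lra.
have := facts_sum_ge q r0 n1; set g := facts_sum _ _ => h.
have -> : main n = (qR * (qR - 1) * (qR + 1)) ^+ 2 * (r * qR ^+ n).
  by rewrite (exprS qR n); apply: leading_term; rewrite gt_eqF.
by rewrite ler_wpM2l // exprn_even_ge0.
Qed.

Lemma num_automorphisms_le n : (1 < n)%N ->
  (p n)%:R <= main n + (size (facts n)).-1%:R * qR `^ (n%:R / 2 + 8).
Proof.
move=> n1; rewrite num_automorphisms_facts //; have q1 := qR_gt1; have q0 : 0 < qR by lra.
set C := _ ^+ 2; set r := (qR - 1) / qR; have r0 : 0 <= r by rewrite divr_ge0 //; lra.
have r1 : r <= 1 by rewrite /r ler_pdivrMr // mul1r; lra.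
have C0 : 0 <= C by rewrite exprn_even_ge0.
have e1 : main n = C * (r * qR ^+ n).
  by rewrite (exprS qR n); apply: leading_term; rewrite gt_eqF.
have hB k m : (1 < k)%N -> (2 * m <= n + 4)%N ->
    r ^+ k * qR ^+ m <= r ^+ 2 * qR `^ (n%:R / 2 + 2).
  move=> k1 hm; apply: ler_pM; rewrite ?exprn_ge0 ?(ltW q0) //.
    by rewrite ler_wiXn2l.
  rewrite -powR_mulrn ?(ltW q0) //; apply: ler_powR; first exact: ltW.
  have : (2 * m)%:R <= (n + 4)%:R :> R by rewrite ler_nat.
  by rewrite natrM natrD; lra.
have := facts_sum_le n1 hB; set g := facts_sum _ _ => h.
rewrite e1; apply: (@le_trans _ _ (C * (r * qR ^+ n + (size (facts n)).-1%:R * (r ^+ 2 * qR `^ (n%:R / 2 + 2))))).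
  by rewrite ler_wpM2l.
rewrite mulrDr lerD2l mulrCA ler_wpM2l //.
(* The 8 is 2 + 6: a factorization of length at least two has sum at most n/2 + 2, and the prefactor
   times r^2 is (q-1)^4 (q+1)^2, at most q^6. *)
have -> : n%:R / 2 + 8 = 6%:R + (n%:R / 2 + 2) :> R by lra.
rewrite [in leRHS]powRD ?(gt_eqF q0) ?implybT // powR_mulrn ?(ltW q0) // mulrA.
rewrite ler_wpM2r ?powR_ge0 //.
have -> : C * r ^+ 2 = ((qR - 1) ^+ 2) * ((qR - 1) * (qR + 1)) ^+ 2.
  by apply: error_term; rewrite gt_eqF.
have -> : qR ^+ 6 = qR ^+ 2 * (qR * qR) ^+ 2 by ring.
have h2 : 0 <= (qR - 1) * (qR + 1) by apply: mulr_ge0; lra.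
apply: ler_pM; rewrite ?exprn_ge0 //; lra.
Qed.

Lemma num_automorphisms_bigO (eps : R) : 0 < eps ->
  (fun n : nat => (p n)%:R : R^o) =
    (fun n => main n : R^o) +O_\oo (fun n => qR `^ (n%:R * (1 / 2 + eps)) : R^o).
Proof.
move=> e0; apply/eqaddOP/bigO_exP; have q1 := qR_gt1; have lq := ln_gt0 q1.
exists (4 / (eps * ln qR) ^+ 2 * qR ^+ 8).
  by rewrite mulr_gt0 ?exprn_gt0 ?divr_gt0 ?mulr_gt0 //; lra.
exists 2%N => // n /= n2; rewrite [leLHS]ger0_norm; last by rewrite subr_ge0; apply: num_automorphisms_ge.
rewrite (ger0_norm (powR_ge0 _ _)).
apply: le_trans (powR_error n q1 e0); rewrite lerBlDl.
apply: le_trans (num_automorphisms_le n2) _; rewrite lerD2l ler_wpM2r ?powR_ge0 //.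
rewrite -natrX ler_nat; apply: leq_trans (leq_pred _) (size_facts_le _); exact: ltnW.
Qed.

End Bounds.

(** The constant 1/(q+1) corrects only n = 1, where p_1 is q/(q+1) times the common prefactor. *)
Lemma num_automorphisms_dirichlet (F : finFieldType) (q' := #|F|%:R : rat) :
  dseries (fun n => (num_automorphisms F n)%:R) =
    dconst ((q' * (q' - 1) * (q' + 1)) ^+ 2) *
      (1 / (1 - dconst ((q' - 1) / q') * rho #|F|) - dconst (1 / (q' + 1))).
Proof.
set r := (q' - 1) / q'; set C := _ ^+ 2.
have e := dseries_facts_sum_inv #|F| r.
set B := 1 - _ in e *; set g := facts_sum _ in e.
have -> : 1 / B = dseries g.
  by rewrite -e mulrK //; apply: one_sub_rho_unit.
apply/funext => k; rewrite [RHS]dconst_mul.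
rewrite [X in _ = _ * X]/(dseries g k - dconst (1 / (q' + 1)) k) /dseries /dconst /dseries.
have q0 : 0 < q' by rewrite ltr0n; apply/card_gt0P; exists 0.
case: k => [|k].
  rewrite num_automorphisms1 /g facts_sum1 mulr1n; apply: affine_term.
  by rewrite gt_eqF // ltr_wpDl // ltW.
by rewrite [X in _ = _ * X](subr0 (g k.+2)) num_automorphisms_facts.
Qed.

Theorem mainTheorem5 (R : realType) (q : nat) (F : finFieldType)
    (hq : #|F| = q) :
  let p := num_automorphisms F in
  let q' : rat := q%:R in
  let qR : R := q%:R in
  [/\ (* (i) *)
      (p 1%N)%:R = q' ^+ 3 * (q' - 1) ^+ 2 * (q' + 1) /\
      (forall n : nat, (1 < n)%N ->
         (p n)%:R = (q' * (q' - 1) * (q' + 1)) ^+ 2 *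
           \sum_(s \in ordered_factorizations n)
             ((q' - 1) / q') ^+ size s * q' ^+ (\sum_(m <- s) m)%N),
      (* (ii) *)
      dseries (fun n => (p n)%:R) =
        dconst ((q' * (q' - 1) * (q' + 1)) ^+ 2) *
          (1 / (1 - dconst ((q' - 1) / q') * rho q) - dconst (1 / (q' + 1)))
    & (* (iii) *)
      (forall n : nat, (2 <= n)%N ->
         (qR - 1) ^+ 3 * (qR + 1) ^+ 2 * qR ^+ n.+1 <= (p n)%:R /\
         (p n)%:R <= (qR - 1) ^+ 3 * (qR + 1) ^+ 2 * qR ^+ n.+1 +
           log2 (n%:R : R) `^ log2 (n%:R : R) * qR `^ (n%:R / 2 + 8)) /\
      (forall eps : R, 0 < eps ->
         (fun n : nat => (p n)%:R : R^o) =
           (fun n => (qR - 1) ^+ 3 * (qR + 1) ^+ 2 * qR ^+ n.+1 : R^o)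
           +O_\oo (fun n => qR `^ (n%:R * (1 / 2 + eps)) : R^o))].
Proof.
subst q; move=> p q' qR; split.
- split=> [|n n1]; first exact: num_automorphisms1.
  rewrite [LHS]num_automorphisms_facts // ordered_factorizationsE //.
  rewrite -fsbig_seq ?facts_uniq //; congr (_ * _).
  by apply: eq_bigr => s _; apply: facts_weight.
- exact: num_automorphisms_dirichlet.
split=> [n n2|eps]; last exact: num_automorphisms_bigO.
split; first exact: num_automorphisms_ge.
apply: (le_trans (num_automorphisms_le _ _ n2)); rewrite lerD2l ler_wpM2r ?powR_ge0 //.
exact: size_facts_log2.
Qed.
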